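(* Let $p$ be a prime number, let $n,l$ be positive integers, let $A$ be a $\mathbb{Z}_{(p)}/(p^n)$-algebra, and let $\lambda\in A$. Assume that for each integer $0\le k\le l-1$ the element $p^{l-k}\lambda^{p^k}$ is divisible by $\lambda^{p^l}$ in $A$ and that the quotient $p^{l-k}\lambda^{p^k}/\lambda^{p^l}$ is nilpotent (if $\lambda=0$, this quotient is by convention $0$). Let $N_l=\mathrm{Ker}\big[\psi^{(l)}:\mathcal{G}^{(\lambda)}\to\mathcal{G}^{(\lambda^{p^l})}\big]$, where $\psi^{(l)}(x)=\lambda^{-p^l}\{(1+\lambda x)^{p^l}-1\}$, and let $\boldsymbol{a}:=\lambda^{-p^l}p^l[\lambda]\in W(A)$. Then the Cartier dual of the finite group scheme $N_l$ is canonically isomorphic to $$\mathrm{Ker}\big[\,\overline{F^{(\lambda)}}: W_A/T_{\boldsymbol{a}}\longrightarrow W_A/T'_{\boldsymbol{a}}\,\big],\qquad T'_{\boldsymbol{a}}:=F^{(\lambda)}\circ T_{\boldsymbol{a}}.$$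
   Context: **The group scheme $\mathcal{G}^{(\lambda)}$.** For a ring $A$ and $\lambda\in A$, $\mathcal{G}^{(\lambda)}=\mathrm{Spec}\,A[X,1/(1+\lambda X)]$ with group law $x\cdot y=x+y+\lambda xy$, so that $x\mapsto 1+\lambda x$ is a homomorphism $\mathcal{G}^{(\lambda)}\to\mathbb{G}_{m,A}$. **The homomorphism $\psi^{(l)}$ and $N_l$.** Write $q_k:=p^{l-k}\lambda^{p^k}/\lambda^{p^l}$ for $0\le k\le l-1$ (so $q_k\lambda^{p^l}=p^{l-k}\lambda^{p^k}$; $q_k:=0$ if $\lambda=0$). The expression $\lambda^{-p^l}\{(1+\lambda X)^{p^l}-1\}$ is read by means of these quotients: it is the monic polynomial $\psi^{(l)}(X)=X^{p^l}+\sum_{j=1}^{p^l-1}\lambda^{-p^l}\binom{p^l}{j}\lambda^jX^j$, where, with $v=v_p(j)<l$, the coefficient $\lambda^{-p^l}\binom{p^l}{j}\lambda^j$ means $p^{-(l-v)}\binom{p^l}{j}\cdot\lambda^{j-p^v}q_v$ (here $p^{-(l-v)}\binom{p^l}{j}\in\mathbb{Z}$). The map $\psi^{(l)}:\mathcal{G}^{(\lambda)}\to\mathcal{G}^{(\lambda^{p^l})}$ is a homomorphism, and its kernel $N_l=\mathrm{Spec}\,A[X]/(\psi^{(l)}(X))$ is a finite group scheme of order $p^l$ over $A$. The Cartier dual of $N_l$ is the group scheme of homomorphisms $N_l\to\mathbb{G}_{m}$, i.e. $B\mapsto \mathrm{Hom}_{B\text{-gp}}(N_{l,B},\mathbb{G}_{m,B})$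 for $A$-algebras $B$. **Witt vectors.** $W$ is the ring scheme of $p$-typical Witt vectors of infinite length, $W_A$ its base change to $A$; $\Phi_m(\boldsymbol{x})=x_0^{p^m}+px_1^{p^{m-1}}+\dots+p^mx_m$ are the Witt (phantom) polynomials; $[\lambda]=(\lambda,0,0,\dots)$ is the Teichmüller lift. - $F:W\to W$ is the endomorphism characterized (universally over $\mathbb{Z}$) by $\Phi_m(F(\boldsymbol{x}))=\Phi_{m+1}(\boldsymbol{x})$. - $F^{(\lambda)}:=F-[\lambda^{p-1}]$, i.e. $F^{(\lambda)}(\boldsymbol{x})=F(\boldsymbol{x})-[\lambda^{p-1}]\cdot\boldsymbol{x}$, an additive endomorphism of $W_A$. - For $\boldsymbol{a}=(a_0,a_1,\dots)\in W(A)$, $T_{\boldsymbol{a}}:W_A\to W_A$ is the additive endomorphism characterized (universally over $\mathbb{Z}$, by integral polynomials in the components of $\boldsymbol{a}$ and $\boldsymbol{x}$) by $$\Phi_m(T_{\boldsymbol{a}}(\boldsymbol{x}))=a_0^{p^m}\Phi_m(\boldsymbol{x})+p\,a_1^{p^{m-1}}\Phi_{m-1}(\boldsymbol{x})+\dots+p^m a_m\Phi_0(\boldsymbol{x})\qquad(m\ge 0).$$ **The vector $\boldsymbol{a}=\lambda^{-p^l}p^l[\lambda]$.** It is obtained by dividing each component of the Witt vector $p^l[\lambda]$ by $\lambda^{p^l}$. Explicitly, let $(c_0,c_1,\dots)\in W(\mathbb{Z})$ be the components of the integer $p^l\in W(\mathbb{Z})$, so that $p^l[\lambda]=(c_k\lambda^{p^k})_{k\ge0}$;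 for $k\le l$ the integer $c_k$ is divisible by $p^{l-k}$. Then $a_k=(c_k/p^{l-k})\,q_k$ for $0\le k\le l-1$, and $a_k=c_k\lambda^{p^k-p^l}$ for $k\ge l$ (with $\lambda^0=1$). **Quotients.** $W_A/T_{\boldsymbol{a}}$ and $W_A/T'_{\boldsymbol{a}}$ denote the cokernels of $T_{\boldsymbol{a}}$ and $T'_{\boldsymbol{a}}=F^{(\lambda)}\circ T_{\boldsymbol{a}}$; on points, $W(A)/T_{\boldsymbol{a}}=\mathrm{Coker}[T_{\boldsymbol{a}}:W(A)\to W(A)]$ and $W(A)/T'_{\boldsymbol{a}}=\mathrm{Coker}[T'_{\boldsymbol{a}}:W(A)\to W(A)]$, and similarly for points in any $A$-algebra $B$. The map $\overline{F^{(\lambda)}}:W_A/T_{\boldsymbol{a}}\to W_A/T'_{\boldsymbol{a}}$ is the well-defined homomorphism $\overline{\boldsymbol{x}}\mapsto\overline{F^{(\lambda)}(\boldsymbol{x})}$.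
   Formalization: The theorem assumes explicitly that ψ^(l) is a homomorphism of group schemes; this can fail under the stated hypotheses (A = Z/p², l = 1, λ = 0, ψ = X^p), and then N_l is not a group scheme and has no Cartier dual. *)

(* Defs.v *)
From HB Require Import structures.
From mathcomp Require Import all_boot all_order all_algebra.
From mathcomp Require Import generic_quotient qpoly finmap monalg boolp.

Set Implicit Arguments.
Unset Strict Implicit.
Unset Printing Implicit Defensive.

Import GRing.Theory.
Local Open Scope ring_scope.

Definition ghost (p : nat) (R : comNzRingType) (x : nat -> R) (m : nat) : R :=
  \sum_(i < m.+1) x i ^+ (p ^ (m - i)) *+ p ^ i.

(* The ring Z[x_(i,j)] in countably many vectors (x_(i,0), x_(i,1), ...) of
   indeterminates, in which the universal operations on Witt vectors live. *)
Definition upoly := {malg int[{cmonom (nat * nat)%type}]}.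
HB.instance Definition _ := GRing.ComNzRing.on upoly.

HB.lock Definition uvar (i j : nat) : upoly := mkmalgU (ucm (i, j)) 1.

Section Eval.
Variables (B : comNzRingType) (v : nat -> nat -> B).

Definition cmeval (m : {cmonom (nat * nat)%type}) : B :=
  \prod_(k <- finsupp m) v k.1 k.2 ^+ m k.

Lemma cmevalw (d : {fset (nat * nat)%type}) (m : {cmonom (nat * nat)%type}) : (finsupp m `<=` d)%fset ->
  cmeval m = \prod_(k <- d) v k.1 k.2 ^+ m k.
Proof.
move=> sub; rewrite /cmeval (big_fset_incl _ sub) // => k _ kn.
by move: kn; rewrite -cmE_eq0 => /eqP ->; rewrite expr0.
Qed.

Lemma cmeval_is_mmorphism : mmorphism cmeval.
Proof.
split=> [m1 m2|]; last by rewrite /cmeval mdom1 big_seq_fset0.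
rewrite (@cmevalw (finsupp m1 `|` finsupp m2)%fset (mmul m1 m2)) ?mdomD //.
rewrite (cmevalw (fsubsetUl (finsupp m1) (finsupp m2))).
rewrite (cmevalw (fsubsetUr (finsupp m1) (finsupp m2))) -big_split /=.
by apply: eq_bigr => k _; rewrite cmM exprD.
Qed.

HB.instance Definition _ := isMultiplicative.Build _ B cmeval
  cmeval_is_mmorphism.

Definition ueval (f : upoly) : B := mmap (intmul (1 : B)) cmeval f.

HB.instance Definition _ := GRing.RMorphism.copy ueval
  (mmap (intmul (1 : B)) cmeval).

Lemma uevalD f g : ueval (f + g) = ueval f + ueval g.
Proof. exact: (rmorphD ueval). Qed.

Lemma uevalN f : ueval (- f) = - ueval f.
Proof. exact: (rmorphN ueval). Qed.

Lemma uevalM f g : ueval (f * g) = ueval f * ueval g.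
Proof. exact: (rmorphM ueval). Qed.

Lemma ueval_var i j : ueval (uvar i j) = v i j.
Proof.
rewrite /ueval uvar.unlock mmapU /= mul1r /cmeval mdomU big_seq_fset1.
by rewrite cmUU expr1.
Qed.

End Eval.


Lemma rmorph_ueval (B B' : comNzRingType) (h : {rmorphism B -> B'})
  (v : nat -> nat -> B) (f : upoly) :
  h (ueval v f) = ueval (fun i j => h (v i j)) f.
Proof.
rewrite /ueval !mmapE rmorph_sum; apply: eq_bigr => m _.
rewrite rmorphM rmorph_int /cmeval rmorph_prod; congr (_ * _).
by apply: eq_bigr => k _; rewrite rmorphXn.
Qed.

Lemma rmorph_ghost (p : nat) (B B' : comNzRingType) (h : {rmorphism B -> B'})
  (x : nat -> B) m : h (ghost p x m) = ghost p (fun i => h (x i)) m.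
Proof.
by rewrite rmorph_sum; apply: eq_bigr => i _; rewrite rmorphMn rmorphXn.
Qed.

Lemma eq_ghost (p : nat) (R : comNzRingType) (x y : nat -> R) m :
  (forall i, (i <= m)%N -> x i = y i) -> ghost p x m = ghost p y m.
Proof. by move=> e; apply: eq_bigr => i _; rewrite e // -ltnS. Qed.

Lemma ghostS (p : nat) (R : comNzRingType) (x : nat -> R) m :
  ghost p x m.+1 = ghost p (fun i => x i ^+ p) m + x m.+1 *+ p ^ m.+1.
Proof.
rewrite /ghost big_ord_recr /= subnn expn0 expr1; congr (_ + _).
by apply: eq_bigr => i _; rewrite -exprM -expnS subSn // -ltnS.
Qed.

Lemma mkmalgU_uvar (m : {cmonom (nat * nat)%type}) :
  mkmalgU m 1 = cmeval uvar m.
Proof.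
have UM (a b : {cmonom (nat * nat)%type}) :
    (mkmalgU a 1 : upoly) * mkmalgU b 1 = mkmalgU (mmul a b) 1.
  by rewrite [_ * _]malgM_def fgmulUU mulr1.
have UX (a : {cmonom (nat * nat)%type}) n :
    (mkmalgU a 1 : upoly) ^+ n = mkmalgU (iter n (mmul a) mone) 1.
  elim: n => [|n IH]; first by rewrite expr0 -mpolyC1E.
  rewrite exprS IH UM iterS; reflexivity.
have xE (a : {cmonom (nat * nat)%type}) n k :
    (iter n (mmul a) mone) k = (n * a k)%N.
  elim: n => [|n IH]; first by rewrite cm1.
  by rewrite iterS cmM IH mulSn.
have prodE (s : seq (nat * nat)) :
    \prod_(k <- s) uvar k.1 k.2 ^+ m k =
    mkmalgU (\big[mmul/mone]_(k <- s) iter (m k) (mmul (ucm k)) mone) 1.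
  elim: s => [|k s IH]; first by rewrite !big_nil.
  rewrite !big_cons IH uvar.unlock -surjective_pairing UX UM; reflexivity.
rewrite /cmeval prodE.
set M := (X in _ = mkmalgU X _); suff -> : M = m by reflexivity.
apply/eqP/cmP => i; rewrite /M.
have -> (s : seq (nat * nat)) :
    (\big[mmul/mone]_(k <- s) iter (m k) (mmul (ucm k)) mone) i
    = (\sum_(k <- s) m k * (k == i))%N.
  elim: s => [|k s IH]; first by rewrite !big_nil cm1.
  by rewrite !big_cons cmM IH xE cmU.
case: (boolP (i \in finsupp m)) => [im|im].
  rewrite (big_fsetD1 i) //= eqxx muln1 big1_fset ?addn0 // => k.
  by rewrite !inE => /andP[/negPf -> _] _; rewrite muln0.
rewrite big1_fset => [|k km _].
  by apply/esym/eqP; rewrite cmE_eq0.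
by case: eqP km im => [-> ->|]; rewrite ?muln0.
Qed.

Section Congruence.
Variable R : comNzRingType.

Definition cong (n : nat) (a b : R) := exists h : R, a - b = h *+ n.

Lemma cong_refl n a : cong n a a.
Proof. by exists 0; rewrite subrr mul0rn. Qed.

Lemma cong_sym n a b : cong n a b -> cong n b a.
Proof. by case=> h e; exists (- h); rewrite mulNrn -e opprB. Qed.

Lemma cong_eqr n a b c : cong n a b -> c = b -> cong n a c.
Proof. by move=> ab ->. Qed.

Lemma cong_trans n a b c : cong n a b -> cong n b c -> cong n a c.
Proof.
by case=> h e [k e']; exists (h + k); rewrite mulrnDl -e -e' addrA subrK.
Qed.

Lemma congD n a b c d : cong n a b -> cong n c d -> cong n (a + c) (b + d).
Proof.
by case=> h e [k e']; exists (h + k); rewrite mulrnDl -e -e' addrACA opprD.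
Qed.

Lemma congN n a b : cong n a b -> cong n (- a) (- b).
Proof. by case=> h e; exists (- h); rewrite mulNrn -e opprD. Qed.

Lemma congM n a b c d : cong n a b -> cong n c d -> cong n (a * c) (b * d).
Proof.
case=> h e [k e']; exists (h * c + b * k).
by rewrite mulrnDl -mulrnAl -mulrnAr -e -e' mulrBl mulrBr addrA subrK.
Qed.

Lemma congX n a b k : cong n a b -> cong n (a ^+ k) (b ^+ k).
Proof.
move=> ab; elim: k => [|k IH]; first exact: cong_refl.
by rewrite !exprS; apply: congM.
Qed.

Lemma cong_sum n (I : Type) (r : seq I) (P : pred I) (F G : I -> R) :
  (forall i, P i -> cong n (F i) (G i)) ->
  cong n (\sum_(i <- r | P i) F i) (\sum_(i <- r | P i) G i).
Proof.
move=> FG; elim/big_ind2: _ => //; first exact: cong_refl.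
by move=> *; apply: congD.
Qed.

Lemma congMn m n a b : cong n a b -> cong (m * n) (a *+ m) (b *+ m).
Proof. by case=> h e; exists h; rewrite -mulrnBl e -mulrnA mulnC. Qed.

Lemma cong_mulrn n a : cong n (a *+ n) 0.
Proof. by exists a; rewrite subr0. Qed.

Lemma cong_pow_step p k a b : cong (p ^ k.+1) a b ->
  cong (p ^ k.+2) (a ^+ p) (b ^+ p).
Proof.
move=> ab; have [h e] := ab.
have abp : cong p a b.
  by exists (h *+ p ^ k); rewrite e -mulrnA expnSr.
have [t et] : cong p (\sum_(i < p) a ^+ (p.-1 - i) * b ^+ i) 0.
  apply: (@cong_trans _ _ (\sum_(i < p) b ^+ p.-1)); last first.
    by rewrite sumr_const card_ord; apply: cong_mulrn.
  apply: cong_sum => i _.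
  have -> : b ^+ p.-1 = b ^+ (p.-1 - i) * b ^+ i.
    rewrite -exprD subnK //; case: (p) i => [|q] i; first by case: i.
    by rewrite -ltnS.
  by apply: congM; [apply: congX | apply: cong_refl].
exists (h * t); rewrite subrXX.
rewrite (eq_bigr (fun i : 'I_p => a ^+ (p.-1 - i) * b ^+ i)); last first.
  by move=> i _; rewrite -subn1 -subnDA add1n.
by rewrite e -[X in _ * X]subr0 et mulrnAl mulrnAr -!mulrnA -expnS.
Qed.

Lemma cong_pow p k a b : cong p a b -> cong (p ^ k.+1) (a ^+ (p ^ k)) (b ^+ (p ^ k)).
Proof.
move=> ab; elim: k => [|k IH]; first by rewrite expn0 !expr1 expn1.
by rewrite [(p ^ k.+1)%N]expnSr !exprM; apply: cong_pow_step.
Qed.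

Lemma cong_freshman p a b : prime p ->
  cong p ((a + b) ^+ p) (a ^+ p + b ^+ p).
Proof.
case: p => [//|q] pp; rewrite exprDn big_ord_recl big_ord_recr /=.
rewrite subn0 bin0 mulr1n expr0 mulr1.
rewrite /bump /= add1n subnn binn mulr1n expr0 mul1r.
apply: congD; first exact: cong_refl.
rewrite -[X in cong _ _ X]add0r; apply: congD; last exact: cong_refl.
rewrite [X in cong _ _ X](_ : _ = \sum_(i < q) 0); last by rewrite big1.
apply: cong_sum => i _.
have /dvdnP[c ->] : (q.+1 %| 'C(q.+1, 1 + i))%N.
  by apply: prime_dvd_bin => //; rewrite add1n /= ltnS.
by rewrite mulrnA; apply: cong_mulrn.
Qed.

Lemma cong_oppX p (a : R) : prime p -> cong p (- a ^+ p) ((- a) ^+ p).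
Proof.
move=> pp; have := cong_freshman a (- a) pp.
rewrite subrr expr0n eqn0Ngt prime_gt0 //= => h.
by have := congD h (cong_refl p (- a ^+ p)); rewrite addrAC subrr !add0r.
Qed.

End Congruence.

Definition udiv (n : nat) (f : upoly) : upoly :=
  [malg k in msupp f => (mcoeff k f %/ n%:Z)%Z].

Lemma udivK n (h : upoly) : (0 < n)%N -> udiv n (h *+ n) = h.
Proof.
move=> n0; apply/malgP => k; rewrite /udiv mcoeffE.
have hk : (mcoeff k (h *+ n) %/ n%:Z)%Z = mcoeff k h.
  rewrite mcoeffMn -mulr_natr natz mulzK //.
  by rewrite -lt0n in n0 *; case: (n) n0.
case: ifP => [_|/negbT kn]; first exact: hk.
by rewrite -hk mcoeff_outdom // div0z.
Qed.

Lemma upoly_mulrn_inj n (f g : upoly) : (0 < n)%N -> f *+ n = g *+ n -> f = g.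
Proof. by move=> n0 e; rewrite -(udivK f n0) e udivK. Qed.

Section Universal.
Variable p : nat.

(* [wsol g] is the sequence of polynomials s with [ghost p s m = g m] for all
   m, obtained by solving for s_m; the divisions are exact for the g used
   below, see [ghost_wsol]. *)
Fixpoint wsols (g : nat -> upoly) (n : nat) : seq upoly :=
  if n is m.+1 then
    let s := wsols g m in
    rcons s (udiv (p ^ m)
      (g m - \sum_(i < m) nth 0 s i ^+ (p ^ (m - i)) *+ p ^ i))
  else [::].

Definition wsol (g : nat -> upoly) (m : nat) : upoly := nth 0 (wsols g m.+1) m.

Lemma size_wsols g n : size (wsols g n) = n.
Proof. by elim: n => //= n IH; rewrite size_rcons IH. Qed.

Lemma nth_wsols g n i : (i < n)%N -> nth 0 (wsols g n) i = wsol g i.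
Proof.
elim: n => [//|n IH]; rewrite ltnS leq_eqVlt => /orP[/eqP -> //|lt].
by rewrite -IH //= nth_rcons size_wsols lt.
Qed.

Lemma wsolE g m : wsol g m = udiv (p ^ m)
  (g m - \sum_(i < m) wsol g i ^+ (p ^ (m - i)) *+ p ^ i).
Proof.
rewrite {1}/wsol [wsols g m.+1]/wsols -/wsols nth_rcons size_wsols ltnn eqxx.
apply: (congr1 (fun t => udiv (p ^ m) (g m - t))).
apply: eq_bigr => i _.
rewrite (nth_wsols _ (ltn_ord i)).
reflexivity.
Qed.

Definition ufrob : upoly -> upoly := ueval (fun i j => uvar i j ^+ p).
HB.instance Definition _ := GRing.RMorphism.on ufrob.

Lemma ufrob_var i j : ufrob (uvar i j) = uvar i j ^+ p.
Proof. exact: ueval_var. Qed.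

Definition dwork (g : nat -> upoly) :=
  forall m, cong (p ^ m.+1) (g m.+1) (ufrob (g m)).

Hypothesis pp : prime p.

Lemma ufrobP f : cong p (ufrob f) (f ^+ p).
Proof.
pose C (a : upoly) := cong p (ufrob a) (a ^+ p).
have C1 : C 1 by rewrite /C rmorph1 expr1n; apply: cong_refl.
have C0 : C 0.
  rewrite /C rmorph0 expr0n eqn0Ngt (prime_gt0 pp); exact: cong_refl.
have CD a b : C a -> C b -> C (a + b).
  move=> Ca Cb; rewrite /C rmorphD.
  by apply: (cong_trans (congD Ca Cb)); apply/cong_sym/cong_freshman.
have CN a : C a -> C (- a).
  move=> Ca; rewrite /C rmorphN.
  apply: (cong_trans (congN Ca)).
  exact: cong_oppX.
have CM a b : C a -> C b -> C (a * b).
  move=> Ca Cb; rewrite /C rmorphM exprMn; exact: (congM Ca Cb).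
have CV i j : C (uvar i j).
  rewrite /C /ufrob ueval_var; exact: cong_refl.
have CX a n : C a -> C (a ^+ n).
  move=> Ca; elim: n => [|n IH]; first exact: C1.
  rewrite exprS; exact: (CM _ _ Ca IH).
have Cn n : C n%:R.
  elim: n => [|n IH]; first exact: C0.
  rewrite -addn1 natrD; exact: (CD _ _ IH C1).
have Cz (z : int) : C z%:~R.
  case: z => n; rewrite ?NegzE ?rmorphN /=; last apply: CN; exact: Cn.
have Cprod (r : seq (nat * nat)) (m : {cmonom (nat * nat)%type}) :
    C (\prod_(k <- r) uvar k.1 k.2 ^+ m k).
  elim: r => [|k r IH]; first by rewrite big_nil; exact: C1.
  rewrite big_cons; exact: (CM _ _ (CX _ _ (CV _ _)) IH).
have Cmon m (c : int) : C (mkmalgU m c).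
  have -> : mkmalgU m c = c%:~R * mkmalgU m 1 :> upoly.
    rewrite mulrzl -raddfMz intz; reflexivity.
  rewrite mkmalgU_uvar; exact: (CM _ _ (Cz _) (Cprod _ _)).
have Csum (r : seq {cmonom (nat * nat)%type}) :
    C (\sum_(m <- r) mkmalgU m (mcoeff m f)).
  elim: r => [|k r IH]; first by rewrite big_nil; exact: C0.
  rewrite big_cons; exact: (CD _ _ (Cmon _ _) IH).
have := Csum (msupp f); rewrite -monalgE; exact: id.
Qed.

Lemma ghost_wsol g m : dwork g -> ghost p (wsol g) m = g m.
Proof.
move=> dg; elim: m => [|m IH].
  rewrite /ghost big_ord_recl big_ord0 addr0 /= expr1 wsolE big_ord0 subr0.
  by rewrite -{1}[g 0%N]mulr1n udivK.
rewrite ghostS wsolE.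
rewrite (_ : \sum_(i < m.+1) _ = ghost p (fun i => wsol g i ^+ p) m); last first.
  apply: eq_bigr => i _; rewrite -exprM -expnS subSn // -ltnS //.
have [h e] : cong (p ^ m.+1) (g m.+1) (ghost p (fun i => wsol g i ^+ p) m).
  apply: (cong_trans (dg m)); rewrite -IH rmorph_ghost.
  apply: cong_sum => i _; have im : (i <= m)%N by rewrite -ltnS.
  rewrite -{1}(subnKC im) -addnS expnD; apply: congMn.
  exact/cong_pow/ufrobP.
by rewrite e udivK ?expn_gt0 ?prime_gt0 // addrC -e subrK.
Qed.

End Universal.

Definition gvar (p i : nat) : nat -> upoly := ghost p (uvar i).

HB.lock Definition gadd (p m : nat) : upoly := gvar p 0 m + gvar p 1 m.
HB.lock Definition gopp (p m : nat) : upoly := - gvar p 0 m.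
HB.lock Definition gmul (p m : nat) : upoly := gvar p 0 m * gvar p 1 m.
HB.lock Definition gfrob (p m : nat) : upoly := gvar p 0 m.+1.
HB.lock Definition gT (p m : nat) : upoly :=
  \sum_(k < m.+1) (uvar 0 k ^+ (p ^ (m - k)) * gvar p 1 (m - k)%N) *+ p ^ k.

Section Dwork.
Variable p : nat.

Lemma cong_dvd (R : comNzRingType) m n (a b : R) :
  (m %| n)%N -> cong n a b -> cong m a b.
Proof. by case/dvdnP=> k -> [h e]; exists (h *+ k); rewrite e mulrnA. Qed.

Lemma dwork_gvar i : dwork p (gvar p i).
Proof.
move=> m; rewrite /gvar ghostS rmorph_ghost.
rewrite -[X in cong _ _ X]addr0; apply: congD; last exact: cong_mulrn.
rewrite (@eq_ghost p _ _ (fun j => ufrob p (uvar i j))); first exact: cong_refl.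
by move=> j _; rewrite /ufrob ueval_var.
Qed.

Lemma dwork_gadd : dwork p (gadd p).
Proof.
move=> m; rewrite gadd.unlock rmorphD; apply: congD; exact (dwork_gvar _ m).
Qed.

Lemma dwork_gopp : dwork p (gopp p).
Proof.
move=> m; rewrite gopp.unlock rmorphN; apply: congN; exact (dwork_gvar _ m).
Qed.

Lemma dwork_gmul : dwork p (gmul p).
Proof.
move=> m; rewrite gmul.unlock rmorphM; apply: congM; exact (dwork_gvar _ m).
Qed.

Lemma dwork_gfrob : dwork p (gfrob p).
Proof.
move=> m; rewrite gfrob.unlock; apply: cong_dvd (dwork_gvar 0 m.+1).
exact: dvdn_exp2l.
Qed.

Lemma dwork_gT : dwork p (gT p).
Proof.
move=> m; rewrite gT.unlock big_ord_recr.
rewrite -[X in cong _ _ X]addr0; apply: congD; last exact: cong_mulrn.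
rewrite rmorph_sum; apply: cong_sum => k _.
have km : (k <= m)%N by rewrite -ltnS.
rewrite rmorphMn rmorphM rmorphXn.
apply: (@cong_eqr _ _ _
  ((uvar 0 k ^+ p) ^+ (p ^ (m - k)) * ufrob p (gvar p 1 (m - k)%N) *+ p ^ k)).
  rewrite -exprM -expnS (subSn km) -{1}(subnKC km) -addnS expnD.
  apply: congMn; apply: congM; first exact: cong_refl.
  exact: (dwork_gvar 1 (m - k)%N).
apply: (congr1 (fun t => t ^+ _ * _ *+ _)); exact: ufrob_var.
Qed.

End Dwork.

(* p-typical Witt vectors; the primality proof is a parameter of the type so
   that the ring structure can be canonical. *)
Record witt (p : nat) (p_pr : prime p) (B : comNzRingType) :=
  Witt { wcoef :> nat -> B }.

HB.instance Definition _ p (p_pr : prime p) (B : comNzRingType) :=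
  gen_eqMixin (witt p_pr B).
HB.instance Definition _ p (p_pr : prime p) (B : comNzRingType) :=
  gen_choiceMixin (witt p_pr B).

Definition wvars (p : nat) (p_pr : prime p) (B : comNzRingType)
    (x y z : witt p_pr B) (i j : nat) : B :=
  match i with 0%N => x j | 1%N => y j | _ => z j end.

(* The operation with ghost components [g], evaluated at x, y, z. *)
HB.lock Definition wop (p : nat) (p_pr : prime p) (g : nat -> upoly)
    (B : comNzRingType) (x y z : witt p_pr B) : witt p_pr B :=
  Witt p_pr (fun m => ueval (wvars x y z) (wsol p g m)).

Section WittOperations.
Variables (p : nat) (p_pr : prime p).
Local Notation W := (witt p_pr).

Lemma wittP (B : comNzRingType) (x y : W B) : x =1 y -> x = y.
Proof. by case: x y => [x] [y] /= e; congr Witt; apply/funext. Qed.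

Definition wmap (B B' : comNzRingType) (h : B -> B') (x : W B) : W B' :=
  Witt p_pr (fun m => h (x m)).

Lemma ghost_wop g (B : comNzRingType) (x y z : W B) m : dwork p g ->
  ghost p (wop g x y z) m = ueval (wvars x y z) (g m).
Proof. by move=> dg; rewrite wop.unlock -(ghost_wsol p_pr m dg) rmorph_ghost. Qed.

Lemma wmap_wop g (B B' : comNzRingType) (h : {rmorphism B -> B'})
  (x y z : W B) : wmap h (wop g x y z) = wop g (wmap h x) (wmap h y) (wmap h z).
Proof.
rewrite wop.unlock; apply: wittP => m /=; rewrite rmorph_ueval.
apply: (congr1 (fun v => ueval v _)).
by apply/funext=> -[|[|i]]; apply/funext => j.
Qed.

Definition wzero (B : comNzRingType) : W B := Witt p_pr (fun=> 0).
Definition teich (B : comNzRingType) (c : B) : W B :=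
  Witt p_pr (fun m => if m is 0%N then c else 0).
Definition wadd (B : comNzRingType) (x y : W B) := wop (gadd p) x y y.
Definition wopp (B : comNzRingType) (x : W B) := wop (gopp p) x x x.
Definition wmul (B : comNzRingType) (x y : W B) := wop (gmul p) x y y.
Definition wfrob (B : comNzRingType) (x : W B) := wop (gfrob p) x x x.
Definition wT (B : comNzRingType) (a x : W B) := wop (gT p) a x x.

Lemma ueval_gvar (B : comNzRingType) (v : nat -> nat -> B) i m :
  ueval v (gvar p i m) = ghost p (v i) m.
Proof.
rewrite rmorph_ghost; apply: eq_ghost => j _; exact: ueval_var.
Qed.

Section GhostRules.
Variable B : comNzRingType.
Implicit Types x y a : W B.

Lemma ghost_zero m : ghost p (wzero B) m = 0.
Proof.
rewrite /ghost big1 //= => i _.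
by rewrite expr0n eqn0Ngt expn_gt0 prime_gt0 // mul0rn.
Qed.

Lemma ghost_teich (c : B) m : ghost p (teich c) m = c ^+ (p ^ m).
Proof.
rewrite /ghost big_ord_recl /= subn0 expn0 mulr1n big1 ?addr0 // => i _ /=.
by rewrite expr0n eqn0Ngt expn_gt0 prime_gt0 // mul0rn.
Qed.

Lemma ghost_add x y m : ghost p (wadd x y) m = ghost p x m + ghost p y m.
Proof.
apply: (etrans (ghost_wop x y y m (@dwork_gadd p))).
rewrite gadd.unlock uevalD.
exact (congr2 +%R (ueval_gvar (wvars x y y) 0 m) (ueval_gvar (wvars x y y) 1 m)).
Qed.

Lemma ghost_opp x m : ghost p (wopp x) m = - ghost p x m.
Proof.
apply: (etrans (ghost_wop x x x m (@dwork_gopp p))).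
rewrite gopp.unlock uevalN.
exact (congr1 -%R (ueval_gvar (wvars x x x) 0 m)).
Qed.

Lemma ghost_mul x y m : ghost p (wmul x y) m = ghost p x m * ghost p y m.
Proof.
apply: (etrans (ghost_wop x y y m (@dwork_gmul p))).
rewrite gmul.unlock uevalM.
exact (congr2 *%R (ueval_gvar (wvars x y y) 0 m) (ueval_gvar (wvars x y y) 1 m)).
Qed.

Lemma ghost_frob x m : ghost p (wfrob x) m = ghost p x m.+1.
Proof. apply: (etrans (ghost_wop x x x m (@dwork_gfrob p))).
rewrite gfrob.unlock; exact (ueval_gvar (wvars x x x) 0 m.+1). Qed.

Lemma ghost_T a x m : ghost p (wT a x) m =
  \sum_(k < m.+1) (a k ^+ (p ^ (m - k)) * ghost p x (m - k)%N) *+ p ^ k.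
Proof.
apply: (etrans (ghost_wop a x x m (@dwork_gT p))).
rewrite gT.unlock rmorph_sum.
apply: eq_bigr => k _.
rewrite rmorphMn rmorphM rmorphXn.
apply: (congr1 (fun t => t *+ _)); apply: congr2.
  apply: (congr1 (fun t => t ^+ _)); exact: ueval_var.
exact: ueval_gvar.
Qed.

End GhostRules.

Section Naturality.
Variables (B B' : comNzRingType) (h : {rmorphism B -> B'}).

Lemma wmap_zero : wmap h (wzero B) = wzero B'.
Proof. by apply: wittP => m /=; rewrite rmorph0. Qed.

Lemma wmap_teich c : wmap h (teich c) = teich (h c).
Proof. by apply: wittP => -[|m] /=; rewrite ?rmorph0. Qed.

Lemma wmap_add x y : wmap h (wadd x y) = wadd (wmap h x) (wmap h y).
Proof. exact: wmap_wop. Qed.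

Lemma wmap_opp x : wmap h (wopp x) = wopp (wmap h x).
Proof. exact: wmap_wop. Qed.

Lemma wmap_mul x y : wmap h (wmul x y) = wmul (wmap h x) (wmap h y).
Proof. exact: wmap_wop. Qed.

Lemma wmap_frob x : wmap h (wfrob x) = wfrob (wmap h x).
Proof. exact: wmap_wop. Qed.

Lemma wmap_T a x : wmap h (wT a x) = wT (wmap h a) (wmap h x).
Proof. exact: wmap_wop. Qed.

End Naturality.

Definition wvar (i : nat) : W upoly := Witt p_pr (uvar i).

Definition torsion_free (R : comNzRingType) : Prop :=
  forall n (f g : R), (0 < n)%N -> f *+ n = g *+ n -> f = g.

Lemma ghost_inj (R : comNzRingType) (tf : torsion_free R) (x y : W R) :
  (forall m, ghost p x m = ghost p y m) -> x = y.
Proof.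
move=> e; apply: wittP => m; elim/ltn_ind: m => m IH.
have := e m; rewrite /ghost !big_ord_recr /= subnn expn0 !expr1.
rewrite (eq_bigr (fun i : 'I_m => y i ^+ (p ^ (m - i)) *+ p ^ i)) => [|i _].
  by move/addrI; apply: tf; rewrite expn_gt0 prime_gt0.
by rewrite IH.
Qed.

Lemma wmap_wvars (B : comNzRingType) (x y z : W B) :
  let h := ueval (wvars x y z) in
  [/\ wmap h (wvar 0) = x, wmap h (wvar 1) = y & wmap h (wvar 2) = z].
Proof. by split; apply: wittP => m /=; rewrite ueval_var. Qed.

Definition ghostE :=
  (ghost_zero, ghost_teich, ghost_add, ghost_opp, ghost_mul, ghost_frob,
   ghost_T).

Definition wmapE :=
  (wmap_zero, wmap_teich, wmap_add, wmap_opp, wmap_mul, wmap_frob, wmap_T).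

Section TorsionFreeAxioms.
Variables (R : comNzRingType) (tf : torsion_free R).

Fact waddA_tf : associative (@wadd R).
Proof.
by move=> x y z; apply: (ghost_inj tf) => m; rewrite !ghostE addrA.
Qed.

Fact waddC_tf : commutative (@wadd R).
Proof.
by move=> x y; apply: (ghost_inj tf) => m; rewrite !ghostE addrC.
Qed.

Fact wadd0_tf : left_id (wzero R) (@wadd R).
Proof.
by move=> x; apply: (ghost_inj tf) => m; rewrite !ghostE add0r.
Qed.

Fact waddN_tf : left_inverse (wzero R) (@wopp R) (@wadd R).
Proof.
by move=> x; apply: (ghost_inj tf) => m; rewrite !ghostE addNr.
Qed.

Fact wmulA_tf : associative (@wmul R).
Proof.
by move=> x y z; apply: (ghost_inj tf) => m; rewrite !ghostE mulrA.
Qed.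

Fact wmulC_tf : commutative (@wmul R).
Proof.
by move=> x y; apply: (ghost_inj tf) => m; rewrite !ghostE mulrC.
Qed.

Fact wmul1_tf : left_id (teich 1) (@wmul R).
Proof.
by move=> x; apply: (ghost_inj tf) => m; rewrite !ghostE expr1n mul1r.
Qed.

Fact wmulDl_tf : left_distributive (@wmul R) (@wadd R).
Proof.
by move=> x y z; apply: (ghost_inj tf) => m; rewrite !ghostE mulrDl.
Qed.

Fact wfrobB_tf (x y : W R) :
  wfrob (wadd x (wopp y)) = wadd (wfrob x) (wopp (wfrob y)).
Proof. by apply: (ghost_inj tf) => m; rewrite !ghostE. Qed.

Fact wTB_tf (a x y : W R) :
  wT a (wadd x (wopp y)) = wadd (wT a x) (wopp (wT a y)).
Proof.
apply: (ghost_inj tf) => m; rewrite !ghostE -sumrB; apply: eq_bigr => k _.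
by rewrite !ghostE mulrBr mulrnBl.
Qed.

End TorsionFreeAxioms.

Fact upoly_tf : torsion_free upoly.
Proof. exact upoly_mulrn_inj. Qed.

Section RingAxioms.
Variable B : comNzRingType.
Implicit Types a x y z : W B.

Lemma waddA : associative (@wadd B).
Proof.
move=> x y z; have := congr1 (wmap (ueval (wvars x y z))) (waddA_tf upoly_tf (wvar 0) (wvar 1) (wvar 2)).
have [e0 e1 e2] := wmap_wvars x y z.
by rewrite !wmapE e0 e1 e2.
Qed.

Lemma waddC : commutative (@wadd B).
Proof.
move=> x y; have := congr1 (wmap (ueval (wvars x y y))) (waddC_tf upoly_tf (wvar 0) (wvar 1)).
have [e0 e1 _] := wmap_wvars x y y.
by rewrite !wmapE e0 e1.
Qed.

Lemma wadd0 : left_id (wzero B) (@wadd B).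
Proof.
move=> x; have := congr1 (wmap (ueval (wvars x x x))) (wadd0_tf upoly_tf (wvar 0)).
have [e0 _ _] := wmap_wvars x x x.
by rewrite !wmapE e0.
Qed.

Lemma waddN : left_inverse (wzero B) (@wopp B) (@wadd B).
Proof.
move=> x; have := congr1 (wmap (ueval (wvars x x x))) (waddN_tf upoly_tf (wvar 0)).
have [e0 _ _] := wmap_wvars x x x.
by rewrite !wmapE e0.
Qed.

Lemma wmulA : associative (@wmul B).
Proof.
move=> x y z; have := congr1 (wmap (ueval (wvars x y z))) (wmulA_tf upoly_tf (wvar 0) (wvar 1) (wvar 2)).
have [e0 e1 e2] := wmap_wvars x y z.
by rewrite !wmapE e0 e1 e2.
Qed.

Lemma wmulC : commutative (@wmul B).
Proof.
move=> x y; have := congr1 (wmap (ueval (wvars x y y))) (wmulC_tf upoly_tf (wvar 0) (wvar 1)).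
have [e0 e1 _] := wmap_wvars x y y.
by rewrite !wmapE e0 e1.
Qed.

Lemma wmul1 : left_id (teich 1) (@wmul B).
Proof.
move=> x; have := congr1 (wmap (ueval (wvars x x x))) (wmul1_tf upoly_tf (wvar 0)).
have [e0 _ _] := wmap_wvars x x x.
by rewrite !wmapE e0 rmorph1.
Qed.

Lemma wmulDl : left_distributive (@wmul B) (@wadd B).
Proof.
move=> x y z; have := congr1 (wmap (ueval (wvars x y z))) (wmulDl_tf upoly_tf (wvar 0) (wvar 1) (wvar 2)).
have [e0 e1 e2] := wmap_wvars x y z.
by rewrite !wmapE e0 e1 e2.
Qed.

Lemma wone_neq0 : teich 1 != wzero B.
Proof.
by apply/eqP => /(congr1 (fun x : W B => x 0%N)) /= /eqP; rewrite oner_eq0.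
Qed.

End RingAxioms.
HB.instance Definition _ (B : comNzRingType) := GRing.isZmodule.Build (W B)
  (@waddA B) (@waddC B) (@wadd0 B) (@waddN B).
HB.instance Definition _ (B : comNzRingType) :=
  GRing.Zmodule_isComNzRing.Build (W B)
    (@wmulA B) (@wmulC B) (@wmul1 B) (@wmulDl B) (@wone_neq0 B).

Lemma wfrob_is_zmod_morphism (B : comNzRingType) :
  zmod_morphism (@wfrob B : W B -> W B).
Proof.
move=> x y; have := congr1 (wmap (ueval (wvars x y y))) (wfrobB_tf upoly_tf (wvar 0) (wvar 1)).
have [e0 e1 _] := wmap_wvars x y y.
by rewrite !wmapE e0 e1.
Qed.

Lemma wT_is_zmod_morphism (B : comNzRingType) (a : W B) :
  zmod_morphism (wT a : W B -> W B).
Proof.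
move=> x y.
have := congr1 (wmap (ueval (wvars a x y))) (wTB_tf upoly_tf (wvar 0) (wvar 1) (wvar 2)).
have [e0 e1 e2] := wmap_wvars a x y.
by rewrite !wmapE e0 e1 e2.
Qed.

HB.instance Definition _ (B : comNzRingType) :=
  GRing.isZmodMorphism.Build (W B) (W B) (@wfrob B)
    (@wfrob_is_zmod_morphism B).
HB.instance Definition _ (B : comNzRingType) (a : W B) :=
  GRing.isZmodMorphism.Build (W B) (W B) (wT a) (wT_is_zmod_morphism a).

Definition Flam (B : comNzRingType) (lam : B) (x : W B) : W B :=
  wfrob x - teich (lam ^+ p.-1) * x.

Lemma Flam_is_zmod_morphism (B : comNzRingType) (lam : B) :
  zmod_morphism (Flam lam).
Proof.
by move=> x y; rewrite /Flam raddfB mulrBr !opprD addrACA.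
Qed.

HB.instance Definition _ (B : comNzRingType) (lam : B) :=
  GRing.isZmodMorphism.Build (W B) (W B) (Flam lam)
    (Flam_is_zmod_morphism lam).

End WittOperations.

Section Cokernel.
Variables (U V : zmodType) (f : {additive U -> V}).

Definition coker_rel : rel V := [rel x y | `[< exists u, x - y = f u >]].

Lemma coker_rel_refl : reflexive coker_rel.
Proof. by move=> x; apply/asboolP; exists 0; rewrite subrr raddf0. Qed.

Lemma coker_rel_sym : symmetric coker_rel.
Proof.
by move=> x y; apply/asboolP/asboolP => -[u e]; exists (- u);
  rewrite raddfN -e opprB.
Qed.

Lemma coker_rel_trans : transitive coker_rel.
Proof.
move=> y x z /asboolP[u e] /asboolP[v e']; apply/asboolP; exists (u + v).
by rewrite raddfD -e -e' addrA subrK.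
Qed.

Canonical coker_equiv :=
  EquivRel coker_rel coker_rel_refl coker_rel_sym coker_rel_trans.

Definition coker := {eq_quot coker_equiv}%qT.
HB.instance Definition _ := Choice.on coker.
HB.instance Definition _ := EqQuotient.on coker.

Definition to_coker (x : V) : coker := (\pi_coker x)%qT.

Lemma to_cokerP x y : (to_coker x = to_coker y) <-> exists u, x - y = f u.
Proof.
split=> [/eqmodP/asboolP //|e]; apply/eqmodP; exact/asboolP.
Qed.

Definition coker_repr (x : coker) : V := repr x.

Lemma coker_reprK x : to_coker (coker_repr x) = x.
Proof. exact: reprK. Qed.

Definition coker_zero := to_coker 0.
Definition coker_opp (x : coker) := to_coker (- coker_repr x).
Definition coker_add (x y : coker) := to_coker (coker_repr x + coker_repr y).

Lemma to_cokerN x : coker_opp (to_coker x) = to_coker (- x).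
Proof.
apply/to_cokerP; have /to_cokerP[u e] := coker_reprK (to_coker x).
by exists (- u); rewrite raddfN -e opprD.
Qed.

Lemma to_cokerD x y :
  coker_add (to_coker x) (to_coker y) = to_coker (x + y).
Proof.
apply/to_cokerP; have /to_cokerP[u e] := coker_reprK (to_coker x).
have /to_cokerP[v e'] := coker_reprK (to_coker y).
by exists (u + v); rewrite raddfD -e -e' opprD addrACA.
Qed.

Lemma coker_ind (P : coker -> Prop) :
  (forall x, P (to_coker x)) -> forall x, P x.
Proof. by move=> h x; rewrite -(coker_reprK x). Qed.

Lemma coker_addA : associative coker_add.
Proof.
by elim/coker_ind=> x; elim/coker_ind=> y; elim/coker_ind=> z;
  rewrite !to_cokerD addrA.
Qed.

Lemma coker_addC : commutative coker_add.
Proof. by move=> x y; rewrite /coker_add addrC. Qed.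

Lemma coker_add0 : left_id coker_zero coker_add.
Proof. by elim/coker_ind=> x; rewrite to_cokerD add0r. Qed.

Lemma coker_addN : left_inverse coker_zero coker_opp coker_add.
Proof. by elim/coker_ind=> x; rewrite to_cokerN to_cokerD addNr. Qed.

HB.instance Definition _ := GRing.isZmodule.Build coker
  coker_addA coker_addC coker_add0 coker_addN.

Lemma to_coker_is_zmod_morphism : zmod_morphism to_coker.
Proof.
by move=> x y; rewrite -to_cokerD -to_cokerN.
Qed.

HB.instance Definition _ := GRing.isZmodMorphism.Build V coker to_coker
  to_coker_is_zmod_morphism.

End Cokernel.

(* The homomorphism V/f(U) -> V'/gf(U) induced by g. *)
Section CokernelMap.
Variables (U V V' : zmodType) (f : {additive U -> V}) (g : {additive V -> V'}).

Definition coker_map (x : coker f) : coker (g \o f) :=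
  to_coker (g \o f) (g (coker_repr x)).

Lemma coker_mapE x : coker_map (to_coker f x) = to_coker (g \o f) (g x).
Proof.
apply/to_cokerP; have /to_cokerP[u e] := coker_reprK (to_coker f x).
by exists u; rewrite -raddfB e.
Qed.

Lemma coker_map_is_zmod_morphism : zmod_morphism coker_map.
Proof.
elim/coker_ind=> x; elim/coker_ind=> y.
by rewrite -raddfB !coker_mapE raddfB raddfB.
Qed.

HB.instance Definition _ := GRing.isZmodMorphism.Build (coker f)
  (coker (g \o f)) coker_map coker_map_is_zmod_morphism.

End CokernelMap.

Arguments coker_map {U V V'} f g x.

Section GroupSchemes.
Variables (p l : nat).

(* In this section [q k] stands for p^(l-k) lam^(p^k) / lam^(p^l), k < l; it is
   a datum, since that quotient is ambiguous when lam is a zero divisor. *)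

(* lam^(-p^l) ((1 + lam X)^(p^l) - 1). For v = logn p j < l, the division of
   'C(p ^ l, j) by p ^ (l - v) is exact. *)
Definition psi (C : comNzRingType) (lam : C) (q : nat -> C) : {poly C} :=
  'X^(p ^ l) + \sum_(1 <= j < p ^ l)
    (('C(p ^ l, j) %/ p ^ (l - logn p j))%:R
      * lam ^+ (j - p ^ logn p j) * q (logn p j)) *: 'X^j.

(* x is a C-point of G^(lam). *)
Definition inG (C : comNzRingType) (lam x : C) : Prop :=
  exists y, (1 + lam * x) * y = 1.

Definition glaw (C : comNzRingType) (lam x y : C) : C := x + y + lam * x * y.

(* psi : G^(lam) -> G^(lam^(p^l)) is a homomorphism of group schemes over A,
   read on points in all A-algebras. This is automatic if lam is regular, but
   not in general: over Z/p^2 with lam = 0 and q = 0, psi is X^(p^l). *)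
Definition psi_hom (A : comNzRingType) (lam : A) (q : nat -> A) : Prop :=
  forall (C : comNzRingType) (g : {rmorphism A -> C}) (x y : C),
    let psiC := psi (g lam) (g \o q) in
    inG (g lam) x -> inG (g lam) y ->
    psiC.[glaw (g lam) x y] = glaw (g lam ^+ (p ^ l)) psiC.[x] psiC.[y].

(* x is a C-point of N_l, the kernel of psi. *)
Definition inN (C : comNzRingType) (lam : C) (q : nat -> C) (x : C) : Prop :=
  inG lam x /\ (psi lam q).[x] = 0.

Lemma size_psi (C : comNzRingType) (lam : C) (q : nat -> C) :
  size (psi lam q) = (p ^ l).+1 /\ psi lam q \is monic.
Proof.
rewrite /psi; set n := (p ^ l)%N; set r := (\sum_(1 <= j < n) _ : {poly C}).
have lt : (size r < size ('X^n : {poly C}))%N.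
  rewrite size_polyXn ltnS; apply: (leq_trans (size_sum _ _ _)).
  rewrite big_nat_cond; apply/bigmax_leqP_seq => j _ /andP[/andP[_ jn] _].
  by rewrite (leq_trans (size_scale_leq _ _)) // size_polyXn.
split; first by rewrite size_polyDl // size_polyXn.
by rewrite monicE lead_coefDl // lead_coefXn.
Qed.

Lemma mk_monic_psi (C : comNzRingType) (lam : C) (q : nat -> C) :
  (0 < p)%N -> mk_monic (psi lam q) = psi lam q.
Proof.
move=> p0; rewrite /mk_monic; have [-> ->] := size_psi lam q.
by rewrite ltnS expn_gt0 p0.
Qed.

(* The coordinate ring B[X]/(psi) of N_l over B; by [mk_monic_psi] the library
   quotient is indeed the one by psi. *)
Definition coordN (B : comNzRingType) (lam : B) (q : nat -> B) :=
  {poly %/ (psi lam q)}.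

(* The value at a C-point x of N_l of the function u on N_l. *)
Definition evalN (B : comNzRingType) (lam : B) (q : nat -> B)
    (C : comNzRingType) (g : B -> C) (u : coordN lam q) (x : C) : C :=
  (map_poly g (u : {poly B})).[x].

(* The B-points of the Cartier dual of N_l: a homomorphism N_(l,B) -> G_(m,B)
   is a unit u of the coordinate ring of N_(l,B) that is multiplicative on
   points. The group law of the dual is the product of coordN. *)
Definition is_char (B : comNzRingType) (lam : B) (q : nat -> B)
    (u : coordN lam q) : Prop :=
  (exists v : coordN lam q, u * v = 1) /\
  forall (C : comNzRingType) (g : {rmorphism B -> C}) (x y : C),
    inN (g lam) (g \o q) x -> inN (g lam) (g \o q) y ->
    evalN g u (glaw (g lam) x y) = evalN g u x * evalN g u y.

Variable (p_pr : prime p).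
Local Notation W := (witt p_pr).

(* lam^(-p^l) (p^l [lam]); the integer p ^ l is taken in W(Z). For k < l the
   division of its k-th component by p ^ (l - k) is exact. *)
Definition avec (B : comNzRingType) (lam : B) (q : nat -> B) : W B :=
  Witt p_pr (fun k =>
    let c : int := ((p ^ l)%:R : W int) k in
    if (k < l)%N then ((c %/ (p ^ (l - k))%:Z)%Z)%:~R * q k
    else c%:~R * lam ^+ (p ^ k - p ^ l)).

(* W(B)/T_a and W(B)/T'_a, with T'_a = F^(lam) o T_a. *)
Definition cokT (B : comNzRingType) (lam : B) (q : nat -> B) : zmodType :=
  coker (wT (avec lam q)).
Definition cokT' (B : comNzRingType) (lam : B) (q : nat -> B) : zmodType :=
  coker (Flam lam \o wT (avec lam q)).

Definition Fbar (B : comNzRingType) (lam : B) (q : nat -> B) :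
    cokT lam q -> cokT' lam q :=
  coker_map (wT (avec lam q)) (Flam lam).

Definition clW (B : comNzRingType) (lam : B) (q : nat -> B) (x : W B) :
    cokT lam q := to_coker (wT (avec lam q)) x.

End GroupSchemes.

(* Main.v *)
From HB Require Import structures.
Require Import Defs.
From mathcomp Require Import all_boot all_order all_algebra.
From mathcomp Require Import generic_quotient ring_quotient qpoly finmap monalg boolp.
From mathcomp Require Import ring zify.

(* For w in W(C) and x nilpotent in C put E(w, x) = prod_k AH(w_k x^(p^k)), where
   AH is the Artin-Hasse exponential, and let kap be the coordinate change with
   AH(lam x) = 1 + lam kap(x). Then chi_z(kap(x)) = E(z, x) is a homomorphism on
   nilpotent points of G^(lam) when F^(lam) z = 0, and every formal homomorphism
   to G_m arises this way. The nilpotence of the q_k makes all points of N_l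
   nilpotent, and characters of N_l, which have degree < p^l, are themselves
   homomorphisms on G^(lam); hence they are the restrictions of the chi_z.
   In these coordinates psi is dual to T_a: E(T_a z, x) = chi_z(psi(kap(x))), the
   last chi being taken on G^(lam^(p^l)). If chi_z is trivial on N_l, it therefore
   factors through psi, and z is in the image of T_a. Conversely, if T_a z is in
   the kernel of F^(lam), its character is trivial on N_l: this is shown by
   successive reduction modulo annihilators of products of the q_k, where a
   becomes the l-th unit vector and T_a the l-fold shift. *)

Set Implicit Arguments.
Unset Strict Implicit.
Unset Printing Implicit Defensive.

Import GRing.Theory Num.Theory.
Local Open Scope ring_scope.

(** * Algebras over the integers localized at p *)

Section LocalIntegers.
Variable p : nat.

(** The base ring has p-torsion and lam may be a zero divisor, so over it neither ghost components
    nor division by lam determine anything. Identities are therefore proved over covers without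
    torsion, where a series with given constant term is fixed by its logarithmic derivative, and
    then specialized; where lam has to be cancelled, it is first made an indeterminate. The
    polynomial psi resists this, because its quotients q_k need not lift to such a cover. What
    replaces a lift is the relation lam^(p^k - p^v) q_v = p^(k-v) q_k, extracted from the assumption
    that psi is a homomorphism: it makes division by lam^(p^l) single-valued on the ideal where it
    is needed. In the converse, T_a z is killed by F^(lam), but nothing places z in the kernel of
    F^(lam^(p^l)), so its character cannot simply be factored through psi; hence the detour that
    removes the q_k one factor at a time. *)

Definition plocal : {pred rat} := [pred x | coprime p `|denq x|].

Lemma plocalP (x : rat) :
  reflect (exists m (a : int), coprime p m /\ x * m%:R = a%:~R) (x \in plocal).
Proof.
apply: (iffP idP) => [px|[m [a [pm e]]]].
  exists `|denq x|%N, (numq x); split; first exact: px.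
  by rewrite numqE -[(`|denq x|)%:R]/((`|denq x|%N)%:~R) absz_denq.
rewrite inE; apply: coprime_dvdr pm.
have e2 : (numq x * m%:Z = a * denq x)%R.
  apply: (@intr_inj rat); rewrite !intrM numqE -e.
  by rewrite -[m%:~R]/(m%:R); ring.
have : (denq x %| numq x * m%:Z)%Z by rewrite e2 dvdz_mull.
rewrite dvdzE abszM Gauss_dvdr; first by rewrite absz_nat.
by rewrite coprime_sym coprime_num_den.
Qed.

Lemma plocal_subring : subring_closed plocal.
Proof.
split.
- by apply/plocalP; exists 1%N, 1; rewrite coprimen1 mulr1.
- move=> x y /plocalP[m [a [pm e]]] /plocalP[n [b [pn f]]].
  apply/plocalP; exists (m * n)%N, (a * n%:Z - b * m%:Z).
  rewrite coprimeMr pm pn intrB !intrM -e -f natrM; split=> //.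
  by rewrite -[n%:~R]/(n%:R) -[m%:~R]/(m%:R); ring.
- move=> x y /plocalP[m [a [pm e]]] /plocalP[n [b [pn f]]].
  apply/plocalP; exists (m * n)%N, (a * b).
  rewrite coprimeMr pm pn !intrM -e -f natrM; split=> //.
  by ring.
Qed.

HB.instance Definition _ := GRing.isSubringClosed.Build rat plocal plocal_subring.

Record zloc := ZLoc { zval :> rat; _ : zval \in plocal }.
HB.instance Definition _ := [isSub for zval].
HB.instance Definition _ := [Choice of zloc by <:].
HB.instance Definition _ := [SubChoice_isSubComNzRing of zloc by <:].

End LocalIntegers.

(** The analogue of [upoly] over Z_(p): universal identities that contain Artin-Hasse coefficients
    need p-integral scalars. *)
Definition lpoly (p : nat) := {malg (zloc p)[{cmonom (nat * nat)%type}]}.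
HB.instance Definition _ p := GRing.ComNzRing.on (lpoly p).

HB.lock Definition lvar (p i j : nat) : lpoly p := mkmalgU (ucm (i, j)) 1.

Section Local.
Variables (p : nat) (p_pr : prime p).
Local Notation Z := (zloc p).

(** A property suffices here instead of an algebra structure, since a homomorphism from Z_(p) is
    unique when it exists ([zloc_rmorphism_unique]). *)
Definition islocal (C : comNzRingType) : Prop :=
  exists f : {rmorphism Z -> C}, True.

Lemma coprime_gt0 m : coprime p m -> (0 < m)%N.
Proof.
case: m => // pm; move: pm p_pr.
by rewrite /coprime gcdn0 => /eqP ->.
Qed.

Lemma zloc_unit m : coprime p m -> exists u : Z, m%:R * u = 1.
Proof.
move=> pm; have m0 := coprime_gt0 pm.
have mq : (m%:R : rat) != 0 by rewrite pnatr_eq0 -lt0n.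
have u1 : (m%:R^-1 : rat) \in plocal p.
  by apply/plocalP; exists m, 1; rewrite mulVf.
exists (ZLoc u1); apply: val_inj; rewrite rmorphM rmorph_nat /= mulfV //.
Qed.

Lemma islocal_unit (C : comNzRingType) m : islocal C -> coprime p m ->
  exists u : C, m%:R * u = 1.
Proof.
move=> [f _] /zloc_unit[u e]; exists (f u).
by rewrite -(rmorph_nat f) -rmorphM e rmorph1.
Qed.

Lemma islocal_rmorphism (C C' : comNzRingType) :
  {rmorphism C -> C'} -> islocal C -> islocal C'.
Proof. by move=> g [f _]; exists (g \o f). Qed.

Lemma islocal_cancel (C : comNzRingType) m (x y : C) : islocal C ->
  coprime p m -> x *+ m = y *+ m -> x = y.
Proof.
move=> lC pm e; have [u mu] := islocal_unit lC pm.
by rewrite -[x]mulr1 -[y]mulr1 -mu !mulrA !mulr_natr e.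
Qed.

Lemma zloc_rmorphism_unique (C : comNzRingType) (f g : {rmorphism Z -> C}) :
  f =1 g.
Proof.
move=> x; have /plocalP[m [a [pm e]]] := valP x.
have lC : islocal C by exists f.
apply: (islocal_cancel lC pm).
rewrite -!rmorphMn.
have -> : x *+ m = a%:~R.
  by apply: val_inj; rewrite raddfMn rmorph_int /= -mulr_natr e.
by rewrite !rmorph_int.
Qed.

Section Nilpotent.
Variables (n : nat) (C : comNzRingType) (pn0 : (p%:R : C) ^+ n = 0).

Lemma pnil_unit m : coprime p m -> exists u : C, m%:R * u = 1.
Proof.
move=> pm; have m0 := coprime_gt0 pm.
have : coprime m (p ^ n) by rewrite coprime_sym coprimeXl.
case/(coprimeP _ m0) => -[u v] /= uv.
exists u%:R; rewrite -natrM mulnC.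
have -> : (u * m = 1 + v * p ^ n)%N.
  by rewrite -uv subnK // ltnW // -subn_gt0 uv.
by rewrite natrD natrM natrX pn0 mulr0 addr0.
Qed.

(** The image is specified against all fractions a/m representing x at once, so that later proofs
    may use whatever denominators are convenient. *)
Lemma zloc_image_ex (x : Z) : exists c : C, forall m a, coprime p m ->
  val x * m%:R = a%:~R -> c * m%:R = a%:~R.
Proof.
have /plocalP[m [a [pm e]]] := valP x.
have [u mu] := pnil_unit pm.
exists (a%:~R * u) => m' a' pm' e'.
have [u' mu'] := pnil_unit pm'.
have am : a * m'%:Z = a' * m%:Z.
  apply: (@intr_inj rat); rewrite !intrM -e -e'.
  by rewrite -[m%:~R]/(m%:R) -[m'%:~R]/(m'%:R); ring.
have {}am : (a%:~R * m'%:R = a'%:~R * m%:R :> C).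
  by have := congr1 (fun z : int => z%:~R : C) am; rewrite !intrM.
by rewrite mulrAC am -mulrA mu mulr1.
Qed.

Definition zloc_image (x : Z) : C := projT1 (cid (zloc_image_ex x)).

Lemma zloc_imageE x m a : coprime p m -> val x * m%:R = a%:~R ->
  zloc_image x * m%:R = a%:~R.
Proof. by rewrite /zloc_image; case: cid => c /= h pm; apply: h. Qed.

Lemma pnil_cancel m (x y : C) : coprime p m ->
  x * m%:R = y * m%:R -> x = y.
Proof.
by move=> pm e; have [u mu] := pnil_unit pm;
  rewrite -[x]mulr1 -[y]mulr1 -mu !mulrA e.
Qed.

Lemma zloc_image_zmod : zmod_morphism zloc_image.
Proof.
move=> x y; have /plocalP[m [a [pm e]]] := valP x.
have /plocalP[k [b [pk f]]] := valP y.
have pmk : coprime p (m * k) by rewrite coprimeMr pm.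
apply: (pnil_cancel pmk).
rewrite (@zloc_imageE _ _ (a * k%:Z - b * m%:Z)) //; last first.
  rewrite raddfB intrB !intrM -e -f natrM.
  by rewrite -[k%:~R]/(k%:R) -[m%:~R]/(m%:R) /=; ring.
rewrite mulrBl natrM mulrA (zloc_imageE pm e) (mulrC m%:R) mulrA (zloc_imageE pk f).
by rewrite intrB !intrM.
Qed.

Lemma zloc_image_monoid : monoid_morphism zloc_image.
Proof.
split.
  by have := @zloc_imageE 1 1 1 (coprimen1 p) (mulr1 _); rewrite mulr1.
move=> x y; have /plocalP[m [a [pm e]]] := valP x.
have /plocalP[k [b [pk f]]] := valP y.
have pmk : coprime p (m * k) by rewrite coprimeMr pm.
apply: (pnil_cancel pmk).
rewrite (@zloc_imageE _ _ (a * b)) //; last first.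
  by rewrite rmorphM intrM -e -f natrM /=; ring.
by rewrite natrM mulrACA (zloc_imageE pm e) (zloc_imageE pk f) intrM.
Qed.

HB.instance Definition _ := GRing.isZmodMorphism.Build Z C zloc_image
  zloc_image_zmod.
HB.instance Definition _ := GRing.isMonoidMorphism.Build Z C zloc_image
  zloc_image_monoid.

Lemma pnil_islocal : islocal C.
Proof. by exists zloc_image. Qed.

End Nilpotent.

Lemma zloc_tf : torsion_free Z.
Proof.
move=> n f g n0 /(congr1 val); rewrite !raddfMn /= => e.
apply: val_inj; apply: (mulIf (_ : (n%:R : rat) != 0)).
  by rewrite pnatr_eq0 -lt0n.
by rewrite !mulr_natr.
Qed.

Lemma lpoly_tf : torsion_free (lpoly p).
Proof.
move=> n f g n0 e; apply/malgP => k; apply: (zloc_tf n0).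
by rewrite -!mcoeffMn e.
Qed.

Lemma lpoly_islocal : islocal (lpoly p).
Proof. by exists (@malgC {cmonom (nat * nat)%type} Z). Qed.

Lemma lpoly_eval (C : comNzRingType) (v : nat -> nat -> C) : islocal C ->
  exists f : {rmorphism lpoly p -> C}, forall i j, f (lvar p i j) = v i j.
Proof.
case=> g _; exists (mmap g (cmeval v)) => i j.
rewrite lvar.unlock /= mmapU.
transitivity (1 * cmeval v (ucm (i, j))).
  by congr (_ * _); exact: (rmorph1 g).
by rewrite mul1r /cmeval mdomU big_seq_fset1 cmUU expr1.
Qed.

End Local.

(** * Nilpotent elements, power series and quotients of polynomial rings *)

Section Evaluation.
Variable C : comNzRingType.
Implicit Types (f : nat -> C) (x : C).

Definition nil x : Prop := exists m, x ^+ m = 0.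

(* Some exponent killing x, and 0 if x is not nilpotent. *)
Definition nilord x : nat :=
  if pselect (nil x) is left h then projT1 (cid h) else 0%N.

Lemma nilordP x : nil x -> x ^+ nilord x = 0.
Proof. by move=> h; rewrite /nilord; case: pselect => // h'; case: cid. Qed.

(** The value of a power series at a nilpotent element; by [evE] any exponent killing x can serve as
    the bound. *)
Definition ev f x : C := \sum_(i < nilord x) f i * x ^+ i.

Lemma exp_nil_leq x m n : x ^+ m = 0 -> (m <= n)%N -> x ^+ n = 0.
Proof. by move=> e /subnK <-; rewrite exprD e mulr0. Qed.

Lemma sum_nil_leq f x m n : x ^+ m = 0 -> (m <= n)%N ->
  \sum_(i < n) f i * x ^+ i = \sum_(i < m) f i * x ^+ i.
Proof.
move=> e /subnKC <-; rewrite big_split_ord /= [X in _ + X]big1 ?addr0 // => i _.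
by rewrite (exp_nil_leq e) ?mulr0 // leq_addr.
Qed.

Lemma evE f x m : x ^+ m = 0 -> ev f x = \sum_(i < m) f i * x ^+ i.
Proof.
move=> e; have e' : x ^+ nilord x = 0 by apply: nilordP; exists m.
by rewrite /ev; case: (leqP m (nilord x)) => [|/ltnW] le;
  [rewrite (sum_nil_leq _ e le)|rewrite (sum_nil_leq _ e' le)].
Qed.

Lemma nil_mull x y : nil x -> nil (y * x).
Proof. by move=> [m e]; exists m; rewrite exprMn e mulr0. Qed.

Lemma nil_mulr x y : nil x -> nil (x * y).
Proof. by rewrite mulrC; apply: nil_mull. Qed.

Lemma nil0 : nil 0. Proof. by exists 1%N. Qed.

Lemma nil_exp x m : nil x -> (0 < m)%N -> nil (x ^+ m).
Proof. by case: m => // m nx _; rewrite exprS; apply: nil_mulr. Qed.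

Lemma nilD x y : nil x -> nil y -> nil (x + y).
Proof.
move=> [m ex] [n ey]; exists (m + n)%N; rewrite exprDn big1 // => i _.
case: (leqP n i) => ni; first by rewrite (exp_nil_leq ey ni) mulr0 mul0rn.
by rewrite (exp_nil_leq ex) ?mul0r ?mul0rn //; lia.
Qed.

Lemma nil_sum (I : Type) (r : seq I) (P : pred I) (F : I -> C) :
  (forall i, P i -> nil (F i)) -> nil (\sum_(i <- r | P i) F i).
Proof. by move=> h; apply: big_ind h; [exact: nil0|exact: nilD]. Qed.

Lemma nil_unit x : nil x -> exists y, (1 + x) * y = 1.
Proof.
case=> m e; exists (\sum_(i < m) (- x) ^+ i).
have /(congr1 -%R) := subrX1 (- x) m.
by rewrite exprNn e mulr0 sub0r opprK -mulNr opprD !opprK addrC => <-.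
Qed.

End Evaluation.

Lemma nil_rmorph (C C' : comNzRingType) (g : {rmorphism C -> C'}) x :
  nil x -> nil (g x).
Proof. by case=> m e; exists m; rewrite -rmorphXn e rmorph0. Qed.

Lemma ev_rmorph (C C' : comNzRingType) (g : {rmorphism C -> C'}) f x :
  nil x -> g (ev f x) = ev (g \o f) (g x).
Proof.
case=> m e; rewrite (evE _ e) (@evE _ _ _ m); last by rewrite -rmorphXn e rmorph0.
by rewrite rmorph_sum; apply: eq_bigr => i _; rewrite rmorphM rmorphXn.
Qed.

Section Quotient.
Variables (B : comNzRingType) (h : {poly B}).

Lemma in_qpoly_val (P : {poly %/ h}) : in_qpoly h (P : {poly B}) = P.
Proof. by apply: val_inj; rewrite /= Pdiv.Ring.rmodp_small // size_mk_monic. Qed.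

Hypotheses (h_mon : h \is monic) (h_size : (1 < size h)%N).

Lemma mk_monicE : mk_monic h = h.
Proof. by rewrite /mk_monic h_size h_mon. Qed.

Lemma in_qpoly_self : in_qpoly h h = 0.
Proof. by apply: val_inj; rewrite /= mk_monicE Pdiv.RingMonic.rmodpp. Qed.

Lemma qpoly_lift (C : comNzRingType) (g : {rmorphism B -> C}) (x : C) :
  (map_poly g h).[x] = 0 ->
  exists f : {rmorphism {poly %/ h} -> C},
    forall P, f (in_qpoly h P) = (map_poly g P).[x].
Proof.
move=> hx.
pose F (P : {poly %/ h}) : C := (map_poly g (P : {poly B})).[x].
have FE P : F (in_qpoly h P) = (map_poly g P).[x].
  rewrite /F /= mk_monicE {2}(Pdiv.RingMonic.rdivp_eq h_mon P).
  by rewrite rmorphD rmorphM hornerD hornerM_comm ?hx ?mulr0 ?add0r //; exact: mulrC.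
have Fz : zmod_morphism F.
  move=> P Q; rewrite -[P in LHS]in_qpoly_val -[Q in LHS]in_qpoly_val -linearB FE.
  by rewrite rmorphB hornerD hornerN.
have Fm : monoid_morphism F.
  split=> [|P Q]; first by rewrite -in_qpoly1 FE rmorph1 hornerC.
  rewrite -[P in LHS]in_qpoly_val -[Q in LHS]in_qpoly_val -in_qpolyM FE.
  by rewrite rmorphM hornerM.
pose az := GRing.isZmodMorphism.Build _ _ F Fz.
pose am := GRing.isMonoidMorphism.Build _ _ F Fm.
pose f : {rmorphism {poly %/ h} -> C} := HB.pack F az am.
by exists f.
Qed.

Lemma qpolyC_in (c : B) : qpolyC h c = in_qpoly h c%:P.
Proof.
apply: val_inj; rewrite /= Pdiv.Ring.rmodp_small // mk_monicE size_polyC.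
by apply: leq_ltn_trans h_size; case: eqP.
Qed.

Lemma in_qpoly_sum (P : {poly B}) : in_qpoly h P =
  \sum_(i < size P) qpolyC h P`_i * qpolyX h ^+ i.
Proof.
rewrite -{1}[P]coefK poly_def rmorph_sum; apply: eq_bigr => i _.
by rewrite -mul_polyC rmorphM rmorphXn qpolyC_in.
Qed.

Lemma in_qpoly_horner (P : {poly B}) :
  in_qpoly h P = (map_poly (qpolyC h) P).[qpolyX h].
Proof.
rewrite in_qpoly_sum (@horner_coef_wide _ (size P)); last exact: size_poly.
by apply: eq_bigr => i _; rewrite coef_map.
Qed.

Lemma qpolyX_root : (map_poly (qpolyC h) h).[qpolyX h] = 0.
Proof. by rewrite -in_qpoly_horner in_qpoly_self. Qed.

Lemma qpoly_coef_sum (b : nat -> B) i : (i < (size h).-1)%N ->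
  ((\sum_(j < (size h).-1) qpolyC h (b j) * qpolyX h ^+ j : {poly %/ h}) : {poly B})`_i
  = b i.
Proof.
move=> ih.
have -> : \sum_(j < (size h).-1) qpolyC h (b j) * qpolyX h ^+ j
    = in_qpoly h (\poly_(j < (size h).-1) b j).
  rewrite poly_def rmorph_sum; apply: eq_bigr => j _.
  by rewrite -mul_polyC rmorphM rmorphXn qpolyC_in.
rewrite in_qpoly_small ?coef_poly ?ih // mk_monicE.
by rewrite (leq_ltn_trans (size_poly _ _)) // prednK // ltnW.
Qed.

End Quotient.

Section Biquotient.
Variables (B : comNzRingType) (h : {poly B}).
Hypotheses (h_mon : h \is monic) (h_size : (1 < size h)%N).
Let Q := {poly %/ h}.
Let hQ := map_poly (qpolyC h) h : {poly Q}.

Lemma biquotient_monic : hQ \is monic.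
Proof. exact: monic_map. Qed.

Lemma biquotient_size : size hQ = size h.
Proof.
rewrite size_map_poly_id0 // (monicP h_mon) rmorph1 oner_eq0 //.
Qed.

(** [biX] and [biY] are the generic pair of roots of h: an identity valid at all pairs of roots can
    be read coefficientwise here, by [biquotient_basis]. *)
Definition biX : {poly %/ hQ} := qpolyC hQ (qpolyX h).
Definition biY : {poly %/ hQ} := qpolyX hQ.
Definition biC (b : B) : {poly %/ hQ} := qpolyC hQ (qpolyC h b).

Lemma biquotient_basis (b : nat -> nat -> B) (d := (size h).-1) :
  \sum_(i < d) \sum_(j < d) biC (b i j) * biX ^+ i * biY ^+ j = 0 ->
  forall i j, (i < d)%N -> (j < d)%N -> b i j = 0.
Proof.
move=> e i j id jd.
pose c j := \sum_(i < d) qpolyC h (b i j) * qpolyX h ^+ i.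
have e' : \sum_(j < (size hQ).-1) qpolyC hQ (c j) * qpolyX hQ ^+ j = 0.
  rewrite biquotient_size -/d -[RHS]e [RHS]exchange_big; apply: eq_bigr => k _ /=.
  rewrite rmorph_sum mulr_suml; apply: eq_bigr => m _.
  by rewrite rmorphM rmorphXn.
have := @qpoly_coef_sum _ hQ biquotient_monic _ c j.
rewrite biquotient_size => /(_ h_size jd); rewrite -/d.
rewrite biquotient_size -/d in e'; rewrite e' coef0 => cj.
by have := qpoly_coef_sum h_mon h_size (b^~ j) id; rewrite -/(c j) -cj coef0.
Qed.

End Biquotient.

Notation trunc M R := {poly %/ ('X^(M.+1) : {poly R})}.
Notation tX M R := (qpolyX ('X^(M.+1) : {poly R})).
Notation tC M R := (qpolyC ('X^(M.+1) : {poly R})).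

Section Truncated.
Variables (M : nat) (R : comNzRingType).
Implicit Types f g : trunc M R.

Lemma truncX_monic : ('X^(M.+1) : {poly R}) \is monic. Proof. exact: monicXn. Qed.
Lemma truncX_size : (1 < size ('X^(M.+1) : {poly R}))%N.
Proof. by rewrite size_polyXn. Qed.

Lemma trunc_mk : mk_monic 'X^(M.+1) = 'X^(M.+1) :> {poly R}.
Proof. exact: mk_monicE truncX_monic truncX_size. Qed.

Lemma trunc_eq f g :
  (forall i, (i <= M)%N -> (f : {poly R})`_i = (g : {poly R})`_i) -> f = g.
Proof.
have sz (u : trunc M R) i : (M < i)%N -> (u : {poly R})`_i = 0.
  move=> Mi; apply: nth_default; apply: leq_trans Mi.
  have := size_mk_monic u; set s := size (mk_monic _) => us.
  by rewrite -ltnS -(size_polyXn R M.+1) -trunc_mk -/s.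
move=> e; apply: val_inj; apply/polyP => i; have [/e //|Mi] := leqP i M.
by rewrite !sz.
Qed.

Lemma coef_in_trunc (P : {poly R}) i : (i <= M)%N ->
  (in_qpoly 'X^(M.+1) P : {poly R})`_i = P`_i.
Proof.
move=> iM; rewrite {2}(Pdiv.RingMonic.rdivp_eq truncX_monic P) coefD coefMXn.
by rewrite ltnS iM add0r /= trunc_mk.
Qed.

Lemma coef_truncM f g i : (i <= M)%N ->
  (f * g : {poly R})`_i
  = \sum_(j < i.+1) (f : {poly R})`_j * (g : {poly R})`_(i - j).
Proof. by move=> iM; rewrite coef_in_trunc // coefM. Qed.

Lemma tXE n : tX M R ^+ n = in_qpoly 'X^(M.+1) 'X^n.
Proof. by rewrite rmorphXn. Qed.

Lemma tX_nil : tX M R ^+ M.+1 = 0.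
Proof. by rewrite tXE in_qpoly_self ?truncX_monic ?truncX_size. Qed.

Lemma tX_isnil : nil (tX M R).
Proof. by exists M.+1; exact: tX_nil. Qed.

Lemma coef_tX n i : (i <= M)%N -> (tX M R ^+ n : {poly R})`_i = (i == n)%:R.
Proof. by move=> iM; rewrite tXE coef_in_trunc // coefXn. Qed.

Lemma coef_tCX (c : R) n i : (i <= M)%N ->
  (tC M R c * tX M R ^+ n : {poly R})`_i = if i == n then c else 0.
Proof.
move=> iM; rewrite qpolyC_in ?truncX_monic ?truncX_size // tXE -rmorphM.
rewrite coef_in_trunc // coefCM coefXn.
by case: eqP; rewrite ?mulr1 ?mulr0.
Qed.

Lemma coef_tC (c : R) i : (tC M R c : {poly R})`_i = if i == 0%N then c else 0.
Proof. by rewrite qpolyCE coefC. Qed.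

Lemma trunc_lift (C : comNzRingType) (g : {rmorphism R -> C}) (x : C) :
  x ^+ M.+1 = 0 ->
  exists f : {rmorphism trunc M R -> C},
    f (tX M R) = x /\ forall c, f (tC M R c) = g c.
Proof.
move=> x0; have [|f fE] := @qpoly_lift _ _ truncX_monic truncX_size C g x.
  by rewrite rmorphXn /= map_polyX hornerXn.
exists f; split=> [|c]; first by rewrite fE map_polyX hornerX.
by rewrite qpolyC_in ?truncX_monic ?truncX_size // fE map_polyC hornerC.
Qed.

Lemma trunc_sum f : f = \sum_(i < M.+1) tC M R (f : {poly R})`_i * tX M R ^+ i.
Proof.
apply: trunc_eq => i iM; rewrite poly_of_qpoly_sum coef_sum.
rewrite (bigD1 (Ordinal (iM : (i < M.+1)%N))) //= coef_tCX // eqxx big1 ?addr0 //.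
by move=> j ji; rewrite coef_tCX //; case: eqP => // ij; case/eqP: ji; apply: val_inj.
Qed.

(** The Euler derivation t d/dt, which preserves the ideal (t^(M+1)), as d/dt in general does
    not. *)
Definition tderiv f : trunc M R :=
  in_qpoly 'X^(M.+1) ('X * ((f : {poly R})^`())).

Lemma coef_tderiv f i : (i <= M)%N ->
  (tderiv f : {poly R})`_i = (f : {poly R})`_i *+ i.
Proof.
by move=> iM; rewrite coef_in_trunc // coefXM coef_deriv; case: i iM.
Qed.

End Truncated.

(** * Derivations and logarithmic derivatives *)

Definition derivation (T : comNzRingType) (D : T -> T) : Prop :=
  (forall x y, D (x + y) = D x + D y) /\
  (forall x y, D (x * y) = D x * y + x * D y).

Lemma tderiv_derivation M (R : comNzRingType) : derivation (@tderiv M R).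
Proof.
split=> x y; apply: trunc_eq => i iM; rewrite ?coefD !coef_tderiv //.
  by rewrite coefD mulrnDl.
rewrite !coef_truncM // -big_split -sumrMnl; apply: eq_bigr => j _ /=.
have ji : (j <= i)%N by rewrite -ltnS.
rewrite !coef_tderiv ?(leq_trans (leq_subr _ _)) ?(leq_trans ji) //.
by rewrite mulrnAl mulrnAr -mulrnDr subnKC.
Qed.

Lemma tderivC M (R : comNzRingType) (c : R) : tderiv (tC M R c) = 0.
Proof.
by apply: trunc_eq => -[|i] iM; rewrite coef_tderiv // coef_tC // coef0 ?mulr0n // mul0rn.
Qed.

Lemma tderivX M (R : comNzRingType) : tderiv (tX M R) = tX M R * 1.
Proof.
apply: trunc_eq => i iM; rewrite mulr1 coef_tderiv //.
have := coef_tX R 1 iM; rewrite expr1 => ->.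
by case: i iM => [|[|i]] iM; rewrite ?mulr0n ?mul0rn.
Qed.

Section Derivation.
Variables (T : comNzRingType) (D : T -> T) (dD : derivation D).

Lemma derD x y : D (x + y) = D x + D y. Proof. by case: dD. Qed.
Lemma derM x y : D (x * y) = D x * y + x * D y. Proof. by case: dD. Qed.

Lemma der0 : D 0 = 0.
Proof. by apply: (addrI (D 0)); rewrite -derD !addr0. Qed.

Lemma der1 : D 1 = 0.
Proof. by apply: (addrI (D 1)); have := derM 1 1; rewrite !mul1r mulr1 addr0. Qed.

Lemma der_sum (I : Type) (r : seq I) (P : pred I) (F : I -> T) :
  D (\sum_(i <- r | P i) F i) = \sum_(i <- r | P i) D (F i).
Proof. exact: (big_morph D derD der0). Qed.

Lemma der_exp x n c : D x = x * c -> D (x ^+ n) = x ^+ n * (c *+ n).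
Proof.
move=> e; elim: n => [|n IH]; first by rewrite expr0 der1 mulr0n mulr0.
by rewrite exprS derM e IH mulrS; ring.
Qed.

(* [D x = x * a] says that [a] is the logarithmic derivative of [x]. *)
Lemma logderM x y a b : D x = x * a -> D y = y * b -> D (x * y) = x * y * (a + b).
Proof. by move=> ex ey; rewrite derM ex ey; ring. Qed.

Lemma logder_prod (I : Type) (r : seq I) (P : pred I) (F G : I -> T) :
  (forall i, P i -> D (F i) = F i * G i) ->
  D (\prod_(i <- r | P i) F i) = (\prod_(i <- r | P i) F i) * \sum_(i <- r | P i) G i.
Proof.
move=> h; elim: r => [|i r IH]; first by rewrite !big_nil der1 mulr0.
by rewrite !big_cons; case: ifP => // Pi; apply: logderM => //; apply: h.
Qed.

End Derivation.

(** As a has no constant term, the equation in degree i > 0 expresses i f_i through lower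
    coefficients of f, and torsion-freeness removes the factor i. *)
Lemma logder_unique M (R : comNzRingType) (f g a : trunc M R) :
  torsion_free R -> (f : {poly R})`_0 = (g : {poly R})`_0 ->
  (a : {poly R})`_0 = 0 ->
  tderiv f = f * a -> tderiv g = g * a -> f = g.
Proof.
move=> tf e0 a0 ef eg; apply: trunc_eq; elim/ltn_ind=> -[|i] IH iM //.
have := congr1 (fun u : trunc M R => (u : {poly R})`_i.+1) ef.
have := congr1 (fun u : trunc M R => (u : {poly R})`_i.+1) eg.
rewrite /= !coef_tderiv // !coef_truncM // !(big_ord_recr i.+1) /= subnn a0 !mulr0 !addr0.
move=> eg' ef'; apply: (tf i.+1) => //; rewrite ef' eg'.
by apply: eq_bigr => j _; rewrite IH // ltnW // (leq_trans _ iM).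
Qed.

(** * The Artin-Hasse exponential *)

Section Shift.
Variable V : nmodType.

Lemma sum_shift (F : nat -> V) c K : (forall m, (K <= m + c)%N -> F m = 0) ->
  \sum_(N < K | (c <= N)%N) F (N - c)%N = \sum_(m < K) F m.
Proof.
move=> F0; have [cK|Kc] := leqP c K; last first.
  rewrite [LHS]big1 => [|i ci]; last by have := ltn_ord i; lia.
  by rewrite big1 // => i _; apply: F0; lia.
rewrite -(subnKC cK) big_split_ord /= big1 ?add0r => [|i ci]; last first.
  by have := ltn_ord i; lia.
rewrite (eq_bigl predT) => [|i]; last by rewrite leq_addr.
rewrite [in RHS]addnC [RHS]big_split_ord /= [X in _ + X]big1 ?addr0 => [|i _].
  by apply: eq_bigr => i _; rewrite addKn.
by apply: F0; lia.
Qed.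

Lemma sum_triangle (G : nat -> nat -> V) K :
  (forall k m, (K <= k + m)%N -> G k m = 0) ->
  \sum_(k < K) \sum_(m < K) G k m = \sum_(N < K) \sum_(i < N.+1) G i (N - i)%N.
Proof.
move=> G0.
transitivity (\sum_(k < K) \sum_(N < K | (k <= N)%N) G k (N - k)%N).
  apply: eq_bigr => k _; rewrite (@sum_shift (G k)) // => m mk.
  by apply: G0; rewrite addnC.
rewrite (exchange_big_dep predT) //=; apply: eq_bigr => N _.
rewrite (big_ord_widen_cond K (fun=> true) (fun i => G i (N - i)%N)) //.
Qed.
End Shift.

Section ArtinHasse.
Variables (p : nat) (p_pr : prime p).

Let p_gt1 : (1 < p)%N := prime_gt1 p_pr.

(* The coefficients of the Artin-Hasse exponential
   AH(x) = exp(x + x^p / p + x^(p^2) / p^2 + ...): the recursion expresses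
   x AH'(x) = AH(x) (x + x^p + x^(p^2) + ...). *)
Definition ahseq (T : comNzRingType) (a : nat -> T) : Prop :=
  a 0%N = 1 /\
  forall n, a n *+ n = \sum_(k < n | (p ^ k <= n)%N) a (n - p ^ k)%N.

Section LogDerivative.
Variables (T : comNzRingType) (D : T -> T) (dD : derivation D).
Variables (a : nat -> T) (ah : ahseq a) (Da : forall i, D (a i) = 0).

(** By the chain rule D multiplies the i-th term by i c. The recursion in [ahseq] turns the new
    coefficients into a convolution, and y^K = 0 removes the terms by which it differs from a
    product. *)
Lemma logder_ah y c K : y ^+ K = 0 -> D y = y * c ->
  D (ev a y) = ev a y * (c * \sum_(k < K) y ^+ (p ^ k)).
Proof.
move=> yK Dy; rewrite !(evE _ yK).
transitivity (c * \sum_(i < K) (a i *+ i) * y ^+ i).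
  rewrite (der_sum dD) mulr_sumr; apply: eq_bigr => i _.
  rewrite (derM dD) Da mul0r add0r (der_exp dD _ Dy).
  by rewrite -[c *+ i]mulr_natr -[a i *+ i]mulr_natr; ring.
rewrite mulrCA; congr (_ * _); rewrite mulr_sumr.
transitivity (\sum_(i < K) \sum_(k < K | (p ^ k <= i)%N) a (i - p ^ k)%N * y ^+ i).
  apply: eq_bigr => i _; rewrite ah.2 mulr_suml.
  rewrite (big_ord_widen_cond K (fun k => (p ^ k <= i)%N)
    (fun k => a (i - p ^ k)%N * y ^+ i)) ?(ltnW (ltn_ord i)) //.
  apply: eq_bigl => k; rewrite andb_idr // => /(leq_trans _) -> //.
  exact: ltn_expl.
rewrite (exchange_big_dep predT) //=; apply: eq_bigr => k _.
rewrite mulr_suml -(@sum_shift _ (fun i => a i * y ^+ i * y ^+ (p ^ k)) (p ^ k)).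
  by apply: eq_bigr => i ki; rewrite -mulrA -exprD subnK.
by move=> m mK; rewrite -mulrA -exprD (exp_nil_leq yK) ?mulr0.
Qed.

(** The k-th factor contributes p^k w_k^(p^m) y^(p^(k+m)) for each m; collecting by N = k + m
    produces the ghost component of index N. This is the link between the pairing E and Witt vector
    operations. *)
Lemma logder_ah_prod (w : nat -> T) y c K : y ^+ K = 0 -> D y = y * c ->
  (forall k, D (w k) = 0) ->
  let e := \prod_(k < K) ev a (w k * y ^+ (p ^ k)) in
  D e = e * (c * \sum_(N < K) ghost p w N * y ^+ (p ^ N)).
Proof.
move=> yK Dy Dw /=.
have nK k : (w k * y ^+ (p ^ k)) ^+ K = 0.
  rewrite exprMn -exprM mulnC exprM yK expr0n -[_ == _]negbK -lt0n expn_gt0.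
  by rewrite prime_gt0 ?mulr0.
have DwX k : D (w k * y ^+ (p ^ k)) = w k * y ^+ (p ^ k) * (c *+ p ^ k).
  by rewrite (derM dD) Dw mul0r add0r (der_exp dD _ Dy) mulrA.
rewrite (@logder_prod _ _ dD _ _ _ _ (fun k : 'I_K => (c *+ p ^ k) *
  \sum_(m < K) (w k * y ^+ (p ^ k)) ^+ (p ^ m))); last first.
  by move=> k _; apply: logder_ah (nK k) (DwX k).
congr (_ * _).
pose G k m := w k ^+ (p ^ m) * y ^+ (p ^ (k + m)) *+ p ^ k.
transitivity (c * \sum_(k < K) \sum_(m < K) G k m).
  rewrite mulr_sumr; apply: eq_bigr => k _.
  rewrite mulrnAl -mulrnAr; congr (_ * _); rewrite -sumrMnl; apply: eq_bigr => m _.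
  by rewrite /G exprMn -exprM expnD.
rewrite sum_triangle => [|k m km]; last first.
  rewrite /G (exp_nil_leq yK) ?mulr0 ?mul0rn //.
  by rewrite (leq_trans km) // ltnW // ltn_expl.
congr (_ * _); apply: eq_bigr => N _; rewrite mulr_suml.
apply: eq_bigr => i _; rewrite /G subnKC; last by rewrite -ltnS.
by rewrite mulrnAl.
Qed.
End LogDerivative.

Fixpoint ahs n : seq rat :=
  if n is m.+1 then
    let s := ahs m in
    rcons s ((\sum_(k < m.+1 | (p ^ k <= m.+1)%N) nth 0 s (m.+1 - p ^ k)%N)
             / m.+1%:R)
  else [:: 1].

Definition ahq n : rat := nth 0 (ahs n) n.

Lemma size_ahs n : size (ahs n) = n.+1.
Proof. by elim: n => //= n IH; rewrite size_rcons IH. Qed.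

Lemma nth_ahs n i : (i <= n)%N -> nth 0 (ahs n) i = ahq i.
Proof.
elim: n => [|n IH]; first by rewrite leqn0 => /eqP ->.
rewrite leq_eqVlt => /orP[/eqP -> //|lt].
by rewrite -IH //= nth_rcons size_ahs lt.
Qed.

Lemma ahqP : ahseq ahq.
Proof.
split=> // -[|n]; first by rewrite big_ord0.
rewrite {1}/ahq /= nth_rcons size_ahs ltnn eqxx.
rewrite -[LHS]mulr_natr divfK ?pnatr_eq0 //; apply: eq_bigr => k _.
rewrite nth_ahs // -ltnS ltn_subrL /= expn_gt0 prime_gt0 //.
Qed.

End ArtinHasse.

Lemma trunc_coef0 M (R : comNzRingType) :
  exists f : {rmorphism trunc M R -> R}, forall u, f u = (u : {poly R})`_0.
Proof.
have [|f fE] := @qpoly_lift _ _ (truncX_monic M R) (truncX_size M R) R idfun 0.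
  by rewrite map_poly_id // hornerXn expr0n.
exists f => u; rewrite -{1}[u]in_qpoly_val fE map_poly_id // horner_coef0 //.
Qed.

Lemma ev0 (C : comNzRingType) (f : nat -> C) : ev f 0 = f 0%N.
Proof. by rewrite (@evE _ _ _ 1%N) // big_ord1 mulr1. Qed.

Lemma rat_tf : torsion_free rat.
Proof.
move=> n f g n0 e; apply: (mulIf (_ : (n%:R : rat) != 0)).
  by rewrite pnatr_eq0 -lt0n.
by rewrite !mulr_natr.
Qed.

Lemma rmorph_ahseq p (T T' : comNzRingType) (g : {rmorphism T -> T'}) a :
  ahseq p a -> ahseq p (g \o a).
Proof.
case=> a0 aS; split=> [|n] /=; first by rewrite a0 rmorph1.
by rewrite -rmorphMn aS rmorph_sum.
Qed.

(** The induction bounds Legendre's partial sums by n (1 - p^(-K)), written without denominators. *)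
Lemma logn_fact_lt p n : prime p -> (0 < n)%N -> (logn p n`! < n)%N.
Proof.
move=> p_pr n0; rewrite logn_fact //.
have p2 := prime_gt1 p_pr.
have H K : ((\sum_(1 <= k < K.+1) n %/ p ^ k) * p ^ K + n <= n * p ^ K)%N.
  elim: K => [|K IH]; first by rewrite big_geq // mul0n muln1.
  rewrite big_nat_recr //=; set S := (\sum_(_ <= _ < _) _)%N in IH *.
  have := leq_trunc_div n (p ^ K.+1); rewrite mulnDl expnS.
  set d := (_ %/ _ * _)%N => dn; nia.
have := H n; set S := (\sum_(_ <= _ < _) _)%N => SH.
rewrite ltnNge; apply/negP => nS.
have : (n * p ^ n + n <= n * p ^ n)%N.
  by apply: leq_trans SH; rewrite leq_add2r leq_mul2r nS orbT.
by lia.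
Qed.

Section Integrality.
Variables (p : nat) (p_pr : prime p).
Local Notation Z := (zloc p).
Let p_gt1 : (1 < p)%N := prime_gt1 p_pr.

Lemma cong_sumX (R : comNzRingType) n (x : nat -> R) :
  cong p ((\sum_(i < n) x i) ^+ p) (\sum_(i < n) x i ^+ p).
Proof.
elim: n => [|n IH].
  by rewrite !big_ord0 expr0n -[p == _]negbK -lt0n prime_gt0 //; apply: cong_refl.
rewrite !big_ord_recr /=; apply: (cong_trans (cong_freshman _ _ p_pr)).
by apply: congD => //; apply: cong_refl.
Qed.

Lemma cong_natX (R : comNzRingType) n : cong p ((n%:R : R) ^+ p) n%:R.
Proof.
have := @cong_sumX R n (fun=> 1); rewrite expr1n !sumr_const card_ord.
by [].
Qed.

Lemma cong_intX (R : comNzRingType) (a : int) : cong p ((a%:~R : R) ^+ p) a%:~R.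
Proof.
case: a => n; first exact: cong_natX.
rewrite NegzE rmorphN /=; apply: (cong_trans (cong_sym (cong_oppX _ p_pr))).
by apply: congN; apply: cong_natX.
Qed.

Lemma zloc_fermat (b : Z) : cong p (b ^+ p) b.
Proof.
have /plocalP[m [a [pm e]]] := valP b.
have [u mu] := zloc_unit p_pr pm.
have bm : b * m%:R = a%:~R.
  by apply: val_inj; rewrite rmorphM rmorph_nat rmorph_int /= e.
have H : cong p (b ^+ p * m%:R) (b * m%:R).
  apply: (@cong_trans _ _ _ (b ^+ p * m%:R ^+ p)).
    by apply: congM; [apply: cong_refl|apply/cong_sym/cong_natX].
  by rewrite -exprMn bm; apply: cong_intX.
have := congM H (cong_refl p u).
by rewrite -!mulrA mu !mulr1.
Qed.

Lemma expp_fact i : (0 < i)%N -> (p%:R ^+ i.-1 / i`!%:R : rat) \in plocal p.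
Proof.
move=> i0; have := logn_fact_lt p_pr i0; set v := logn _ _ => vi.
have i0' := fact_gt0 i.
have [m pm im] := pfactor_coprime p_pr i0'; rewrite -/v in im.
have m0 : (0 < m)%N by have := i0'; rewrite im muln_gt0 => /andP[].
apply/plocalP; exists m, (p ^ (i.-1 - v))%N%:Z; split=> //.
have -> : (i.-1 = (i.-1 - v) + v)%N by lia.
rewrite addnK im natrM exprD -!natrX.
have mN : (m%:R : rat) != 0 by rewrite pnatr_eq0 -lt0n.
have pN : ((p ^ v)%:R : rat) != 0 by rewrite pnatr_eq0 -lt0n expn_gt0 prime_gt0.
by rewrite -[RHS]/((p ^ (i.-1 - v))%:R); field; rewrite mN pN.
Qed.

Lemma expr_nilD (T : comNzRingType) (v w : T) m : w * w = 0 -> v * w = w ->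
  (v + w) ^+ m = v ^+ m + w *+ m.
Proof.
move=> ww vw; elim: m => [|m IH]; first by rewrite !expr0 mulr0n addr0.
have vmw : v ^+ m * w = w by elim: (m) => [|k IHk]; rewrite ?mul1r // exprSr -mulrA vw.
rewrite exprSr IH mulrDl !mulrDr -exprSr vmw !mulrnAl ww mul0rn addr0.
by rewrite [w * v]mulrC vw mulrS addrA.
Qed.

(** Both sides have logarithmic derivative p (t + t^p + t^(p^2) + ...): substituting t^p shifts the
    series and brings in a factor p, and e = exp(p t) restores the missing first term p t. *)
Lemma ahqX n (T := trunc n rat) (a := tC n rat \o ahq p) (t := tX n rat)
  (e := \sum_(i < n.+1) tC n rat (p%:R ^+ i / i`!%:R) * t ^+ i) :
  ev a t ^+ p = ev a (t ^+ p) * e.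
Proof.
have aS : ahseq p a by apply: rmorph_ahseq; apply: ahqP.
have dD := @tderiv_derivation n rat.
have DC c : tderiv (tC n rat c) = 0 by exact: tderivC.
have t0 : t ^+ n.+1 = 0 by apply: tX_nil.
have Dt : tderiv t = t * 1 by exact: tderivX.
have Da i : tderiv (a i) = 0 by apply: DC.
have ef k : (k < n)%N -> (p%:R ^+ k.+1 / (k.+1)`!%:R *+ k.+1 = p%:R * (p%:R ^+ k / k`!%:R) :> rat).
  move=> _; rewrite factS natrM invfM exprS -mulr_natr.
  have kN : (k.+1%:R : rat) != 0 by rewrite pnatr_eq0.
  by rewrite -!mulrA; do 2 congr (_ * _); rewrite mulrC mulfK.
have De : tderiv e = e * (t *+ p).
  rewrite /e (der_sum dD) mulr_suml [LHS]big_ord_recl [RHS]big_ord_recr.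
  rewrite [t ^+ ord0]expr0 [X in tderiv X + _]mulr1 DC add0r /=.
  rewrite -[X in _ = _ + X]mulrA mulrnAr -exprSr t0 mul0rn mulr0 addr0.
  apply: eq_bigr => i _; rewrite (derM dD) DC mul0r add0r (der_exp dD _ Dt).
  rewrite /bump /= add1n mulr_natr mulrnAr -mulrnAl -rmorphMn /= ef // rmorphM rmorph_nat.
  by rewrite [t ^+ i.+1]exprS -[t *+ p]mulr_natr; ring.
have [f fE] := trunc_coef0 n rat.
have ft : f t = 0.
  by rewrite fE; have := coef_tX rat 1 (leq0n n); rewrite expr1.
have fa y : nil y -> f y = 0 -> f (ev a y) = 1.
  move=> ny fy; rewrite ev_rmorph // fy ev0 /= fE coef_tC.
  by have [-> _] := ahqP p_pr.
have fe : f e = 1.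
  rewrite /e rmorph_sum big_ord_recl big1 ?addr0 => [|i _].
    by rewrite [t ^+ _]expr0 mulr1 fE coef_tC /= mul1r invr1.
  by rewrite rmorphM rmorphXn ft expr0n mulr0.
have nt : nil t by exists n.+1.
have ntp : nil (t ^+ p) by apply: nil_exp; rewrite ?prime_gt0.
have ftp : f (t ^+ p) = 0 by rewrite rmorphXn ft expr0n -[_ == _]negbK -lt0n prime_gt0.
have lt := logder_ah p_pr dD aS Da t0 Dt.
have Dtp := der_exp dD p Dt.
have tp0 : (t ^+ p) ^+ n.+1 = 0 by rewrite -exprM mulnC exprM t0 expr0n -[_ == _]negbK -lt0n prime_gt0.
have ltp := logder_ah p_pr dD aS Da tp0 Dtp.
apply: (logder_unique (a := (\sum_(k < n.+1) t ^+ (p ^ k)) *+ p)).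
- exact: rat_tf.
- by rewrite -!fE rmorphXn rmorphM fa // fa // fe mulr1 expr1n.
- rewrite -fE rmorphMn rmorph_sum big1 ?mul0rn // => i _.
  by rewrite rmorphXn ft expr0n -[_ == _]negbK -lt0n expn_gt0 prime_gt0.
- by rewrite (der_exp dD _ lt) mul1r.
- rewrite (logderM dD ltp De); congr (_ * _).
  rewrite mulr_natl -mulrnDl; congr (_ *+ _).
  apply: esym; rewrite [LHS]big_ord_recl [in RHS]big_ord_recr /= [t ^+ (p ^ 0)]expr1 addrC.
  congr (_ + _); rewrite -[LHS]addr0; congr (_ + _); last first.
    by apply: esym; rewrite -exprM -expnS (exp_nil_leq t0) // ltnW // ltn_expl.
  by apply: eq_bigr => i _; rewrite -exprM -expnS.
Qed.

(* Dwork's argument: AH(t)^p = AH(t^p) exp(p t), and the non-constant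
   coefficients of exp(p t) are divisible by p in Z_(p). *)
Lemma ahq_plocal n : ahq p n \in plocal p.
Proof.
elim/ltn_ind: n => -[|n] IH; first by rewrite (ahqP p_pr).1 rpred1.
set N := n.+1 in IH *.
pose b i : Z := insubd 0 (ahq p i).
have bE i : (i < N)%N -> val (b i) = ahq p i by move=> iN; rewrite insubdK //; apply: IH.
pose dq i : rat := p%:R ^+ i.-1 / i`!%:R.
pose d i : Z := if i is 0%N then 0 else insubd 0 (dq i).
have dE i : (0 < i)%N -> val (d i) = dq i.
  by case: i => // i _; rewrite /d insubdK //; apply: expp_fact.
pose t := tX N Z; pose tq := tX N rat.
have [io [ioX ioC]] := @trunc_lift N Z (trunc N rat) (tC N rat \o val) tq (tX_nil _ _).
rewrite -/t in ioX.
pose u : trunc N Z := \sum_(i < N) tC N Z (b i) * t ^+ i.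
pose u' : trunc N Z := \sum_(i < N) tC N Z (b i) * t ^+ (p * i).
pose e' : trunc N Z := \sum_(i < N) tC N Z (d i.+1) * t ^+ i.+1.
have tq0 : tq ^+ N.+1 = 0 by apply: tX_nil.
pose a := tC N rat \o ahq p.
have auE : ev a tq = io u + tC N rat (ahq p N) * tq ^+ N.
  rewrite (evE _ tq0) big_ord_recr /=; congr (_ + _); rewrite rmorph_sum.
  by apply: eq_bigr => i _; rewrite rmorphM rmorphXn ioX ioC /= bE.
have au'E : ev a (tq ^+ p) = io u'.
  have tqp0 : (tq ^+ p) ^+ N = 0.
    by rewrite -exprM (exp_nil_leq tq0) // /N; nia.
  rewrite (evE _ tqp0) rmorph_sum.
  by apply: eq_bigr => i _; rewrite rmorphM rmorphXn ioX ioC /= bE // exprM.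
have eE : \sum_(i < N.+1) tC N rat (p%:R ^+ i / i`!%:R) * tq ^+ i
    = 1 + io e' *+ p.
  rewrite big_ord_recl; congr (_ + _).
    by rewrite [tq ^+ _]expr0 mulr1 /= mul1r invr1.
  rewrite rmorph_sum -sumrMnl; apply: eq_bigr => i _.
  rewrite [io (_ * _)]rmorphM [io (_ ^+ _)]rmorphXn ioX ioC -mulrnAl; congr (_ * _).
  rewrite -rmorphMn; congr (tC _ _ _).
  rewrite rmorphMn lift0 exprS -[RHS]mulr_natl -mulrA; congr (_ * _); exact: esym (dE i.+1 isT).
have : ev a tq ^+ p = ev a (tq ^+ p) *
    \sum_(i < N.+1) tC N rat (p%:R ^+ i / i`!%:R) * tq ^+ i := ahqX N.
(* The unknown coefficient c_N enters through w = c_N t^N alone. As w^2 = 0 and the lower part fixes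
   w, the p-th power contains it as p w; all other terms are p times something defined over
   Z_(p). *)
rewrite auE au'E eE expr_nilD; last first.
- rewrite mulrA [io u * _]mulrC -mulrA rmorph_sum mulr_suml big_ord_recl.
  rewrite big1 ?addr0 => [|i _]; last first.
    rewrite [io (_ * _)]rmorphM [io (_ ^+ _)]rmorphXn ioX -mulrA -exprD.
    by rewrite (exp_nil_leq tq0) ?mulr0 // lift0 addSn ltnS leq_addl.
  rewrite [t ^+ _]expr0 mulr1 ioC /= bE // (ahqP p_pr).1.
  by rewrite rmorph1 mul1r.
- by rewrite mulrACA -exprD (exp_nil_leq tq0) ?mulr0 // /N; lia.
rewrite mulrDr mulr1 => /(canRL (addKr _)); rewrite mulrnAr.
have [h hE] : cong p u' (u ^+ p).
  apply: cong_sym; apply: (cong_trans (@cong_sumX _ N (fun i => tC N Z (b i) * t ^+ i))).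
  apply: cong_sum => i _; rewrite exprMn -exprM mulnC; apply: congM; last exact: cong_refl.
  have [k kE] := zloc_fermat (b i); exists (tC N Z k).
  by rewrite -rmorphXn -rmorphB kE rmorphMn.
rewrite -[io u ^+ p]rmorphXn addrA [- _ + _]addrC -rmorphB hE -rmorphM -rmorphMn -rmorphD -mulrnDl.
set x := h + _; rewrite rmorphMn => /(congr1 (fun v : trunc N rat => (v : {poly rat})`_N)).
have ioE v : (io v : {poly rat})`_N = val ((v : {poly Z})`_N).
  rewrite {1}[v]trunc_sum rmorph_sum poly_of_qpoly_sum coef_sum big_ord_recr big1 /=.
    by rewrite add0r rmorphM rmorphXn ioX ioC coef_tCX // eqxx.
  move=> i _; rewrite rmorphM rmorphXn ioX ioC coef_tCX //.
  by case: eqP => // iN; have := ltn_ord i; rewrite -iN ltnn.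
rewrite !raddfMn /= !coefMn coef_tCX // eqxx ioE => /(rat_tf (prime_gt0 p_pr)) ->.
exact: valP.
Qed.

Definition ahz n : Z := ZLoc (ahq_plocal n).

Lemma ahzP : ahseq p ahz.
Proof.
have [a0 aS] := ahqP p_pr; split; first exact: val_inj.
by move=> n; apply: val_inj; rewrite raddfMn raddf_sum /= aS.
Qed.

Definition ah (C : comNzRingType) (n : nat) : C :=
  if pselect (islocal p C) is left h then projT1 (cid h) (ahz n) else 0.

Lemma ah_zloc (C : comNzRingType) (f : {rmorphism Z -> C}) n : ah C n = f (ahz n).
Proof.
rewrite /ah; case: pselect => [h|[]]; last by exists f.
by case: cid => g _ /=; apply: (zloc_rmorphism_unique p_pr).
Qed.

Lemma ah_rmorph (C C' : comNzRingType) (g : {rmorphism C -> C'}) n :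
  islocal p C -> g (ah C n) = ah C' n.
Proof. by case=> f _; rewrite (ah_zloc f) (ah_zloc (g \o f)). Qed.

Lemma ahP (C : comNzRingType) : islocal p C -> ahseq p (ah C).
Proof.
case=> f _; rewrite (_ : ah C = f \o ahz); first exact: rmorph_ahseq ahzP.
by apply/funext => n; apply: ah_zloc.
Qed.

End Integrality.

(** * The pairing of Witt vectors with nilpotent elements *)

Section WittExponential.
Variables (p : nat) (p_pr : prime p).
Local Notation W := (witt p_pr).
Local Notation islocal := (islocal p).

Section WittFacts.
Variable C : comNzRingType.
Implicit Types (x y a : W C).

Lemma ghostD x y m : ghost p (x + y) m = ghost p x m + ghost p y m.
Proof. exact: ghost_add. Qed.
Lemma ghostM x y m : ghost p (x * y) m = ghost p x m * ghost p y m.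
Proof. exact: ghost_mul. Qed.
Lemma ghost_iter_frob k x m : ghost p (iter k (@wfrob p p_pr C) x) m = ghost p x (k + m).
Proof. by elim: k m => //= k IH m; rewrite ghost_frob IH addnS. Qed.
End WittFacts.

Lemma wmap_is_monoid (C C' : comNzRingType) (g : {rmorphism C -> C'}) :
  monoid_morphism (@wmap p p_pr C C' g).
Proof. by split=> [|x y]; [apply: etrans (wmap_teich p_pr g 1) _; rewrite rmorph1|exact: wmap_mul]. Qed.

Lemma wmap_is_zmod (C C' : comNzRingType) (g : {rmorphism C -> C'}) :
  zmod_morphism (@wmap p p_pr C C' g).
Proof. by move=> x y; apply: etrans (wmap_add g x (- y)) _; rewrite [wmap g (- y)]wmap_opp. Qed.

HB.instance Definition _ (C C' : comNzRingType) (g : {rmorphism C -> C'}) :=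
  GRing.isZmodMorphism.Build (W C) (W C') (@wmap p p_pr C C' g) (wmap_is_zmod g).
HB.instance Definition _ (C C' : comNzRingType) (g : {rmorphism C -> C'}) :=
  GRing.isMonoidMorphism.Build (W C) (W C') (@wmap p p_pr C C' g) (wmap_is_monoid g).

Lemma wmap_comp (C C' C'' : comNzRingType) (g : C -> C') (h : C' -> C'') (w : W C) :
  wmap h (wmap g w) = wmap (h \o g) w.
Proof. exact: wittP. Qed.

Lemma wmap_iter_frob (C C' : comNzRingType) (g : {rmorphism C -> C'}) k w :
  wmap g (iter k (@wfrob p p_pr C) w) = iter k (@wfrob p p_pr C') (wmap g w).
Proof. by elim: k => //= k IH; rewrite wmap_frob IH. Qed.

Definition AH (C : comNzRingType) (x : C) : C := ev (ah p_pr C) x.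

Definition E (C : comNzRingType) (w : W C) (x : C) : C :=
  \prod_(k < nilord x) AH (w k * x ^+ (p ^ k)).

Lemma expp_nil (C : comNzRingType) (x : C) m k : x ^+ m = 0 -> (m <= k)%N ->
  x ^+ (p ^ k) = 0.
Proof.
move=> e mk; apply: (exp_nil_leq e); apply: (leq_trans mk).
by rewrite ltnW // ltn_expl // prime_gt1.
Qed.

Section Local.
Variables (C : comNzRingType) (lC : islocal C).
Implicit Types (w : W C) (x : C).

Lemma AH0 : AH 0 = 1 :> C.
Proof. by rewrite /AH ev0 (ahP p_pr lC).1. Qed.

Lemma EE w x m : x ^+ m = 0 ->
  E w x = \prod_(k < m) AH (w k * x ^+ (p ^ k)).
Proof.
move=> e; have e' : x ^+ nilord x = 0 by apply: nilordP; exists m.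
have H n n' : x ^+ n = 0 -> (n <= n')%N ->
    \prod_(k < n') AH (w k * x ^+ (p ^ k)) = \prod_(k < n) AH (w k * x ^+ (p ^ k)).
  move=> en /subnKC <-; rewrite big_split_ord /= [X in _ * X]big1 ?mulr1 // => i _.
  by rewrite (expp_nil en) ?leq_addr // mulr0 AH0.
by rewrite /E; case: (leqP m (nilord x)) => [|/ltnW] le; [apply: H|rewrite (H (nilord x) m)].
Qed.

Lemma E_nil0 w : E w 0 = 1.
Proof. by rewrite (@EE _ _ 1) // big_ord1 expn0 expr1 mulr0 AH0. Qed.

Lemma E_teich (c x : C) : nil x -> E (teich p_pr c) x = AH (c * x).
Proof.
case=> m e; rewrite (@EE _ _ m.+1) ?exprS ?e ?mulr0 // big_ord_recl big1.
  by rewrite mulr1 expn0 expr1.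
by move=> i _; rewrite /= mul0r AH0.
Qed.

Lemma AH_rmorph (C' : comNzRingType) (g : {rmorphism C -> C'}) x :
  nil x -> g (AH x) = AH (g x).
Proof.
move=> nx; rewrite /AH ev_rmorph //; congr ev; apply/funext => i /=.
exact: ah_rmorph.
Qed.
End Local.

Lemma E_rmorph (C C' : comNzRingType) (lC : islocal C) (g : {rmorphism C -> C'})
  (w : W C) x : nil x -> g (E w x) = E (wmap g w) (g x).
Proof.
case=> m e; have lC' := islocal_rmorphism g lC.
rewrite (EE lC _ e) (@EE _ lC' _ _ m); last by rewrite -rmorphXn e rmorph0.
rewrite rmorph_prod; apply: eq_bigr => k _.
rewrite AH_rmorph // ?rmorphM ?rmorphXn //.
by apply: nil_mull; apply: nil_exp; [exists m|rewrite expn_gt0 prime_gt0].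
Qed.

Section Universal.
Variables (M : nat) (R : comNzRingType) (lR : islocal R) (tfR : torsion_free R).
Local Notation T := (trunc M R).
Local Notation t := (tX M R).
Local Notation D := (@tderiv M R).
Local Notation cst := (tC M R).

Let lT : islocal T := islocal_rmorphism cst lR.
Let dD := @tderiv_derivation M R.

Lemma E_logder (w : W R) (y c : T) K : y ^+ K = 0 -> D y = y * c ->
  D (E (wmap cst w) y) = E (wmap cst w) y *
    (c * \sum_(N < K) cst (ghost p w N) * y ^+ (p ^ N)).
Proof.
move=> yK Dy; have aT := ahP p_pr lT; rewrite (EE lT _ yK) /AH.
rewrite (logder_ah_prod p_pr dD aT _ yK Dy) //.
- congr (_ * (_ * _)); apply: eq_bigr => N _; congr (_ * _).
  by rewrite (rmorph_ghost p cst w).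
- by move=> i; rewrite -(ah_rmorph p_pr cst i lR) tderivC.
- by move=> k /=; rewrite tderivC.
Qed.

Lemma logder_trunc_unique (f g a b : T) (h : {rmorphism T -> R}) :
  (forall u, h u = (u : {poly R})`_0) -> h f = 1 -> h g = 1 -> h a = 0 ->
  D f = f * a -> D g = g * b -> a = b -> f = g.
Proof.
move=> hE hf hg ha Df Dg ab; rewrite -ab in Dg.
apply: (logder_unique tfR _ _ Df Dg); by rewrite -?hE ?hf ?hg.
Qed.

Lemma trunc_coef0X : exists h : {rmorphism T -> R},
  [/\ forall u, h u = (u : {poly R})`_0, h t = 0,
   forall w y, nil y -> h y = 0 -> h (E w y) = 1 &
   forall w K (c : T), h (c * \sum_(N < K) cst (ghost p w N) * t ^+ (p ^ N)) = 0].
Proof.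
have [h hE] := trunc_coef0 M R; exists h.
have hX : h t = 0 by rewrite hE; have := coef_tX R 1 (leq0n M); rewrite expr1.
split=> // [w y ny hy|w K c]; first by rewrite E_rmorph // hy E_nil0.
rewrite rmorphM rmorph_sum big1 ?mulr0 // => i _.
by rewrite rmorphM rmorphXn hX expr0n -[_ == _]negbK -lt0n expn_gt0 prime_gt0 // mulr0.
Qed.

Lemma E_add_univ (w w' : W R) :
  E (wmap cst (w + w')) t = E (wmap cst w) t * E (wmap cst w') t.
Proof.
have [h [hE hX hE1 hs]] := trunc_coef0X.
have nt := tX_isnil M R.
have L w0 := E_logder w0 (tX_nil M R) (tderivX M R).
apply: (logder_trunc_unique hE _ _ _ (L _) (logderM dD (L w) (L w'))).
- exact: hE1.
- by rewrite rmorphM !hE1 ?mulr1.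
- exact: hs.
- rewrite -mulrDr -big_split; congr (_ * _); apply: eq_bigr => N _ /=.
  by rewrite ghostD rmorphD mulrDl.
Qed.

(** The k-th factor has logarithmic derivative p^k times the sum over m of a_k^(p^m) Phi_m(w)
    t^(p^(k+m)); collected by N = k + m, this is the formula that defines Phi_N(T_a w). *)
Lemma E_T_univ (a w : W R) : E (wmap cst (wT a w)) t
  = \prod_(k < M.+1) E (wmap cst w) (cst (a k) * t ^+ (p ^ k)).
Proof.
have [h [hE hX hE1 hs]] := trunc_coef0X.
have nt := tX_isnil M R.
pose y k := cst (a k) * t ^+ (p ^ k).
have yK k : y k ^+ M.+1 = 0.
  by rewrite exprMn -exprM mulnC exprM tX_nil expr0n -[_ == _]negbK -lt0n expn_gt0 prime_gt0 ?mulr0.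
have Dy k : D (y k) = y k * (1 *+ p ^ k).
  by rewrite (derM dD) tderivC mul0r add0r (der_exp dD _ (tderivX M R)) mulrA.
have L k := E_logder w (yK k) (Dy k).
have LR := @logder_prod _ _ dD _ (index_enum 'I_M.+1) predT _ _ (fun k _ => L k).
apply: (logder_trunc_unique hE _ _ _ (E_logder _ (tX_nil M R) (tderivX M R)) LR).
- exact: hE1.
- rewrite rmorph_prod big1 // => k _; apply: hE1; first by exists M.+1.
  by rewrite rmorphM rmorphXn hX expr0n -[_ == _]negbK -lt0n expn_gt0 prime_gt0 ?mulr0.
- exact: hs.
pose G k m := cst (a k ^+ (p ^ m) * ghost p w m *+ p ^ k) * t ^+ (p ^ (k + m)).
transitivity (\sum_(k < M.+1) \sum_(m < M.+1) G k m); last first.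
  apply: eq_bigr => k _; rewrite mulr_natl -sumrMnl; apply: eq_bigr => m _.
  rewrite /G /y exprMn -exprM expnD rmorphMn rmorphM rmorphXn mulrA mulrnAl.
  by congr (_ * _ *+ _); apply: mulrC.
rewrite (@sum_triangle _ G) => [|k m km]; last by rewrite /G (expp_nil (tX_nil M R)) ?mulr0.
rewrite mul1r; apply: eq_bigr => N _; rewrite ghost_T rmorph_sum mulr_suml.
by apply: eq_bigr => i _; rewrite /G subnKC // -ltnS.
Qed.

(** The left side has logarithmic derivative the sum of Phi_N(w) Phi_N(S) t^(p^N). Expanding
    Phi_N(S) into its terms p^k S_k^(p^(N-k)) and reading Phi_N(w) as Phi_(N-k)(F^k w) gives the
    right side. *)
Lemma E_teichD_univ (w : W R) (x y : R) (S := teich p_pr x + teich p_pr y) :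
  E (wmap cst w) (cst x * t) * E (wmap cst w) (cst y * t)
  = \prod_(k < M.+1) E (wmap cst (iter k (@wfrob p p_pr R) w))
                       (cst (S k) * t ^+ (p ^ k)).
Proof.
have [h [hE hX hE1 hs]] := trunc_coef0X.
have nt := tX_isnil M R.
pose z k := cst (S k) * t ^+ (p ^ k).
have zK (c : R) k : (cst c * t ^+ (p ^ k)) ^+ M.+1 = 0.
  by rewrite exprMn -exprM mulnC exprM tX_nil expr0n -[_ == _]negbK -lt0n expn_gt0 prime_gt0 ?mulr0.
have Dz (c : R) k : D (cst c * t ^+ (p ^ k)) = cst c * t ^+ (p ^ k) * (1 *+ p ^ k).
  by rewrite (derM dD) tderivC mul0r add0r (der_exp dD _ (tderivX M R)) mulrA.
have L (k : nat) := E_logder (iter k (@wfrob p p_pr R) w) (zK (S k) k) (Dz (S k) k).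
have LR := @logder_prod _ _ dD _ (index_enum 'I_M.+1) predT _ _ (fun k _ => L k).
have Lx := E_logder w (zK x 0) (Dz x 0).
have Ly := E_logder w (zK y 0) (Dz y 0).
have hz (c : R) k : h (cst c * t ^+ (p ^ k)) = 0.
  by rewrite rmorphM rmorphXn hX expr0n -[_ == _]negbK -lt0n expn_gt0 prime_gt0 ?mulr0.
have LHS := logderM dD Lx Ly.
apply: (logder_trunc_unique hE _ _ _ LHS LR).
- by rewrite rmorphM !hE1 ?mulr1 ?(hz _ 0); by [|exists M.+1].
- by rewrite rmorph_prod big1 // => k _; apply: hE1; first by exists M.+1.
- have hsz c : h (1 *+ p ^ 0 * \sum_(N < M.+1) cst (ghost p w N) *
      (cst c * t ^+ (p ^ 0)) ^+ (p ^ N)) = 0.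
    rewrite rmorphM rmorph_sum big1 ?mulr0 // => i _.
    by rewrite rmorphM rmorphXn (hz _ 0) expr0n -[_ == _]negbK -lt0n expn_gt0 prime_gt0 // mulr0.
  by rewrite rmorphD !hsz addr0.
pose G k m := cst (ghost p w (k + m) * S k ^+ (p ^ m) *+ p ^ k) * t ^+ (p ^ (k + m)).
transitivity (\sum_(k < M.+1) \sum_(m < M.+1) G k m); last first.
  apply: eq_bigr => k _; rewrite mulr_natl -sumrMnl; apply: eq_bigr => m _.
  rewrite /G exprMn -exprM expnD rmorphMn rmorphM rmorphXn mulrA mulrnAl.
  by rewrite ghost_iter_frob.
rewrite (@sum_triangle _ G) => [|k m km]; last by rewrite /G (expp_nil (tX_nil M R)) ?mulr0.
rewrite expn0 !mul1r -big_split; apply: eq_bigr => N _ /=.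
transitivity (cst (ghost p w N * ghost p S N) * t ^+ (p ^ N)).
  rewrite ghostD !ghost_teich mulrDr rmorphD !rmorphM !rmorphXn mulrDl !exprMn.
  by rewrite expr1 !mulrA.
rewrite mulr_sumr rmorph_sum mulr_suml; apply: eq_bigr => i _.
rewrite /G subnKC; last by rewrite -ltnS.
by congr (cst _ * _); apply: mulrnAr.
Qed.

End Universal.

Lemma trunc_universal M (C : comNzRingType) (lC : islocal C) (x : C)
  (v : nat -> nat -> C) : x ^+ M.+1 = 0 ->
  exists f : {rmorphism trunc M (lpoly p) -> C}, f (tX M (lpoly p)) = x /\
    forall i, wmap f (wmap (tC M (lpoly p)) (Witt p_pr (lvar p i))) = Witt p_pr (v i).
Proof.
move=> x0; have [g gE] := lpoly_eval v lC.
have [f [fX fC]] := trunc_lift g x0.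
exists f; split=> // i; apply: wittP => j /=.
by rewrite fC gE.
Qed.


End WittExponential.

Section WittIdentities.
Variables (p : nat) (p_pr : prime p).
Local Notation W := (witt p_pr).

Section WmapRules.
Variables (C C' : comNzRingType) (g : {rmorphism C -> C'}).
Implicit Types x y : W C.
Lemma wmapD x y : wmap g (x + y) = wmap g x + wmap g y. Proof. exact: rmorphD. Qed.
Lemma wmapB x y : wmap g (x - y) = wmap g x - wmap g y. Proof. exact: rmorphB. Qed.
Lemma wmapM x y : wmap g (x * y) = wmap g x * wmap g y. Proof. exact: rmorphM. Qed.
Lemma wmap0 : wmap g (0 : W C) = 0. Proof. exact: rmorph0. Qed.
End WmapRules.

Lemma witt_comp0 (C : comNzRingType) (x y : W C) : (x + y) 0%N = x 0%N + y 0%N.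
Proof. by have := ghostD x y 0; rewrite /ghost !big_ord1 /= !mulr1n !expr1. Qed.

Lemma upoly_universal (C : comNzRingType) (x y z : W C) :
  exists h : {rmorphism upoly -> C}, [/\ wmap h (wvar p_pr 0) = x,
    wmap h (wvar p_pr 1) = y & wmap h (wvar p_pr 2) = z].
Proof. by exists (ueval (wvars x y z)); exact: wmap_wvars. Qed.

Lemma wfrobM (C : comNzRingType) (x y : W C) : wfrob (x * y) = wfrob x * wfrob y.
Proof.
have U : wfrob (wvar p_pr 0 * wvar p_pr 1) = wfrob (wvar p_pr 0) * wfrob (wvar p_pr 1).
  by apply: (ghost_inj upoly_tf) => m; rewrite ghost_frob !ghostM !ghost_frob.
have [h [<- <- _]] := upoly_universal x y y.
by rewrite -[X in wfrob X]rmorphM -!wmap_frob U rmorphM.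
Qed.

Lemma wfrob_teich (C : comNzRingType) (c : C) :
  wfrob (teich p_pr c) = teich p_pr (c ^+ p).
Proof.
have U : wfrob (teich p_pr (uvar 0 0)) = teich p_pr (uvar 0 0 ^+ p).
  apply: (ghost_inj upoly_tf) => m.
  by rewrite ghost_frob !ghost_teich -exprM -expnS.
have [h [e _ _]] := upoly_universal (teich p_pr c) 0 0.
have <- : h (uvar 0 0) = c by have := congr1 (fun u : W C => u 0%N) e.
by rewrite -rmorphXn -!wmap_teich -wmap_frob U.
Qed.

Lemma teichM_comp (C : comNzRingType) (c : C) (w : W C) k :
  (teich p_pr c * w) k = c ^+ (p ^ k) * w k.
Proof.
have U : teich p_pr (uvar 0 0) * wvar p_pr 1
    = Witt p_pr (fun k => uvar 0 0 ^+ (p ^ k) * uvar 1 k).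
  apply: (ghost_inj upoly_tf) => m; rewrite ghostM ghost_teich.
  rewrite /ghost mulr_sumr; apply: eq_bigr => i _ /=.
  rewrite exprMn -exprM -expnD subnKC; last by rewrite -ltnS.
  by rewrite mulrnAr.
have [h [e <- _]] := upoly_universal (teich p_pr c) w 0.
have <- : h (uvar 0 0) = c by have := congr1 (fun u : W C => u 0%N) e.
rewrite -wmap_teich -rmorphM U /= rmorphM rmorphXn //.
Qed.

(** Carries the identities just proved for t over a torsion-free ring to arbitrary nilpotent points:
    Witt vectors and point are specialized together. *)
Lemma local_cover M (C : comNzRingType) (x : C) (v : nat -> nat -> C) :
  islocal p C -> x ^+ M.+1 = 0 ->
  exists (R : comNzRingType) (var : nat -> nat -> R) (f : {rmorphism trunc M R -> C}),
  [/\ islocal p R, torsion_free R, f (tX M R) = x &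
      forall i, wmap f (wmap (tC M R) (Witt p_pr (var i))) = Witt p_pr (v i)].
Proof.
move=> lC e; have [f [fX fv]] := trunc_universal p_pr lC v e.
exists (lpoly p), (lvar p), f; split=> //; first exact: lpoly_islocal.
exact: lpoly_tf.
Qed.

Section Identities.
Variables (C : comNzRingType) (lC : islocal p C).
Implicit Types (w z : W C) (x y t : C).

Lemma E_add w w' x : nil x -> E (w + w') x = E w x * E w' x.
Proof.
case=> M e; have e' : x ^+ M.+1 = 0 by rewrite exprS e mulr0.
have [R [var [f [lR tR <- fv]]]] :=
  local_cover (fun i => if i is 0%N then w else w') lC e'.
have lT := islocal_rmorphism (tC M R) lR; have nt := tX_isnil M R.
have [<- <-] : Witt p_pr w = w /\ Witt p_pr w' = w' by split; apply: wittP.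
rewrite -[Witt p_pr w](fv 0%N) -[Witt p_pr w'](fv 1%N).
rewrite -!rmorphD -!E_rmorph // -rmorphM; congr (f _).
exact: (E_add_univ M lR tR).
Qed.

Lemma E0 x : nil x -> E (0 : W C) x = 1.
Proof.
move=> nx; rewrite /E big1 // => k _ /=.
by rewrite mul0r AH0.
Qed.

Lemma E_wT a w x M : x ^+ M = 0 ->
  E (wT a w) x = \prod_(k < M) E w (a k * x ^+ (p ^ k)).
Proof.
case: M => [/eqP|M e]; first by rewrite expr0 oner_eq0.
have [R [var [f [lR tR <- fv]]]] :=
  local_cover (fun i => if i is 0%N then a else w) lC e.
have lT := islocal_rmorphism (tC M R) lR; have nt := tX_isnil M R.
have [<- <-] : Witt p_pr w = w /\ Witt p_pr a = a by split; apply: wittP.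
rewrite -[Witt p_pr a](fv 0%N) -[Witt p_pr w](fv 1%N).
rewrite -wmap_T -wmap_T -E_rmorph // (E_T_univ M lR tR) rmorph_prod.
apply: eq_bigr => k _; rewrite E_rmorph // ?rmorphM ?rmorphXn //.
by apply: nil_mull; apply: nil_exp => //; rewrite expn_gt0 prime_gt0.
Qed.

Lemma E_teichD w x y t M (S := teich p_pr x + teich p_pr y) : t ^+ M = 0 ->
  E w (x * t) * E w (y * t) =
  \prod_(k < M) E (iter k (@wfrob p p_pr C) w) (S k * t ^+ (p ^ k)).
Proof.
case: M => [/eqP|M e]; first by rewrite expr0 oner_eq0.
pose v i : nat -> C := if i is 0%N then w else fun j => if j is 0%N then x else y.
have [R [var [f [lR tR <- fv]]]] := local_cover v lC e.
have lT := islocal_rmorphism (tC M R) lR; have nt := tX_isnil M R.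
have <- : Witt p_pr w = w by apply: wittP.
rewrite -[Witt p_pr w](fv 0%N).
have fE j : f (tC M R (var 1%N j)) = if j is 0%N then x else y.
  exact: (congr1 (fun u : W C => u j) (fv 1%N)).
have := congr1 f (@E_teichD_univ p p_pr M _ lR tR
  (Witt p_pr (var 0%N)) (var 1%N 0%N) (var 1%N 1%N)).
rewrite rmorphM !E_rmorph //; try exact: nil_mull.
rewrite !rmorphM !fE => ->.
rewrite rmorph_prod; apply: eq_bigr => k _.
rewrite E_rmorph //; last first.
  by apply: nil_mull; apply: nil_exp => //; rewrite expn_gt0 prime_gt0.
rewrite !wmap_iter_frob rmorphM rmorphXn; congr (E _ (_ * _)).
set s := teich _ _ + _.
rewrite -[f _]/((wmap f (wmap (tC M R) s)) k) /s !wmapD !wmap_teich.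
by rewrite !fE.
Qed.

Lemma E_teichM (c : C) w x : nil x -> E (teich p_pr c * w) x = E w (c * x).
Proof.
case=> m e; rewrite !(@EE _ p_pr _ lC _ _ m) //; last by rewrite exprMn e mulr0.
by apply: eq_bigr => k _; rewrite teichM_comp exprMn; congr AH; ring.
Qed.
End Identities.

Lemma ah1 (C : comNzRingType) : islocal p C -> ah p_pr C 1 = 1.
Proof.
move=> lC; have [a0 aS] := ahP p_pr lC; have := aS 1%N.
by rewrite mulr1n => ->; rewrite big_mkcond big_ord1 /= subnn.
Qed.

Lemma AH_sqr0 (C : comNzRingType) (y : C) : islocal p C -> y * y = 0 -> AH p_pr y = 1 + y.
Proof.
move=> lC y2; rewrite /AH (@evE _ _ _ 2) // !big_ord_recl big_ord0 /=.
by rewrite (ahP p_pr lC).1 ah1 // expr0 expr1 !mul1r addr0.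
Qed.

Lemma E_eq1 (R : comNzRingType) (w : W R) : islocal p R ->
  (forall M, E (wmap (tC M R) w) (tX M R) = 1) -> w = 0.
Proof.
move=> lR e; apply: wittP => k; rewrite [RHS]/(0 : R).
elim/ltn_ind: k => k IH.
(* Modulo t^(p^k + 1) the factors before k are 1 by induction and those after k by degree, so E is 1
   + w_k t^(p^k). *)
pose M := (p ^ k)%N; pose t := tX M R.
have lT := islocal_rmorphism (tC M R) lR.
have t0 : t ^+ M.+1 = 0 by apply: tX_nil.
have M0 : (0 < M)%N by rewrite expn_gt0 prime_gt0.
have kM : (k < M.+1)%N by rewrite ltnS ltnW // ltn_expl // prime_gt1.
have := e M; rewrite (EE lT _ t0) (bigD1 (Ordinal kM)) //= big1 => [|j jk].
  rewrite mulr1 AH_sqr0 //; last first.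
    by rewrite mulrACA -exprD (exp_nil_leq t0) ?mulr0 // -/M; lia.
  move/(canRL (addKr _)); rewrite addNr => /(congr1 (fun u : trunc M R => (u : {poly R})`_M)).
  by rewrite coef_tCX // eqxx coef0.
have {}jk : j != k :> nat by [].
case: (ltngtP j k) jk => // [jk _|kj _]; first by rewrite IH // rmorph0 mul0r AH0.
rewrite (exp_nil_leq t0) ?mulr0 ?AH0 //.
by rewrite /M ltn_exp2l // prime_gt1.
Qed.

End WittIdentities.

(** * Witt vectors in the kernel of F^(lam) give homomorphisms *)

Section Kappa.
Variables (p : nat) (p_pr : prime p).
Local Notation W := (witt p_pr).
Local Notation islocal := (islocal p).

(* The coefficients of ((AH (lam X)) - 1) / lam. *)
Definition kcoef (C : comNzRingType) (lam : C) (i : nat) : C :=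
  if i is j.+1 then ah p_pr C i * lam ^+ j else 0.

Definition kap (C : comNzRingType) (lam x : C) : C := ev (kcoef lam) x.

Section OneRing.
Variables (C : comNzRingType) (lC : islocal C) (lam : C).
Implicit Types (x y a b : C).

Lemma AH_kap x : nil x -> AH p_pr (lam * x) = 1 + lam * kap lam x.
Proof.
case=> m e; have e1 : x ^+ m.+1 = 0 by rewrite exprS e mulr0.
rewrite /AH (@evE _ _ _ m.+1); last by rewrite exprMn e1 mulr0.
rewrite /kap (evE _ e1) !big_ord_recl [kcoef _ ord0]/= (ahP p_pr lC).1 !expr0.
rewrite mul0r add0r mulr1.
congr (_ + _); rewrite mulr_sumr; apply: eq_bigr => i _.
by rewrite lift0 /= [lam * x]mulrC exprMn [lam ^+ i.+1]exprS; ring.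
Qed.

(** The linear coefficient of [kap] is 1, and in higher degrees a - b splits off with a further
    factor x. This yields injectivity and, by approximation, surjectivity on nilpotent elements. *)
Lemma kap_diff a b x : (exists m, x ^+ m = 0) -> (exists c, a = x * c) ->
  (exists c, b = x * c) ->
  exists g, kap lam a - kap lam b = (a - b) * (1 + x * g).
Proof.
move=> [m e] [c ac] [d bd].
have am : a ^+ m.+2 = 0 by rewrite ac exprMn !exprS e !mulr0 mul0r.
have bm : b ^+ m.+2 = 0 by rewrite bd exprMn !exprS e !mulr0 mul0r.
rewrite /kap (evE _ am) (evE _ bm) !big_ord_recl [kcoef _ ord0]/= !mul0r !add0r.
rewrite [kcoef _ (lift _ _)]/= expr0 mulr1 ah1 // !mul1r !expr1.
have step (i : 'I_m) : exists g, kcoef lam i.+2 * a ^+ i.+2 - kcoef lam i.+2 * b ^+ i.+2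
    = (a - b) * (x * g).
  rewrite -mulrBr subrXX.
  exists (kcoef lam i.+2 * \sum_(j < i.+2) (if (j < i.+1)%N then c * a ^+ (i - j) * b ^+ j else d * b ^+ i)).
  rewrite mulrCA; congr (_ * _); rewrite mulrCA; congr (_ * _).
  rewrite mulr_sumr; apply: eq_bigr => j _; case: ltnP => ji.
    by rewrite /= subSn // exprS {1}ac; ring.
  have -> : nat_of_ord j = i.+1 by apply/eqP; rewrite eqn_leq ji -ltnS ltn_ord.
  by rewrite /= subnn expr0 exprS {1}bd; ring.
have [g gE] : exists g : 'I_m -> C, forall i : 'I_m, kcoef lam i.+2 * a ^+ i.+2 -
    kcoef lam i.+2 * b ^+ i.+2 = (a - b) * (x * g i).
  by exists (fun i => projT1 (cid (step i))) => i; case: cid.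
exists (\sum_i g i); rewrite opprD addrACA mulrDr mulr1; congr (_ + _).
rewrite -sumrB mulr_sumr mulr_sumr; apply: eq_bigr => i _.
by rewrite !lift0 /= -gE.
Qed.

Lemma kap_mul x : nil x -> exists g, kap lam x = x * (1 + x * g).
Proof.
move=> nx; have [||g] := @kap_diff x 0 x nx.
- by exists 1; rewrite mulr1.
- by exists 0; rewrite mulr0.
by rewrite /kap ev0 subr0 subr0 => ->; exists g.
Qed.

Lemma nil_kap x : nil x -> nil (kap lam x).
Proof. by move=> nx; have [g ->] := kap_mul nx; apply: nil_mulr. Qed.

Lemma nil_sub_eq0 (a v : C) : nil v -> a * (1 + v) = 0 -> a = 0.
Proof.
move=> nv e; have [u uE] := nil_unit nv.
by rewrite -[a]mulr1 -uE mulrA e mul0r.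
Qed.

Lemma kap_inj x a b : nil x -> (exists c, a = x * c) -> (exists c, b = x * c) ->
  kap lam a = kap lam b -> a = b.
Proof.
move=> nx ha hb e; have [g] := kap_diff nx ha hb.
rewrite e subrr => /esym /nil_sub_eq0 H; apply/eqP; rewrite -subr_eq0.
by apply/eqP/H/nil_mulr.
Qed.

Lemma kap_surj x : nil x -> exists c, kap lam (x * c) = x.
Proof.
move=> nx; case: (nx) => m e.
suff [c [d cd]] : exists c d, kap lam (x * c) - x = x ^+ m * d.
  by exists c; apply/eqP; rewrite -subr_eq0 cd e mul0r.
elim: m {e} => [|m [c [d cd]]].
  by exists 0, (- x); rewrite mulr0 /kap ev0 sub0r expr0 mul1r.
case: m cd => [|m] cd.
  have [g gE] := kap_mul nx; exists 1, (x * g).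
  by rewrite mulr1 gE expr1; ring.
(* Moving the argument by -x^(m+1) d moves the value by that amount times 1 + x g, so the error
   x^(m+1) d becomes -x^(m+2) d g. *)
have [||g gE] := @kap_diff (x * (c - x ^+ m * d)) (x * c) x nx; try by eexists.
exists (c - x ^+ m * d), (- d * g).
rewrite -[kap lam _](subrK (kap lam (x * c))) gE -addrA cd [x ^+ m.+2]exprS.
by rewrite [x ^+ m.+1]exprS; ring.
Qed.

(** Choosing the preimage among the multiples of x keeps it nilpotent and provides the common
    divisor that [kap_inj] asks for. *)
Definition kinv x : C :=
  if pselect (nil x) is left h then x * projT1 (cid (kap_surj h)) else 0.

Lemma kinvK x : nil x -> kap lam (kinv x) = x.
Proof. by move=> nx; rewrite /kinv; case: pselect => // h; case: cid. Qed.

Lemma kinv_mul x : exists c, kinv x = x * c.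
Proof.
by rewrite /kinv; case: pselect => h; [eexists|exists 0; rewrite mulr0].
Qed.

Lemma nil_kinv x : nil x -> nil (kinv x).
Proof. by move=> nx; have [c ->] := kinv_mul x; apply: nil_mulr. Qed.

Lemma kapK x : nil x -> kinv (kap lam x) = x.
Proof.
move=> nx; apply: (kap_inj nx).
- have [c ->] := kinv_mul (kap lam x); have [g ->] := kap_mul nx.
  by eexists; rewrite -mulrA.
- by exists 1; rewrite mulr1.
by rewrite kinvK //; apply: nil_kap.
Qed.
End OneRing.

Lemma kap_rmorph (C C' : comNzRingType) (lC : islocal C) (g : {rmorphism C -> C'})
  (lam x : C) : nil x -> g (kap lam x) = kap (g lam) (g x).
Proof.
move=> nx; rewrite /kap ev_rmorph //; congr ev; apply/funext => -[|i] /=.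
  by rewrite rmorph0.
by rewrite rmorphM rmorphXn ah_rmorph.
Qed.

Lemma kinv_rmorph (C C' : comNzRingType) (lC : islocal C) (lC' : islocal C')
  (g : {rmorphism C -> C'}) (lam x : C) : nil x ->
  g (kinv lC lam x) = kinv lC' (g lam) (g x).
Proof.
move=> nx; have nk := nil_kinv lC lam nx.
by rewrite -[g x](congr1 g (kinvK lC lam nx)) kap_rmorph // kapK //; apply: nil_rmorph.
Qed.

End Kappa.

(** * Multiplicativity of chi: merging a product of values of E into one value *)

Section Merge.
Variables (p : nat) (p_pr : prime p).
Local Notation W := (witt p_pr).
Local Notation islocal := (islocal p).
Local Notation Flam := (@Flam p p_pr _).

Lemma Flam_eq0 (C : comNzRingType) (lam : C) (z : W C) :
  Flam lam z = 0 -> wfrob z = teich p_pr (lam ^+ p.-1) * z.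
Proof. by move/eqP; rewrite subr_eq0 => /eqP. Qed.

Lemma Flam_teich (C : comNzRingType) (lam : C) : Flam lam (teich p_pr lam) = 0.
Proof.
apply/eqP; rewrite subr_eq0 wfrob_teich; apply/eqP/wittP => -[|k]; rewrite teichM_comp.
  by rewrite expn0 expr1 -exprSr prednK // prime_gt0.
by rewrite /= mulr0.
Qed.

Lemma Flam_rmorph (C C' : comNzRingType) (g : {rmorphism C -> C'}) lam (z : W C) :
  wmap g (Flam lam z) = Flam (g lam) (wmap g z).
Proof. by rewrite /Flam wmapB wmapM wmap_frob wmap_teich rmorphXn. Qed.

Lemma iter_frob_Flam (C : comNzRingType) (lam : C) (z : W C) k :
  Flam lam z = 0 ->
  iter k (@wfrob p p_pr C) z = teich p_pr (lam ^+ (p ^ k).-1) * z.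
Proof.
move=> Fz; elim: k => [|k IH]; first by rewrite expn0 /= expr0 [teich _ 1]/(1 : W C) mul1r.
rewrite iterS IH wfrobM (Flam_eq0 Fz) wfrob_teich mulrA; congr (_ * _).
apply: wittP => -[|j]; rewrite teichM_comp /= ?mulr0 // expn0 expr1 -exprM -exprD.
congr (_ ^+ _); have := prime_gt0 p_pr; have : (0 < p ^ k)%N by rewrite expn_gt0 prime_gt0.
by rewrite expnS; set a := (p ^ k)%N; nia.
Qed.

Lemma E_teichD_Flam (C : comNzRingType) (lC : islocal C) (lam : C) (z : W C) x y t M
  (S := teich p_pr x + teich p_pr y) : Flam lam z = 0 -> t ^+ M = 0 ->
  E z (x * t) * E z (y * t) =
  \prod_(k < M) E z (lam ^+ (p ^ k).-1 * (S k * t ^+ (p ^ k))).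
Proof.
move=> Fz tM; rewrite (E_teichD lC z x y tM); apply: eq_bigr => k _.
rewrite (iter_frob_Flam k Fz) E_teichM //; apply/nil_mull/nil_exp; first by exists M.
by rewrite expn_gt0 prime_gt0.
Qed.

(** As a polynomial in the second entry, this component vanishes at 0, where the sum is [u]; so the
    entry divides it. *)
Lemma teichD_dvd (C : comNzRingType) (u c r : C) k : (0 < k)%N ->
  exists g, (teich p_pr u + teich p_pr (c * r)) k = c * g.
Proof.
move=> k0.
pose f := (teich p_pr u%:P + teich p_pr 'X : W {poly C}) k.
have fE x : f.[x] = (teich p_pr u + teich p_pr x) k.
  rewrite -[f.[x]]/(horner_eval x f) /f.
  rewrite -[horner_eval x _]/(wmap (horner_eval x) (teich p_pr u%:P + teich p_pr 'X) k).
  by rewrite wmapD !wmap_teich /= /horner_eval hornerC hornerX.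
have f0 : f.[0] = 0.
  rewrite fE; have -> : teich p_pr (0 : C) = 0 by apply: wittP => -[].
  by rewrite addr0; case: (k) k0.
have fX : f = drop_poly 1 f * 'X.
  rewrite -{1}[f](poly_take_drop 1) expr1; set h := take_poly 1 f.
  suff -> : h = 0 by rewrite add0r.
  apply/polyP => -[|i]; rewrite coef_take_poly coef0 //.
  by rewrite -horner_coef0 f0.
by exists ((drop_poly 1 f).[c * r] * r); rewrite -fE {1}fX hornerMX; ring.
Qed.

Section Process.
Variables (C0 : comNzRingType) (lam t : C0) (N : nat) (tN : t ^+ N = 0).

(** The lists must not depend on z or on C: the merged point is identified afterwards from the
    single case z = [lam]. *)
Definition Eeq (s s' : seq C0) : Prop :=
  forall (C : comNzRingType) (f : {rmorphism C0 -> C}) (z : W C), islocal C ->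
  Flam (f lam) z = 0 ->
  \prod_(x <- s) E z (f x) = \prod_(x <- s') E z (f x).

Lemma Eeq_trans s1 s2 s3 : Eeq s1 s2 -> Eeq s2 s3 -> Eeq s1 s3.
Proof. by move=> h h' C f z lC Fz; rewrite h // h'. Qed.

Lemma Eeq_cat s1 s2 s : Eeq s1 s2 -> Eeq (s1 ++ s) (s2 ++ s).
Proof. by move=> h C f z lC Fz; rewrite !big_cat /= h. Qed.

(* With S = [u] + [r t^j] one has E z (u t) E z (r t^(j+1)) =
   prod_k E z (lam^(p^k - 1) S_k t^(p^k)); as t^j divides S_k for k > 0, all
   factors but the first lie deeper, and iterating leaves a single factor. *)
Lemma merge_step u r j : exists rs,
  Eeq [:: u * t; r * t ^+ j.+1] ((u + r * t ^+ j) * t :: [seq x * t ^+ j.+2 | x <- rs]).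
Proof.
case: N tN => [/eqP|n tn]; first by rewrite expr0 oner_eq0.
have H (k : nat) : exists g, (teich p_pr u + teich p_pr (t ^+ j * r)) k.+1 = t ^+ j * g.
  exact: teichD_dvd.
have [g gE] : exists g : nat -> C0, forall k,
    (teich p_pr u + teich p_pr (t ^+ j * r)) k.+1 = t ^+ j * g k.
  by exists (fun k => projT1 (cid (H k))) => k; case: cid.
exists [seq lam ^+ (p ^ k.+1).-1 * g k * t ^+ (p ^ k.+1 - 2) | k <- iota 0 n].
move=> C f z lC Fz; rewrite !big_cons big_nil mulr1 !big_map.
have -> : f (r * t ^+ j.+1) = f (t ^+ j * r) * f t.
  by rewrite -rmorphM exprS; congr (f _); ring.
have ftN : f t ^+ n.+1 = 0 by rewrite -rmorphXn tn rmorph0.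
rewrite [f (u * t)]rmorphM (E_teichD_Flam lC (f u) (f (t ^+ j * r)) Fz ftN).
have -> : teich p_pr (f u) + teich p_pr (f (t ^+ j * r))
  = wmap f (teich p_pr u + teich p_pr (t ^+ j * r)) by rewrite wmapD !wmap_teich.
rewrite big_ord_recl; congr (_ * _).
  rewrite [nat_of_ord _]/= expn0 expr0 mul1r expr1 /= witt_comp0 /= -rmorphM.
  by congr (E z (f (_ * _))); rewrite mulrC.
have -> : iota 0 n = index_iota 0 n by rewrite /index_iota subn0.
rewrite big_mkord; apply: eq_bigr => k _; rewrite lift0.
rewrite -[wmap f _ _]/(f ((teich p_pr u + teich p_pr (t ^+ j * r)) k.+1)) gE.
rewrite -!rmorphXn -!rmorphM; congr (E z (f _)).
have pk : (2 <= p ^ k.+1)%N.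
  by rewrite (leq_trans (prime_gt1 p_pr)) // -{1}[p]expn1 leq_exp2l // prime_gt1.
rewrite -[RHS]mulrA -exprD (_ : _ + _ = j + p ^ k.+1)%N; last by lia.
by rewrite exprD; ring.
Qed.

Lemma merge_list j rs u : exists u' rs',
  Eeq (u * t :: [seq x * t ^+ j.+1 | x <- rs])
      (u' * t :: [seq x * t ^+ j.+2 | x <- rs']).
Proof.
elim: rs u => [|r rs IH] u; first by exists u, [::] => C f z.
have [rs1 h1] := merge_step u r j.
have [u' [rs2 h2]] := IH (u + r * t ^+ j).
exists u', (rs2 ++ rs1); rewrite map_cat -cat_cons.
apply: Eeq_trans (Eeq_cat _ h2); rewrite cat_cons.
apply: (Eeq_trans (s2 := [:: u * t; r * t ^+ j.+1] ++ [seq x * t ^+ j.+1 | x <- rs])) => //.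
apply: (Eeq_trans (Eeq_cat _ h1)) => C f z lC Fz.
by rewrite !cat_cons !big_cons !big_cat /= [X in _ * X]mulrC.
Qed.

Lemma merge_all u rs : exists u', Eeq (u * t :: [seq x * t | x <- rs]) [:: u' * t].
Proof.
suff H d j : (N <= j.+1 + d)%N -> forall u rs,
    exists u', Eeq (u * t :: [seq x * t ^+ j.+1 | x <- rs]) [:: u' * t].
  have [u' h] := H N 0%N (leq_addl _ _) u rs; exists u'.
  suff -> : [seq x * t | x <- rs] = [seq x * t ^+ 1 | x <- rs] by [].
  by apply: eq_map => x; rewrite expr1.
elim: d j => [|d IH] j Nj {}u {}rs; last first.
  have [u1 [rs1 h1]] := merge_list j rs u.
  have [|u2 h2] := IH j.+1 _ u1 rs1; first by rewrite addSnnS.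
  by exists u2; apply: Eeq_trans h2.
exists u => C f z lC Fz; rewrite !big_cons big_nil big_map big1 // => r _.
by rewrite (exp_nil_leq tN) ?mulr0 ?rmorph0 ?E_nil0 // -[j.+1]addn0.
Qed.
End Process.

Section Universal.
Variables (R : comNzRingType) (lR : islocal R) (lam x y : R) (M : nat).
Hypothesis lam_reg : forall a, lam * a = 0 -> a = 0.
Local Notation T := (trunc M R).
Local Notation t := (tX M R).
Local Notation cst := (tC M R).

Lemma trunc_reg (a : T) : cst lam * a = 0 -> a = 0.
Proof.
move=> e; apply: trunc_eq => i iM; rewrite coef0; apply: lam_reg.
have := congr1 (fun u : T => (u : {poly R})`_i) e; rewrite coef0 => e0.
rewrite -[RHS]e0 coef_truncM // big_ord_recl big1 => [|j _]; last by rewrite coef_tC mul0r.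
by rewrite addr0 subn0 coef_tC.
Qed.

(** For z = [lam] the merged identity reads (1 + lam kap(x t)) (1 + lam kap(y t)) = 1 + lam kap(u
    t), and regularity of lam identifies kap(u t) with the group law. The same u then works for
    every z. *)
Lemma merge_univ : exists u : T,
  kap p_pr (cst lam) (u * t) = glaw (cst lam) (kap p_pr (cst lam) (cst x * t))
     (kap p_pr (cst lam) (cst y * t)) /\
  forall (C : comNzRingType) (f : {rmorphism T -> C}) (z : W C),
    Flam (f (cst lam)) z = 0 ->
    E z (f (cst x * t)) * E z (f (cst y * t)) = E z (f (u * t)).
Proof.
have lT := islocal_rmorphism cst lR.
have [u h] := merge_all (cst lam) (tX_nil M R) (cst x) [:: cst y].
exists u; split; last first.
  move=> C f z Fz; have := h C f z (islocal_rmorphism f lT) Fz.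
  by rewrite /= !big_cons big_nil !mulr1.
have nt := tX_isnil M R.
have := h T idfun (teich p_pr (cst lam)) lT (Flam_teich _).
rewrite /= !big_cons big_nil !mulr1 !E_teich ?AH_kap //; try exact: nil_mull.
move=> e; apply/eqP; rewrite -subr_eq0; apply/eqP/trunc_reg.
move/eqP: e; rewrite -subr_eq0 => /eqP e; rewrite -[RHS]oppr0 -e /glaw; ring.
Qed.
End Universal.

Definition chi (C : comNzRingType) (lC : islocal C) (lam : C) (z : W C) (x : C) : C :=
  E z (kinv p_pr lC lam x).

Lemma poly_cover (C : comNzRingType) (lam x y : C) : islocal C ->
  exists (R : comNzRingType) (l a b : R) (f : {rmorphism R -> C}),
  [/\ islocal R, (forall c, l * c = 0 -> c = 0), f l = lam, f a = x & f b = y].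
Proof.
move=> lC; have [g gE] := lpoly_eval (fun i _ => if i is 0%N then x else y) lC.
exists {poly (lpoly p)}, 'X, (lvar p 0 0)%:P, (lvar p 1 0)%:P.
have cg : commr_rmorph g lam by move=> u; apply: mulrC.
exists (horner_morph cg); split.
- exact: islocal_rmorphism (@polyC _) (lpoly_islocal p).
- move=> c /polyP e; apply/polyP => i; have := e i.+1.
  by rewrite coefXM /= !coef0.
- exact: horner_morphX.
- by rewrite -[RHS](gE 0%N 0%N); apply: horner_morphC.
- by rewrite -[RHS](gE 1%N 0%N); apply: horner_morphC.
Qed.

(** Two multiples of one nilpotent element lift to multiples of t over a truncated ring in which lam
    is an indeterminate, hence regular; z itself is not lifted. *)
Lemma chi_hom_principal (C : comNzRingType) (lC : islocal C) (lam : C) (z : W C) t x y :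
  Flam lam z = 0 -> nil t ->
  chi lC lam z (glaw lam (x * t) (y * t)) = chi lC lam z (x * t) * chi lC lam z (y * t).
Proof.
move=> Fz [M e]; have e' : t ^+ M.+1 = 0 by rewrite exprS e mulr0.
have nt : nil t by exists M.
have [x' xE] := kinv_mul p_pr lC lam (x * t).
have [y' yE] := kinv_mul p_pr lC lam (y * t).
have nx : nil (x * t) by apply: nil_mull.
have ny : nil (y * t) by apply: nil_mull.
have [R [l [a [b [g [lR lreg gl ga gb]]]]]] := poly_cover lam (x * x') (y * y') lC.
have [u [uk uE]] := merge_univ lR a b M lreg.
have [f [fX fC]] := trunc_lift g e'.
have lT := islocal_rmorphism (tC M R) lR.
have ntX := tX_isnil M R.
have fa : f (tC M R a * tX M R) = kinv p_pr lC lam (x * t).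
  by rewrite rmorphM fX fC ga xE mulrAC.
have fb : f (tC M R b * tX M R) = kinv p_pr lC lam (y * t).
  by rewrite rmorphM fX fC gb yE mulrAC.
have fl : f (tC M R l) = lam by rewrite fC.
rewrite /chi -fa -fb uE ?fl //; congr E.
have nu : nil (u * tX M R) by apply: nil_mull.
have kE : f (kap p_pr (tC M R l) (u * tX M R)) = kap p_pr lam (f (u * tX M R)).
  by rewrite kap_rmorph // fl.
rewrite -[RHS](kapK p_pr lC lam (nil_rmorph f nu)) -kE uk.
rewrite /glaw !rmorphD !rmorphM !kap_rmorph //; try exact: nil_mull.
by rewrite fa fb fl !kinvK.
Qed.

Lemma chi_rmorph (C C' : comNzRingType) (lC : islocal C) (lC' : islocal C')
  (g : {rmorphism C -> C'}) lam (z : W C) x : nil x ->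
  g (chi lC lam z x) = chi lC' (g lam) (wmap g z) (g x).
Proof.
move=> nx; rewrite /chi E_rmorph //; last exact: nil_kinv.
by rewrite (kinv_rmorph p_pr lC lC').
Qed.

(* [x] and [y] need not be multiples of one nilpotent element: work with x X
   and y X over {poly C}, and specialize X to 1 at the end. *)
Lemma chi_hom (C : comNzRingType) (lC : islocal C) (lam : C) (z : W C) x y :
  Flam lam z = 0 -> nil x -> nil y ->
  chi lC lam z (glaw lam x y) = chi lC lam z x * chi lC lam z y.
Proof.
move=> Fz nx ny; pose P := {poly C}.
have lP : islocal P := islocal_rmorphism (@polyC _) lC.
pose zP := wmap (@polyC C) z.
have nX (c : C) : nil c -> nil (c%:P * 'X).
  by move=> nc; apply: nil_mulr; apply: (nil_rmorph (@polyC _)).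
have FzP : Flam lam%:P zP = 0.
  by rewrite -(Flam_rmorph (@polyC C)) Fz wmap0.
have nS (D : comNzRingType) (l a b : D) : nil a -> nil b -> nil (glaw l a b).
  by move=> na nb; rewrite /glaw; apply: nilD; [exact: nilD|exact: nil_mull].
have HP : chi lP lam%:P zP (glaw lam%:P (x%:P * 'X) (y%:P * 'X))
    = chi lP lam%:P zP (x%:P * 'X) * chi lP lam%:P zP (y%:P * 'X).
  (* The coefficient of X^M is visible modulo X^(M+1), where both points are multiples of the
     nilpotent class of X. *)
  apply/polyP => M; have lT := islocal_rmorphism (tC M C) lC.
  have [pi [piE piC piX]] : exists pi : {rmorphism {poly C} -> trunc M C},
      [/\ forall u, (pi u : {poly C})`_M = u`_M, forall c, pi c%:P = tC M C c
        & pi 'X = tX M C].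
    exists (in_qpoly 'X^(M.+1)); split=> // [u|c]; first exact: coef_in_trunc.
    by rewrite qpolyC_in ?truncX_size ?truncX_monic.
  have H c : nil c ->
      pi (chi lP lam%:P zP c) = chi lT (tC M C lam) (wmap (tC M C) z) (pi c).
    move=> nc; rewrite (chi_rmorph lP lT pi _ _ nc) piC.
    have -> : wmap pi zP = wmap (tC M C) z by apply: wittP => i /=; rewrite piC.
    by [].
  have nxX := nX _ nx; have nyX := nX _ ny; have nSX := nS _ lam%:P _ _ nxX nyX.
  rewrite -[LHS]piE -[RHS]piE rmorphM (H _ nSX) (H _ nxX) (H _ nyX).
  rewrite /glaw !rmorphD !rmorphM !piC piX.
  rewrite -chi_hom_principal //; first by rewrite -Flam_rmorph Fz wmap0.
  exact: tX_isnil.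
have [he [heC heX]] : exists he : {rmorphism {poly C} -> C},
    (forall c, he c%:P = c) /\ he 'X = 1.
  by exists (horner_eval 1); split=> [c|]; rewrite /= /horner_eval ?hornerC ?hornerX.
have K c : nil c -> he (chi lP lam%:P zP c) = chi lC lam z (he c).
  move=> nc; rewrite (chi_rmorph lP lC he _ _ nc) heC.
  have -> : wmap he zP = z by apply: wittP => i /=; rewrite heC.
  by [].
have nxX := nX _ nx; have nyX := nX _ ny; have nSX := nS _ lam%:P _ _ nxX nyX.
have := congr1 he HP; rewrite rmorphM (K _ nSX) (K _ nxX) (K _ nyX).
by rewrite /glaw !rmorphD !rmorphM !heC heX !mulr1.
Qed.
End Merge.

(** * Homomorphisms come from Witt vectors *)

Section NatFunctions.
Variable K : comNzRingType.

Definition natfun : Type := nat -> K.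
HB.instance Definition _ := gen_eqMixin natfun.
HB.instance Definition _ := gen_choiceMixin natfun.

Fact natfun_addA : associative (fun (f g : natfun) s => f s + g s).
Proof. by move=> f g h; apply/funext => s; rewrite addrA. Qed.
Fact natfun_addC : commutative (fun (f g : natfun) s => f s + g s).
Proof. by move=> f g; apply/funext => s; rewrite addrC. Qed.
Fact natfun_add0 : left_id (fun=> 0) (fun (f g : natfun) s => f s + g s).
Proof. by move=> f; apply/funext => s; rewrite add0r. Qed.
Fact natfun_addN :
  left_inverse (fun=> 0) (fun (f : natfun) s => - f s) (fun (f g : natfun) s => f s + g s).
Proof. by move=> f; apply/funext => s; rewrite addNr. Qed.
HB.instance Definition _ := GRing.isZmodule.Build natfun
  natfun_addA natfun_addC natfun_add0 natfun_addN.

Fact natfun_mulA : associative (fun (f g : natfun) s => f s * g s).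
Proof. by move=> f g h; apply/funext => s; rewrite mulrA. Qed.
Fact natfun_mulC : commutative (fun (f g : natfun) s => f s * g s).
Proof. by move=> f g; apply/funext => s; rewrite mulrC. Qed.
Fact natfun_mul1 : left_id (fun=> 1) (fun (f g : natfun) s => f s * g s).
Proof. by move=> f; apply/funext => s; rewrite mul1r. Qed.
Fact natfun_mulD :
  left_distributive (fun (f g : natfun) s => f s * g s) (fun (f g : natfun) s => f s + g s).
Proof. by move=> f g h; apply/funext => s; rewrite mulrDl. Qed.
Fact natfun_one : (fun=> 1) != 0 :> natfun.
Proof. by apply/eqP => /(congr1 (fun f : natfun => f 0%N)) /eqP; rewrite oner_eq0. Qed.
HB.instance Definition _ := GRing.Zmodule_isComNzRing.Build natfun
  natfun_mulA natfun_mulC natfun_mul1 natfun_mulD natfun_one.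

Definition natfun_at s (f : natfun) : K := f s.
Fact natfun_at_zmod s : zmod_morphism (natfun_at s). Proof. by []. Qed.
Fact natfun_at_monoid s : monoid_morphism (natfun_at s). Proof. by []. Qed.
HB.instance Definition _ s := GRing.isZmodMorphism.Build natfun K (natfun_at s)
  (natfun_at_zmod s).
HB.instance Definition _ s := GRing.isMonoidMorphism.Build natfun K (natfun_at s)
  (natfun_at_monoid s).

Definition natfun_cst (c : K) : natfun := fun=> c.
Fact natfun_cst_zmod : zmod_morphism natfun_cst. Proof. by []. Qed.
Fact natfun_cst_monoid : monoid_morphism natfun_cst. Proof. by []. Qed.
HB.instance Definition _ := GRing.isZmodMorphism.Build K natfun natfun_cst
  natfun_cst_zmod.
HB.instance Definition _ := GRing.isMonoidMorphism.Build K natfun natfun_cst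
  natfun_cst_monoid.
End NatFunctions.

Lemma pair_rmorphism (K A B : comNzRingType) (f : {rmorphism K -> A})
  (g : {rmorphism K -> B}) :
  exists h : {rmorphism K -> (A * B)%type}, forall c, h c = (f c, g c).
Proof.
pose F c : (A * B)%type := (f c, g c).
have Fz : zmod_morphism F.
  by move=> x y; rewrite /F !rmorphB.
have Fm : monoid_morphism F.
  by split=> [|x y]; rewrite /F ?rmorph1 ?rmorphM.
pose az := GRing.isZmodMorphism.Build _ _ F Fz.
pose am := GRing.isMonoidMorphism.Build _ _ F Fm.
pose h : {rmorphism K -> (A * B)%type} := HB.pack F az am.
by exists h.
Qed.

(* The coefficient of x^i y^j in (x + y + lam x y)^m is
   [sig i j m] lam^(i + j - m). *)
Definition sig (i j m : nat) : nat :=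
  (if m <= i + j then 'C(m, j) * 'C(j, i + j - m) else 0)%N.

(* [h] is the sequence of coefficients of a homomorphism from the formal
   completion of G^(lam) to G_m. *)
Definition ishom (C : comNzRingType) (lam : C) (h : nat -> C) : Prop :=
  h 0%N = 1 /\ forall i j,
  h i * h j = \sum_(m < (i + j).+1) lam ^+ (i + j - m) * h m *+ sig i j m.

Lemma bin_trinomial s j m :
  ('C(s, j + m) * 'C(j + m, j) = 'C(s, j) * 'C(s - j, m))%N.
Proof.
have [jms|sjm] := leqP (j + m) s; last first.
  rewrite (bin_small sjm) mul0n; have [js|sj] := leqP j s; last by rewrite (bin_small sj).
  by rewrite [in RHS](@bin_small _ m) ?muln0 //; lia.
have js : (j <= s)%N by lia.
have ms : (m <= s - j)%N by lia.
have e1 := bin_fact jms; have e2 := bin_fact (leq_addr m j).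
have e3 := bin_fact js; have e4 := bin_fact ms.
rewrite addKn in e2; rewrite -subnDA in e4.
have c0 : (0 < j`! * m`! * (s - (j + m))`!)%N by rewrite !muln_gt0 !fact_gt0.
apply/eqP; rewrite -(eqn_pmul2r c0); apply/eqP; nia.
Qed.

(** These are the coefficients of x^i y^j in (1 + x)^s (1 + y)^s = (1 + x + y + x y)^s; the proof is
    Vandermonde for s = (s - j) + j. *)
Lemma bin_mul_bin s i j :
  ('C(s, i) * 'C(s, j) = \sum_(m < (i + j).+1) sig i j m * 'C(s, m))%N.
Proof.
transitivity ('C(s, j) * \sum_(m < i.+1) 'C(s - j, m) * 'C(j, i - m))%N.
  have [js|sj] := leqP j s; last by rewrite (bin_small sj) muln0 mul0n.
  by rewrite binomial.Vandermonde subnK // mulnC.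
have -> : ((i + j).+1 = j + i.+1)%N by lia.
rewrite big_split_ord /= [X in (X + _)%N]big1 ?add0n => [|m _]; last first.
  by rewrite /sig (bin_small (ltn_ord m)) mul0n if_same mul0n.
rewrite big_distrr; apply: eq_bigr => m _ /=.
have mi : (m <= i)%N by rewrite -ltnS.
have e1 : (j + m <= i + j)%N by lia.
have e2 : (i + j - (j + m) = i - m)%N by lia.
by rewrite /sig e1 e2 mulnA -bin_trinomial [RHS]mulnC mulnA.
Qed.

(** The multiple s [lam] belongs to the character (1 + lam x)^s, expanded here by the binomial
    theorem. *)
Lemma E_teichMn (p : nat) (p_pr : prime p) (T : comNzRingType) (lT : islocal p T)
  (lam t : T) s : nil t ->
  E (teich p_pr lam *+ s) t = ev (fun i => lam ^+ i *+ 'C(s, i)) (kap p_pr lam t).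
Proof.
move=> nt; have -> : E (teich p_pr lam *+ s) t = AH p_pr (lam * t) ^+ s.
  elim: s => [|s IH]; first by rewrite mulr0n expr0 E0.
  by rewrite mulrS exprS E_add // IH E_teich.
rewrite AH_kap //; set k := kap _ _ _.
have [m km] : nil k by apply: nil_kap.
have km' : k ^+ (m + s.+1) = 0 by rewrite exprD km mul0r.
rewrite (evE _ km') addnC big_split_ord /= [X in _ = _ + X]big1 ?addr0 => [|i _]; last first.
  by rewrite bin_small ?mulr0n ?mul0r //; lia.
rewrite exprDn; apply: eq_bigr => i _; rewrite expr1n mul1r exprMn.
by rewrite mulrnAl.
Qed.

Section Newton.
Variables (p : nat) (p_pr : prime p).
Local Notation W := (witt p_pr).
Local Notation islocal := (islocal p).
Local Notation K := {poly (zloc p)}.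
Variables (B : comNzRingType) (lB : islocal B) (lam : B) (h : nat -> B).
Hypothesis hh : ishom lam h.

Let F := natfun K.
Let FB : comNzRingType := (F * B)%type.

Definition newton (i : nat) : F := fun s => 'X^i * 'C(s, i)%:R.

Lemma newton_hom : ishom (natfun_cst 'X) newton.
Proof.
split=> [|i j]; apply/funext => s.
  by rewrite /newton expr0 mul1r bin0.
rewrite -[RHS]/(natfun_at s _) rmorph_sum /=.
rewrite -[LHS]/(newton i s * newton j s) /newton mulrACA -exprD -natrM bin_mul_bin.
rewrite natr_sum mulr_sumr; apply: eq_bigr => m _.
rewrite (rmorphMn (natfun_at s)) (rmorphM (natfun_at s)) (rmorphXn (natfun_at s)).
rewrite /natfun_at /natfun_cst mulrA -exprD subnK; last by rewrite -ltnS.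
by rewrite natrM mulrCA mulr_natl.
Qed.

Lemma scal_ex : exists f : {rmorphism K -> FB},
  (forall c, (f c).1 = natfun_cst c) /\ (f 'X).2 = lam.
Proof.
have [g _] := lB.
have cg : commr_rmorph g lam by move=> u; apply: mulrC.
have [f fE] := pair_rmorphism (@natfun_cst K) (horner_morph cg).
by exists f; split=> [c|]; rewrite fE //= horner_morphX.
Qed.

Definition scal : {rmorphism K -> FB} := projT1 (cid scal_ex).

Lemma scal1 c : (scal c).1 = natfun_cst c.
Proof. by rewrite /scal; case: cid => f [/= e _]; apply: e. Qed.

Lemma scal2 : (scal 'X).2 = lam.
Proof. by rewrite /scal; case: cid => f [/= _ e]; apply: e. Qed.

Let f1 : {rmorphism FB -> F} := fst.
Let f2 : {rmorphism FB -> B} := snd.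

(* For every s, the coefficients X^i 'C(s, i) of (1 + X x)^s satisfy the same
   relations as h. An element of the span of the pairs (newton i, h i) is
   determined by its values at the integers s, so the vector interpolating
   the s [X] has a second component, which is the Witt vector attached to h. *)
Definition hpair i : FB := (newton i, h i).

Lemma hpair_hom : ishom (scal 'X) hpair.
Proof.
have [n0 nS] := newton_hom; have [h0 hS] := hh.
split=> [|i j]; first by rewrite /hpair n0 h0.
apply: injective_projections.
  transitivity (newton i * newton j); first by [].
  rewrite nS -[RHS]/(f1 _) rmorph_sum; apply: eq_bigr => m _.
  by rewrite rmorphMn rmorphM rmorphXn /= scal1.
transitivity (h i * h j); first by [].
rewrite hS -[RHS]/(f2 _) rmorph_sum; apply: eq_bigr => m _.
by rewrite rmorphMn rmorphM rmorphXn /= scal2.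
Qed.

Definition spanned (u : FB) : Prop :=
  exists n (P : nat -> K), u = \sum_(i < n) scal (P i) * hpair i.

Lemma spanned_gen c i : spanned (scal c * hpair i).
Proof.
exists i.+1, (fun j => if j == i then c else 0).
rewrite big_ord_recr /= eqxx big1 ?add0r // => j _.
by rewrite ltn_eqF // rmorph0 mul0r.
Qed.

Lemma spannedD u v : spanned u -> spanned v -> spanned (u + v).
Proof.
move=> [n [P ->]] [m [Q ->]].
exists (maxn n m), (fun i => (if (i < n)%N then P i else 0) + (if (i < m)%N then Q i else 0)).
transitivity (\sum_(i < maxn n m) (scal (if (i < n)%N then P i else 0) * hpair i +
  scal (if (i < m)%N then Q i else 0) * hpair i)); last first.
  by apply: eq_bigr => i _; rewrite rmorphD mulrDl.
rewrite big_split; congr (_ + _) => /=.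
  rewrite (big_ord_widen _ (fun i => scal (P i) * hpair i) (leq_maxl n m)) big_mkcond.
  by apply: eq_bigr => i _; case: ifP; rewrite ?rmorph0 ?mul0r.
rewrite (big_ord_widen _ (fun i => scal (Q i) * hpair i) (leq_maxr n m)) big_mkcond.
by apply: eq_bigr => i _; case: ifP; rewrite ?rmorph0 ?mul0r.
Qed.

Lemma spanned0 : spanned 0.
Proof. by exists 0%N, (fun=> 0); rewrite big_ord0. Qed.

Lemma spanned_sum (I : Type) (r : seq I) (P : pred I) (u : I -> FB) :
  (forall i, P i -> spanned (u i)) -> spanned (\sum_(i <- r | P i) u i).
Proof. by move=> H; apply: big_ind H; [exact: spanned0|exact: spannedD]. Qed.

Lemma spanned_scal c u : spanned u -> spanned (scal c * u).
Proof.
move=> [n [P ->]]; rewrite mulr_sumr; apply: spanned_sum => i _.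
by rewrite mulrA -rmorphM; apply: spanned_gen.
Qed.

(** Both components of the generators multiply with the same structure constants, by [hpair_hom]; so
    the span is a ring, and Witt vectors over it make sense. *)
Lemma spannedM u v : spanned u -> spanned v -> spanned (u * v).
Proof.
move=> [n [P ->]] [m [Q ->]]; rewrite mulr_suml; apply: spanned_sum => i _.
rewrite mulr_sumr; apply: spanned_sum => j _.
rewrite mulrACA -rmorphM; apply: spanned_scal; rewrite hpair_hom.2.
apply: spanned_sum => k _; rewrite -mulr_natl -rmorphXn mulrA.
by rewrite -(rmorph_nat scal) -rmorphM; apply: spanned_gen.
Qed.

Definition span_pred : {pred FB} := fun u => `[< spanned u >].

Lemma span_pred_subring : subring_closed span_pred.
Proof.
split.
- by apply/asboolP; have := spanned_gen 1 0; rewrite rmorph1 mul1r hpair_hom.1.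
- move=> u v /asboolP su /asboolP sv; apply/asboolP; apply: spannedD => //.
  by rewrite -mulN1r -(rmorphN1 scal); apply: spanned_scal.
- by move=> u v /asboolP su /asboolP sv; apply/asboolP; apply: spannedM.
Qed.
HB.instance Definition _ := GRing.isSubringClosed.Build FB span_pred span_pred_subring.

Record span_ring := SpanRing { span_val :> FB; _ : span_val \in span_pred }.
HB.instance Definition _ := [isSub for span_val].
HB.instance Definition _ := [Choice of span_ring by <:].
HB.instance Definition _ := [SubChoice_isSubComNzRing of span_ring by <:].

Lemma span_ringP (u : span_ring) : spanned (val u).
Proof. by apply/asboolP/(valP u). Qed.

Definition span_at s : {rmorphism span_ring -> K} := natfun_at s \o (f1 \o val).
Definition span_snd : {rmorphism span_ring -> B} := f2 \o val.

Lemma span_atE s n (P : nat -> K) :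
  natfun_at s (\sum_(i < n) scal (P i) * hpair i).1 = \sum_(i < n) P i * 'X^i *+ 'C(s, i).
Proof.
rewrite -[(_).1]/(f1 _) (rmorph_sum f1) (rmorph_sum (natfun_at s)).
apply: eq_bigr => i _; rewrite (rmorphM f1) (rmorphM (natfun_at s)) /= scal1.
by rewrite /natfun_at /natfun_cst /newton mulrA mulr_natr.
Qed.

Lemma sumX_dvd n (P : nat -> K) N :
  (forall s, exists c, \sum_(i < n) P i * 'X^i *+ 'C(s, i) = c *+ N) ->
  forall i, (i < n)%N -> exists c, P i = c *+ N.
Proof.
move=> H; elim/ltn_ind => i IH iln; have [c cE] := H i.
suff [w wE] : exists w, P i * 'X^i = w *+ N.
  exists (drop_poly i w); apply/polyP => j; rewrite coefMn coef_drop_poly.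
  by have /polyP/(_ (j + i)%N) := wE; rewrite coefMXn coefMn ltnNge leq_addl addnK.
have {cE} : \sum_(j < i.+1) P j * 'X^j *+ 'C(i, j) = c *+ N.
  rewrite -cE (big_ord_widen _ (fun j => P j * 'X^j *+ 'C(i, j)) iln) big_mkcond.
  apply: eq_bigr => j _; case: ifP => // /negbT; rewrite -leqNgt => ij.
  by rewrite bin_small.
rewrite big_ord_recr /= binn mulr1n => /(canRL (addKr _)) ->.
have [d dE] : exists d : nat -> K, forall j, (j < i)%N -> P j = d j *+ N.
  exists (fun j => if pselect (exists c, P j = c *+ N) is left h then projT1 (cid h) else 0).
  move=> j ji; case: pselect => [hj|[]]; first by case: cid.
  by apply: IH => //; apply: ltn_trans iln.
exists (c - \sum_(j < i) d j * 'X^j *+ 'C(i, j)).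
rewrite mulrnBl addrC; congr (_ - _); rewrite -sumrMnl; apply: eq_bigr => j _.
by rewrite dE // mulrnAl mulrnAC.
Qed.

Lemma span_dvd (u : span_ring) N : (forall s, exists c, span_at s u = c *+ N) ->
  exists v, u = v *+ N.
Proof.
move=> H; have [n [P uE]] := span_ringP u.
have {}H : forall i, (i < n)%N -> exists c, P i = c *+ N.
  apply: sumX_dvd => s; have [c cE] := H s; exists c.
  by rewrite -cE /= uE span_atE.
have [Q QE] : exists Q : nat -> K, forall j, (j < n)%N -> P j = Q j *+ N.
  exists (fun j => if pselect (exists c, P j = c *+ N) is left h then projT1 (cid h) else 0).
  by move=> j jn; case: pselect => [hj|[]]; [case: cid|apply: H].
have sv : \sum_(i < n) scal (Q i) * hpair i \in span_pred.
  by apply/asboolP; exists n, Q.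
exists (SpanRing sv); apply: val_inj; rewrite uE raddfMn /= -sumrMnl.
by apply: eq_bigr => i _; rewrite QE // rmorphMn mulrnAl.
Qed.

(** Vanishing at all integers kills the coefficients of the combination, and with them the component
    in B, which no [span_at] sees. *)
Lemma span_inj (u : span_ring) : (forall s, span_at s u = 0) -> u = 0.
Proof.
move=> H; have [n [P uE]] := span_ringP u.
have {}H : forall i, (i < n)%N -> exists c, P i = c *+ 0.
  apply: sumX_dvd => s; exists 0.
  by rewrite mulr0n; apply: etrans (H s); rewrite /= uE span_atE.
apply: val_inj; rewrite uE /= big1 // => i _.
by have [c ->] := H i (ltn_ord i); rewrite mulr0n rmorph0 mul0r.
Qed.

Lemma spanned_scal1 c : scal c \in span_pred.
Proof. by apply/asboolP; have := spanned_gen c 0; rewrite hpair_hom.1 mulr1. Qed.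

Lemma spanned_hpair i : hpair i \in span_pred.
Proof. by apply/asboolP; have := spanned_gen 1 i; rewrite rmorph1 mul1r. Qed.

Definition span_scal c : span_ring := SpanRing (spanned_scal1 c).
Definition span_gen i : span_ring := SpanRing (spanned_hpair i).

Lemma span_scal_zmod : zmod_morphism span_scal.
Proof. by move=> x y; apply: val_inj; rewrite raddfB /= rmorphB. Qed.
Lemma span_scal_monoid : monoid_morphism span_scal.
Proof.
by split=> [|x y]; apply: val_inj; rewrite ?rmorphM ?rmorph1 /= ?rmorph1 ?rmorphM.
Qed.
HB.instance Definition _ := GRing.isZmodMorphism.Build K span_ring span_scal span_scal_zmod.
HB.instance Definition _ := GRing.isMonoidMorphism.Build K span_ring span_scal span_scal_monoid.

Lemma zloc_local : islocal (zloc p).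
Proof. by exists idfun. Qed.

Lemma K_local : islocal K.
Proof. exact: islocal_rmorphism (@polyC _) zloc_local. Qed.

Lemma span_local : islocal span_ring.
Proof. exact: islocal_rmorphism span_scal K_local. Qed.

Lemma span_at_scal s c : span_at s (span_scal c) = c.
Proof. by rewrite /= scal1. Qed.

Lemma span_at_gen s i : span_at s (span_gen i) = 'X^i *+ 'C(s, i).
Proof. by rewrite /= /natfun_at /= /newton mulr_natr. Qed.

Lemma K_tf : torsion_free K.
Proof.
move=> n f g n0 e; apply/polyP => i; apply: (zloc_tf n0).
by rewrite -!coefMn e.
Qed.

Definition witt_nat s : W K := teich p_pr 'X *+ s.

(** The ghost components s X^(p^k) = X^(p^k - 1) (s X) come from the span. Solving for component k
    requires division by p^k, which is possible at each s since s [X] exists over K, and then in the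
    span by [span_dvd]. *)
Lemma span_witt_ex : exists z : W span_ring, forall s, wmap (span_at s) z = witt_nat s.
Proof.
suff H k : exists u : span_ring, forall s, span_at s u = witt_nat s k.
  exists (Witt p_pr (fun k => projT1 (cid (H k)))) => s; apply: wittP => k /=.
  by case: cid => u /= ->.
elim/ltn_ind: k => k IH.
have [g gE] : exists g : nat -> span_ring, forall i, (i < k)%N ->
    forall s, span_at s (g i) = witt_nat s i.
  exists (fun j => if pselect (exists u : span_ring, forall s, span_at s u = witt_nat s j)
    is left h then projT1 (cid h) else 0).
  by move=> j jk; case: pselect => [hj|[]]; [case: cid|apply: IH].
pose u := span_scal 'X^((p ^ k).-1) * span_gen 1 -
  \sum_(i < k) g i ^+ (p ^ (k - i)) *+ p ^ i.
have uE s : span_at s u = witt_nat s k *+ p ^ k.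
  have gh : ghost p (witt_nat s) k = 'X^(p ^ k) *+ s.
    rewrite /witt_nat; elim: s => [|s IHs]; first by rewrite !mulr0n; exact: ghost_zero.
    by rewrite !mulrS ghostD ghost_teich IHs.
  have {gh} -> : witt_nat s k *+ p ^ k = - (\sum_(i < k) witt_nat s i ^+ (p ^ (k - i)) *+ p ^ i)
      + 'X^(p ^ k) *+ s.
    by rewrite -gh /ghost big_ord_recr /= subnn expn0 expr1 addKr.
  have -> : span_at s u = span_at s (span_scal 'X^((p ^ k).-1)) * span_at s (span_gen 1)
      - \sum_(i < k) span_at s (g i) ^+ (p ^ (k - i)) *+ p ^ i.
    rewrite -[X in _ = X - _]rmorphM.
    rewrite (eq_bigr (fun i : 'I_k => span_at s (g i ^+ (p ^ (k - i)) *+ p ^ i))) => [|i _].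
      by rewrite -[X in _ = _ - X]rmorph_sum -[RHS]rmorphB.
    by rewrite -rmorphXn -rmorphMn.
  rewrite span_at_scal span_at_gen bin1 mulrnAr -exprD addn1 prednK ?expn_gt0 ?prime_gt0 //.
  rewrite addrC; congr (- _ + _); apply: eq_bigr => i _; rewrite gE //.
have [|v vE] := @span_dvd u (p ^ k); first by move=> s; eexists; apply: uE.
exists v => s; have pk : (0 < p ^ k)%N by rewrite expn_gt0 prime_gt0.
have e : span_at s v *+ p ^ k = witt_nat s k *+ p ^ k by rewrite -uE vE -rmorphMn.
exact: K_tf pk e.
Qed.

Theorem hom_witt : exists z : W B, Flam lam z = 0 /\
  forall (C : comNzRingType) (g : {rmorphism B -> C}) (x : C), nil x ->
  E (wmap g z) x = ev (g \o h) (kap p_pr (g lam) x).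
Proof.
have [z zE] := span_witt_ex.
pose l := span_scal 'X.
have sl : span_snd l = lam by rewrite /= scal2.
exists (wmap span_snd z); split.
  have Fz : Flam l z = 0.
    apply: wittP => k; apply: span_inj => s.
    have -> : span_at s (Flam l z k) = wmap (span_at s) (Flam l z) k by [].
    rewrite Flam_rmorph zE span_at_scal /witt_nat raddfMn /= Flam_teich mul0rn.
    by [].
  by rewrite -sl -Flam_rmorph Fz wmap0.
move=> C g x [M e]; have e' : x ^+ M.+1 = 0 by rewrite exprS e mulr0.
have lG := span_local; have lT := islocal_rmorphism (tC M span_ring) lG.
have nt := tX_isnil M span_ring.
have [f [fX fC]] := trunc_lift (g \o span_snd) e'.
(* At every integer s both sides become (1 + X kap(t))^s, so they agree over the span; the second
   projection carries the equality to B. *)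
have H : E (wmap (tC M span_ring) z) (tX M span_ring)
    = ev (tC M span_ring \o span_gen) (kap p_pr (tC M span_ring l) (tX M span_ring)).
  apply: trunc_eq => i iM; apply/eqP; rewrite -subr_eq0 -coefB; apply/eqP.
  apply: span_inj => s.
  have [a [aX aC]] := @trunc_lift M _ _ (tC M K \o span_at s) (tX M K) (tX_nil M K).
  have aE (u : trunc M span_ring) : span_at s (u : {poly span_ring})`_i = (a u : {poly K})`_i.
    rewrite [u in RHS]trunc_sum rmorph_sum poly_of_qpoly_sum coef_sum.
    rewrite (bigD1 (Ordinal (iM : (i < M.+1)%N))) //= big1 ?addr0 => [|j ji].
      by rewrite rmorphM rmorphXn aX aC /= coef_tCX // eqxx.
    rewrite rmorphM rmorphXn aX aC /= coef_tCX //.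
    by case: eqP => // ij; case/eqP: ji; apply: val_inj.
  rewrite coefB (rmorphB (span_at s)) !aE; apply/eqP; rewrite subr_eq0; apply/eqP.
  congr ((_ : {poly K})`_i); congr (polyn _).
  rewrite E_rmorph // aX ev_rmorph; last exact: nil_kap.
  rewrite kap_rmorph // aX aC /= scal1.
  have -> : wmap a (wmap (tC M span_ring) z) = teich p_pr (tC M K 'X) *+ s.
    rewrite -wmap_teich -raddfMn -/(witt_nat s) -zE.
    by apply: wittP => k /=; rewrite aC.
  rewrite E_teichMn; [|exact: islocal_rmorphism (tC M K) K_local|exact: tX_isnil].
  congr ev; apply/funext => j /=.
  by rewrite aC /= -rmorphXn -rmorphMn -span_at_gen.
have := congr1 f H; rewrite E_rmorph // fX ev_rmorph; last exact: nil_kap.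
rewrite kap_rmorph // fX fC /= scal2.
have -> : wmap f (wmap (tC M span_ring) z) = wmap g (wmap span_snd z).
  by apply: wittP => k /=; rewrite fC.
by move=> ->; congr ev; apply/funext => j /=; rewrite fC.
Qed.

End Newton.

(** * Coefficients of psi *)

Section GlawExpansion.
Variables (C : comNzRingType) (lam x y : C).

Lemma sig_eq0l i j m : (m < i)%N -> sig i j m = 0%N.
Proof.
move=> mi; rewrite /sig; case: ifP => // _.
by rewrite [X in (_ * X)%N]bin_small ?muln0 //; lia.
Qed.

Lemma sig_eq0r i j m : (m < j)%N -> sig i j m = 0%N.
Proof. by move=> mj; rewrite /sig (bin_small mj) mul0n if_same. Qed.

Lemma sig_eq0 i j m : (i + j < m)%N -> sig i j m = 0%N.
Proof. by move=> ijm; rewrite /sig leqNgt ijm. Qed.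

Lemma glaw_exp m n : (m < n)%N -> glaw lam x y ^+ m =
  \sum_(i < n) \sum_(j < n) (lam ^+ (i + j - m) *+ sig i j m) * x ^+ i * y ^+ j.
Proof.
move=> mn.
transitivity (\sum_(i < m.+1) \sum_(j < m.+1)
    (lam ^+ (i + j - m) *+ sig i j m) * x ^+ i * y ^+ j); last first.
  rewrite (big_ord_widen n (fun i => \sum_(j < m.+1)
    (lam ^+ (i + j - m) *+ sig i j m) * x ^+ i * y ^+ j)) // big_mkcond.
  apply: eq_bigr => i _; rewrite ltnS; case: leqP => [im|mi]; last first.
    by rewrite big1 // => j _; rewrite sig_eq0l // mulr0n !mul0r.
  rewrite (big_ord_widen n (fun j =>
    (lam ^+ (i + j - m) *+ sig i j m) * x ^+ i * y ^+ j)) // big_mkcond.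
  apply: eq_bigr => j _; rewrite ltnS; case: leqP => [//|mj].
  by rewrite sig_eq0r // mulr0n !mul0r.
rewrite exchange_big (_ : glaw lam x y = x + (1 + lam * x) * y); last by rewrite /glaw; ring.
rewrite exprDn; apply: eq_bigr => -[j /= jlt] _.
have jm : (j <= m)%N by rewrite -ltnS.
rewrite {jlt} exprMn (exprDn 1).
have -> : (m.+1 = (m - j) + j.+1)%N by lia.
rewrite big_split_ord /= [X in _ = X + _]big1 ?add0r => [|i _]; last first.
  have := ltn_ord i; rewrite /sig => il.
  by rewrite ifF ?mulr0n ?mul0r ?mul0r //; apply/negbTE; lia.
rewrite mulr_suml mulr_sumr -sumrMnl; apply: eq_bigr => e _.
have ej : (e <= j)%N by rewrite -ltnS.
have e1 : (m <= m - j + e + j)%N by lia.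
have e2 : (m - j + e + j - m = e)%N by lia.
rewrite /sig e1 e2 expr1n mul1r exprMn exprD !(mulrnAl, mulrnAr) mulnC mulrnA.
by congr (_ *+ _ *+ _); ring.
Qed.

Lemma poly_glaw (c : nat -> C) n :
  \sum_(m < n) c m * glaw lam x y ^+ m = \sum_(i < n) \sum_(j < n)
    (\sum_(m < n) lam ^+ (i + j - m) * c m *+ sig i j m) * x ^+ i * y ^+ j.
Proof.
rewrite (eq_bigr (fun m : 'I_n => \sum_(i < n) \sum_(j < n)
  (lam ^+ (i + j - m) * c m *+ sig i j m) * x ^+ i * y ^+ j)) => [|m _].
  rewrite exchange_big; apply: eq_bigr => i _; rewrite exchange_big.
  by apply: eq_bigr => j _; rewrite !mulr_suml.
rewrite (glaw_exp (ltn_ord m)) mulr_sumr; apply: eq_bigr => i _.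
rewrite mulr_sumr; apply: eq_bigr => j _.
by rewrite !(mulrnAl, mulrnAr); congr (_ *+ _); ring.
Qed.

Lemma nil_glaw : nil x -> nil y -> nil (glaw lam x y).
Proof. by move=> nx ny; apply: nilD; [exact: nilD|exact: nil_mull]. Qed.
End GlawExpansion.

(* The coefficient of x^i y^j in the series c at x + y + lam x y. *)
Definition glaw_coef (B : comNzRingType) (lam : B) (c : nat -> B) i j : B :=
  \sum_(m < (i + j).+1) lam ^+ (i + j - m) * c m *+ sig i j m.

Lemma glaw_coefE (B : comNzRingType) (lam : B) (c : nat -> B) i j n :
  (i + j < n)%N ->
  \sum_(m < n) lam ^+ (i + j - m) * c m *+ sig i j m = glaw_coef lam c i j.
Proof.
move=> ijn; rewrite /glaw_coef [RHS](big_ord_widen n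
  (fun m => lam ^+ (i + j - m) * c m *+ sig i j m)) // [RHS]big_mkcond.
by apply: eq_bigr => m _; case: ltnP => // le; rewrite sig_eq0.
Qed.

Lemma glaw_coef_small (B : comNzRingType) (lam : B) (c : nat -> B) i j n :
  (forall m, (n <= m)%N -> c m = 0) ->
  \sum_(m < n) lam ^+ (i + j - m) * c m *+ sig i j m = glaw_coef lam c i j.
Proof.
move=> c0; rewrite -(@glaw_coefE _ _ _ _ _ (n + (i + j).+1)) ?leq_addl //.
rewrite big_split_ord /= [X in _ + X]big1 ?addr0 // => m _.
by rewrite c0 ?leq_addr // mulr0 mul0rn.
Qed.

Lemma bisum_comb (T : comNzRingType) n (u v : T) (F G : nat -> nat -> T)
  (f g : nat -> T) :
  u * (\sum_(k < n) \sum_(l < n) F k l + \sum_(k < n) \sum_(l < n) G k l)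
    + v * ((\sum_(k < n) f k) * (\sum_(l < n) g l))
  = \sum_(k < n) \sum_(l < n) (u * (F k l + G k l) + v * (f k * g l)).
Proof.
rewrite -big_split mulr_suml !mulr_sumr -big_split; apply: eq_bigr => k _ /=.
rewrite -big_split !mulr_sumr -big_split; apply: eq_bigr => l _ //.
Qed.

Section FromPoints.
Variables (B : comNzRingType) (lam : B) (c : nat -> B) (a b : B).

(** The constants cover two uses: a = 1 and b = lam^(p^l) for psi as a map between group schemes, a
    = 0 and b = 1 for homomorphisms to G_m. Coefficients are read off at the generic pair with
    x^(M+1) = y^(M+1) = 0. *)
Lemma glaw_coef_points :
  (forall (C : comNzRingType) (g : {rmorphism B -> C}) (x y : C), nil x -> nil y ->
    ev (g \o c) (glaw (g lam) x y) =
    g a * (ev (g \o c) x + ev (g \o c) y) + g b * (ev (g \o c) x * ev (g \o c) y)) ->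
  forall i j, glaw_coef lam c i j =
    a * (c i *+ (j == 0)%N + c j *+ (i == 0)%N) + b * (c i * c j).
Proof.
move=> H i j; pose M := (i + j)%N; pose h : {poly B} := 'X^(M.+1).
have hm : h \is monic := truncX_monic M B.
have hs : (1 < size h)%N := truncX_size M B.
have dE : (size h).-1 = M.+1 by rewrite /h size_polyXn.
pose x := biX h; pose y := biY h.
pose g : {rmorphism B -> _} := (qpolyC (map_poly (qpolyC h) h)) \o (qpolyC h).
have gE u : g u = biC h u by [].
have x0 : x ^+ M.+1 = 0 by rewrite /x /biX -rmorphXn tX_nil rmorph0.
have y0 : y ^+ M.+1 = 0.
  have hs2 : (1 < size (map_poly (qpolyC h) h))%N by rewrite biquotient_size.
  rewrite -(in_qpoly_self (biquotient_monic hm) hs2) /y /biY /qpolyX -rmorphXn.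
  by congr (in_qpoly _ _); rewrite [RHS]map_polyXn.
have nx : nil x by exists M.+1.
have ny : nil y by exists M.+1.
have nS : glaw (g lam) x y ^+ (M.+1 + M.+1).+1 = 0.
  have xy : forall k l, (M.+1 + M.+1 <= k + l)%N -> x ^+ k * y ^+ l = 0.
    move=> k l kl; case: (leqP M.+1 k) => kM; first by rewrite (exp_nil_leq x0) ?mul0r.
    by rewrite (exp_nil_leq y0) ?mulr0 //; lia.
  rewrite (_ : glaw _ _ _ = x + (1 + g lam * x) * y); last by rewrite /glaw; ring.
  rewrite exprDn big1 // => k _; rewrite exprMn mulrCA xy ?mulr0 ?mul0rn //.
  by have := ltn_ord k; lia.
(* The group law may leave the range of exponents killing x and y, hence the longer sum, which
   [trim] cuts back. *)
pose N := (M.+1 + M.+1).+1.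
pose d i j := glaw_coef lam c i j - (a * (c i *+ (j == 0)%N + c j *+ (i == 0)%N) + b * (c i * c j)).
suff D0 : d i j = 0 by apply/eqP; rewrite -subr_eq0; apply/eqP.
apply: (biquotient_basis hm hs (b := d)); rewrite ?dE; [|rewrite /M; lia..].
have := H _ g x y nx ny; rewrite (evE _ nS) -/N poly_glaw !(evE _ x0) !(evE _ y0).
have trim (F : nat -> nat -> {poly %/ map_poly (qpolyC h) h}) :
    \sum_(k < N) \sum_(l < N) F k l * x ^+ k * y ^+ l =
    \sum_(k < M.+1) \sum_(l < M.+1) F k l * x ^+ k * y ^+ l.
  rewrite [RHS](big_ord_widen N (fun k => \sum_(l < M.+1) F k l * x ^+ k * y ^+ l)); last by rewrite /N; lia.
  rewrite [RHS]big_mkcond; apply: eq_bigr => k _; case: ltnP => kM; last first.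
    by rewrite big1 // => l _; rewrite (exp_nil_leq x0) // mulr0 mul0r.
  rewrite [RHS](big_ord_widen N (fun l => F k l * x ^+ k * y ^+ l)); last by rewrite /N; lia.
  rewrite [RHS]big_mkcond; apply: eq_bigr => l _; case: ltnP => lM //.
  by rewrite (exp_nil_leq y0) // mulr0.
rewrite (trim (fun k l => \sum_(m < N) g lam ^+ (k + l - m) * (g \o c) m *+ sig k l m)).
set L := (X in X = _); set R := (X in _ = X) => LR.
transitivity (L - R); last by rewrite LR subrr.
have -> : L = \sum_(k < M.+1) \sum_(l < M.+1) biC h (glaw_coef lam c k l) * x ^+ k * y ^+ l.
  apply: eq_bigr => k _; apply: eq_bigr => l _; congr (_ * _ * _).
  rewrite -(@glaw_coefE _ _ _ _ _ N); last first.
    by have := ltn_ord k; have := ltn_ord l; rewrite /N; lia.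
  rewrite -gE rmorph_sum; apply: eq_bigr => m _.
  by rewrite rmorphMn rmorphM rmorphXn.
have -> : R = \sum_(k < M.+1) \sum_(l < M.+1)
    biC h (a * (c k *+ (l == 0 :> nat)%N + c l *+ (k == 0 :> nat)%N) + b * (c k * c l)) * x ^+ k * y ^+ l.
  rewrite /R.
  have cx : \sum_(i < M.+1) (g \o c) i * x ^+ i = \sum_(k < M.+1) \sum_(l < M.+1)
      g (c k *+ (l == 0 :> nat)%N) * x ^+ k * y ^+ l.
    apply: eq_bigr => k _; rewrite big_ord_recl big1 ?addr0 => [|l _].
      by rewrite expr0 mulr1.
    by rewrite lift0 [(_ == _)]/= mulr0n (rmorph0 g) !mul0r.
  have cy : \sum_(i < M.+1) (g \o c) i * y ^+ i = \sum_(k < M.+1) \sum_(l < M.+1)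
      g (c l *+ (k == 0 :> nat)%N) * x ^+ k * y ^+ l.
    rewrite exchange_big; apply: eq_bigr => l _; rewrite big_ord_recl big1 ?addr0 => [|k _].
      by rewrite [RHS]addr0 expr0 mulr1.
    by rewrite lift0 [(_ == _)]/= mulr0n (rmorph0 g) !mul0r.
  rewrite [X in g a * (X + _)]cx [X in g a * (_ + X)]cy.
  rewrite (bisum_comb _ (g a) (g b) (fun k l => g (c k *+ (l == 0)%N) * x ^+ k * y ^+ l)
    (fun k l => g (c l *+ (k == 0)%N) * x ^+ k * y ^+ l)
    (fun k => (g \o c) k * x ^+ k) (fun l => (g \o c) l * y ^+ l)).
  apply: eq_bigr => k _; apply: eq_bigr => l _.
  by rewrite -gE !(rmorphD g) !(rmorphM g) !(rmorphD g); ring.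
rewrite -sumrB; apply: eq_bigr => k _; rewrite -sumrB; apply: eq_bigr => l _.
by rewrite /d -!gE rmorphB !mulrBl.
Qed.
End FromPoints.

(** * Binomial coefficients of prime powers *)

Section Arithmetic.
Variables (p : nat) (p_pr : prime p).
Let p_gt0 : (0 < p)%N := prime_gt0 p_pr.
Let p_gt1 : (1 < p)%N := prime_gt1 p_pr.

(** From m C(p^e, m) = p^e C(p^e - 1, m - 1), after cancelling the p-part of m. *)
Lemma bin_pfactor e m : (0 < m)%N -> (m <= p ^ e)%N ->
  (logn p m <= e)%N /\ (p ^ (e - logn p m) %| 'C(p ^ e, m))%N.
Proof.
move=> m0 me; have [m' pm mE] := pfactor_coprime p_pr m0; set v := logn p m in mE *.
have m'0 : (0 < m')%N by move: m0; rewrite mE muln_gt0 => /andP[].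
have ve : (v <= e)%N.
  rewrite -(leq_exp2l _ _ p_gt1) (leq_trans _ me) // mE.
  by rewrite leq_pmull.
split=> //.
have H : (p ^ (e - v) * 'C((p ^ e).-1, m.-1) = m' * 'C(p ^ e, m))%N.
  apply/eqP; rewrite -(@eqn_pmul2l (p ^ v)) ?expn_gt0 ?p_gt0 // !mulnA -expnD subnKC //.
  by rewrite [(p ^ v * m')%N]mulnC -mE mul_bin_diag prednK.
have : (p ^ (e - v) %| m' * 'C(p ^ e, m))%N by rewrite -H dvdn_mulr.
by rewrite Gauss_dvdr // coprimeXl.
Qed.

Lemma dvdn_bin_pfactor e m : (0 < m < p ^ e)%N -> (p %| 'C(p ^ e, m))%N.
Proof.
move=> /andP[m0 me]; have [ve] := bin_pfactor m0 (ltnW me).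
apply: dvdn_trans; rewrite -{1}[p]expn1 dvdn_exp2l // subn_gt0.
have := dvdn_leq m0 (pfactor_dvdnn p m); move/leq_ltn_trans/(_ me).
by rewrite ltn_exp2l.
Qed.

(** Two neighbours in row p^e - 1 add up to an inner entry of row p^e, which p divides; so they are
    opposite modulo p, starting from 1. *)
Lemma coprime_bin_pred e j : (j < p ^ e)%N -> coprime p 'C((p ^ e).-1, j).
Proof.
have pe : (0 < p ^ e)%N by rewrite expn_gt0 p_gt0.
elim: j => [|j IH] je; first by rewrite bin0 coprimen1.
have := IH (ltnW je); rewrite !prime_coprime //; apply: contra => d.
have : (p %| 'C(p ^ e, j.+1))%N by apply: dvdn_bin_pfactor.
by rewrite -{1}(prednK pe) binS dvdn_addr.
Qed.

Lemma bin_pred_mul e k : (k <= e)%N ->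
  'C(p ^ e, p ^ k) = (p ^ (e - k) * 'C((p ^ e).-1, (p ^ k).-1))%N.
Proof.
move=> ke; have pk : (0 < p ^ k)%N by rewrite expn_gt0 p_gt0.
have := mul_bin_diag (p ^ e) (p ^ k).-1; rewrite prednK // -{1}(subnKC ke) expnD.
by rewrite -mulnA => /eqP; rewrite eqn_pmul2l // => /eqP.
Qed.

End Arithmetic.

Lemma horner_ev (C : comNzRingType) (P : {poly C}) x : nil x ->
  P.[x] = ev (fun i => P`_i) x.
Proof.
move=> [m e]; have e' : x ^+ (size P + m) = 0 by rewrite exprD e mulr0.
by rewrite (evE _ e') -horner_coef_wide // leq_addr.
Qed.

Section PsiCoefficients.
Variables (p l : nat) (p_pr : prime p).

Lemma psi_map (C C' : comNzRingType) (g : {rmorphism C -> C'}) lam q :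
  map_poly g (psi p l lam q) = psi p l (g lam) (g \o q).
Proof.
rewrite /psi rmorphD /= map_polyXn rmorph_sum /=; congr (_ + _); apply: eq_bigr => j _.
by rewrite map_polyZ map_polyXn !rmorphM rmorphXn rmorph_nat.
Qed.

(* With q_l = 1 the formula for the coefficients of psi also gives the leading one. *)
Definition qx (C : comNzRingType) (q : nat -> C) v : C := if (v < l)%N then q v else 1.

Definition psi_int m : nat := 'C(p ^ l, m) %/ p ^ (l - logn p m).

Lemma psi_coef (C : comNzRingType) (lam : C) q m :
  (psi p l lam q)`_m = if (0 < m <= p ^ l)%N then
    (psi_int m)%:R * lam ^+ (m - p ^ logn p m) * qx q (logn p m) else 0.
Proof.
have p1 := prime_gt1 p_pr.
rewrite /psi coefD coefXn coef_sum.
rewrite (eq_big_nat _ _ (F2 := fun j => if j == m then (psi_int j)%:R * lam ^+ (j - p ^ logn p j) * q (logn p j) else 0)); last first.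
  by move=> j _; rewrite coefZ coefXn eq_sym; case: eqP; rewrite ?mulr1 ?mulr0.
have [->|m0] := posnP m.
  rewrite eq_sym -[_ == _]negbK -lt0n expn_gt0 prime_gt0 // add0r.
  by rewrite big_nat big1 // => j /andP[j0 _]; case: eqP j0 => // ->.
case: (ltngtP m (p ^ l)) => ml /=.
- rewrite add0r (bigD1_seq m) ?mem_index_iota ?iota_uniq ?m0 //= eqxx big1 ?addr0.
    have v : (logn p m < l)%N.
      rewrite -(ltn_exp2l _ _ p1) (leq_ltn_trans _ ml) //.
      exact: dvdn_leq (pfactor_dvdnn p m).
    by rewrite /qx v.
  by move=> j /negPf ->.
- by rewrite add0r big_nat big1 // => j /andP[_ jl]; case: eqP => // jm; move: jl ml; rewrite jm ltnNge => /negbTE; lia.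
- rewrite big_nat big1 => [|j /andP[_ jl]]; last by case: eqP => // jm; lia.
  rewrite addr0 ml pfactorK // /qx ltnn !subnn expr0 !mulr1 /psi_int pfactorK //.
  by rewrite binn subnn expn0 divn1.
Qed.

End PsiCoefficients.

Section Datum.
Variables (p n l : nat) (p_pr : prime p).

Record datum (B : comNzRingType) (lam : B) (q : nat -> B) : Prop := Datum {
  datum_p : (p%:R : B) ^+ n = 0;
  datum_qE : forall k, (k < l)%N ->
    q k * lam ^+ (p ^ l) = (p ^ (l - k))%:R * lam ^+ (p ^ k);
  datum_nil : forall k, (k < l)%N -> nil (q k);
  datum_hom : psi_hom p l lam q }.

Lemma datum_islocal (B : comNzRingType) (lam : B) q : datum lam q -> islocal p B.
Proof. by case=> pn0 _ _ _; exact: pnil_islocal pn0. Qed.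

Lemma datum_rmorph (B C : comNzRingType) (g : {rmorphism B -> C}) (lam : B) q :
  datum lam q -> datum (g lam) (g \o q).
Proof.
case=> pn0 qE q_nil H; split.
- by rewrite -(rmorph_nat g) -rmorphXn pn0 rmorph0.
- by move=> k kl; rewrite -rmorphXn -rmorphM qE // rmorphM rmorphXn rmorph_nat.
- by move=> k kl; exact/nil_rmorph/q_nil.
- by move=> C' g' x y; exact: (H C' (g' \o g) x y).
Qed.

Lemma psi_hom_nil (B : comNzRingType) (lam : B) q x y : datum lam q -> nil x -> nil y ->
  (psi p l lam q).[glaw lam x y] =
  glaw (lam ^+ (p ^ l)) (psi p l lam q).[x] (psi p l lam q).[y].
Proof.
move=> D nx ny; have := datum_hom D (g := idfun) (x := x) (y := y); apply.
  exact/nil_unit/nil_mull.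
exact/nil_unit/nil_mull.
Qed.

Section PsiInt.
Let p_gt0 : (0 < p)%N := prime_gt0 p_pr.
Let p_gt1 : (1 < p)%N := prime_gt1 p_pr.

Lemma psi_intE m : (0 < m <= p ^ l)%N ->
  'C(p ^ l, m) = (p ^ (l - logn p m) * psi_int p l m)%N.
Proof.
by move=> /andP[m0 ml]; have [_ d] := bin_pfactor p_pr m0 ml; rewrite mulnC divnK.
Qed.

Lemma psi_int_pX k : (k <= l)%N -> psi_int p l (p ^ k) = 'C((p ^ l).-1, (p ^ k).-1).
Proof.
by move=> kl; rewrite /psi_int (bin_pred_mul p_pr kl) pfactorK // mulKn // expn_gt0 p_gt0.
Qed.

Lemma logn_lt m k : (0 < m)%N -> (m < p ^ k)%N -> (logn p m < k)%N.
Proof.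
move=> m0 mk; rewrite -(ltn_exp2l _ _ p_gt1) (leq_ltn_trans _ mk) //.
exact: dvdn_leq (pfactor_dvdnn p m).
Qed.

Lemma logn_pred_mul k : logn p (p.-1 * p ^ k) = k.
Proof.
have pm1 : (0 < p.-1)%N by move: p_gt1; case: (p) => [|[]].
by rewrite lognM ?expn_gt0 ?p_gt0 // pfactorK // logn_coprime // coprimenP.
Qed.

Lemma sig_pX k : sig (p ^ k) (p ^ k.+1 - p ^ k) (p ^ k.+1) =
  (p * 'C((p ^ k.+1).-1, (p ^ k).-1))%N.
Proof.
have kSk : (p ^ k <= p ^ k.+1)%N by rewrite leq_exp2l.
rewrite /sig subnKC // leqnn subnn bin0 muln1 bin_sub //.
by rewrite (@bin_pred_mul p p_pr k.+1 k) // subSnn expn1.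
Qed.

(** This is [bin_mul_bin] at s = p^l divided by p^(l-k). In [lam_pow_qx] psi produces the same sum;
    the terms below p^(k+1) match by induction, and the last ones give the new relation. *)
Lemma psi_int_identity k (i := (p ^ k)%N) (j := (p ^ k.+1 - p ^ k)%N) : (k < l)%N ->
  (\sum_(m < p ^ k.+1) sig i j m * (psi_int p l m * p ^ (k - logn p m))
   + psi_int p l (p ^ k.+1) * 'C((p ^ k.+1).-1, (p ^ k).-1)
   = p ^ (l - k) * (psi_int p l i * psi_int p l j))%N.
Proof.
move=> kl; have pk : (0 < p ^ k)%N by rewrite expn_gt0 p_gt0.
have pkS : (p ^ k.+1 = p * p ^ k)%N by rewrite expnS.
have ikS : (i <= p ^ k.+1)%N by rewrite pkS leq_pmull.
have ij : (i + j = p ^ k.+1)%N by rewrite /i /j subnKC.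
have kSl : (p ^ k.+1 <= p ^ l)%N by rewrite leq_exp2l.
have jE : (j = p.-1 * p ^ k)%N by rewrite /j pkS -subn1 mulnBl mul1n.
have j0 : (0 < j)%N by rewrite jE muln_gt0 pk andbT; move: p_gt1; case: (p) => [|[]].
have vj : logn p j = k by rewrite jE logn_pred_mul.
have := bin_mul_bin (p ^ l) i j; rewrite ij big_ord_recr /=.
have iB : 'C(p ^ l, i) = (p ^ (l - k) * psi_int p l i)%N.
  by rewrite psi_intE ?pk ?pfactorK // (leq_trans ikS).
have jB : 'C(p ^ l, j) = (p ^ (l - k) * psi_int p l j)%N.
  by rewrite psi_intE ?vj // j0 (leq_trans _ kSl) // -ij leq_addl.
rewrite iB jB => e; apply/eqP.
have P0 : (0 < p ^ (l - k))%N by rewrite expn_gt0 p_gt0.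
rewrite -(@eqn_pmul2l (p ^ (l - k))) //; apply/eqP.
rewrite (_ : (_ * (_ * _) = p ^ (l - k) * psi_int p l i * (p ^ (l - k) * psi_int p l j))%N); last by ring.
rewrite e mulnDr big_distrr; congr (_ + _)%N.
  apply: eq_bigr => -[m /= mlt] _; have [mi|im] := ltnP m i.
    by rewrite sig_eq0l // !mul0n muln0.
  have m0 : (0 < m)%N by apply: leq_trans im.
  have v := logn_lt m0 mlt.
  rewrite psi_intE ?m0 ?(leq_trans (ltnW mlt)) //.
  have -> : (l - logn p m = (l - k) + (k - logn p m))%N by lia.
  by rewrite expnD; ring.
rewrite psi_intE ?expn_gt0 ?p_gt0 // pfactorK //.
rewrite sig_pX; have -> : (l - k = (l - k.+1).+1)%N by lia.
by rewrite expnS; ring.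
Qed.
End PsiInt.

Section QuotientRelation.
Variables (B : comNzRingType) (lam : B) (q : nat -> B).
Hypothesis D : datum lam q.
Let p_gt0 : (0 < p)%N := prime_gt0 p_pr.
Let p_gt1 : (1 < p)%N := prime_gt1 p_pr.
Let lB := datum_islocal D.

Lemma psi_glaw_coef i j : (0 < i)%N -> (0 < j)%N ->
  glaw_coef lam (fun m => (psi p l lam q)`_m) i j =
  lam ^+ (p ^ l) * ((psi p l lam q)`_i * (psi p l lam q)`_j).
Proof.
move=> i0 j0.
rewrite (@glaw_coef_points _ lam (fun m => (psi p l lam q)`_m) 1 (lam ^+ (p ^ l))).
  by rewrite !(gtn_eqF i0, gtn_eqF j0) !mulr0n addr0 mulr0 add0r.
move=> C g x y nx ny; have DC := datum_rmorph g D.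
have e z : nil z -> ev (g \o (fun m => (psi p l lam q)`_m)) z =
    (psi p l (g lam) (g \o q)).[z].
  by move=> nz; rewrite horner_ev // -psi_map /ev; under [RHS]eq_bigr => m _ do rewrite coef_map.
rewrite !e //; last exact: nil_glaw.
by rewrite psi_hom_nil // rmorph1 mul1r rmorphXn /glaw mulrA.
Qed.

(* The inductive step compares the coefficients of x^(p^k) y^(p^k.+1 - p^k) in
   the identity expressing that psi is a homomorphism. *)
Lemma lam_pow_qx k v : (v <= k <= l)%N ->
  lam ^+ (p ^ k - p ^ v) * qx l q v = (p ^ (k - v))%:R * qx l q k.
Proof.
elim: k v => [|k IH] v /andP[vk kl].
  by move: vk; rewrite leqn0 => /eqP ->; rewrite !subnn expr0.
have step : lam ^+ (p ^ k.+1 - p ^ k) * qx l q k = p%:R * qx l q k.+1.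
  pose theta := lam ^+ (p ^ k.+1 - p ^ k) * qx l q k; rewrite -/theta.
  have pk : (0 < p ^ k)%N by rewrite expn_gt0 p_gt0.
  have kSk : (p ^ k < p ^ k.+1)%N by rewrite ltn_exp2l.
  have kSl : (p ^ k.+1 <= p ^ l)%N by rewrite leq_exp2l.
  pose i := (p ^ k)%N; pose j := (p ^ k.+1 - p ^ k)%N.
  have ij : (i + j = p ^ k.+1)%N by rewrite /i /j subnKC // ltnW.
  have j0 : (0 < j)%N by rewrite subn_gt0.
  have jE : j = (p.-1 * p ^ k)%N by rewrite /j expnS -subn1 mulnBl mul1n.
  have vj : logn p j = k by rewrite jE logn_pred_mul.
  have cE m : (0 < m <= p ^ l)%N -> (psi p l lam q)`_m =
      (psi_int p l m)%:R * lam ^+ (m - p ^ logn p m) * qx l q (logn p m).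
    by move=> ml; rewrite (psi_coef _ p_pr) ml.
  have := psi_glaw_coef pk j0; rewrite /glaw_coef ij big_ord_recr /= subnn expr0 mul1r.
  rewrite cE ?kSl ?expn_gt0 ?p_gt0 // pfactorK // subnn expr0 mulr1.
  rewrite [X in _ * (X * _)]cE ?pk ?(leq_trans (ltnW kSk)) //.
  rewrite [X in _ * (_ * X)]cE ?j0 ?(leq_trans _ kSl) ?leq_subr //.
  rewrite pfactorK // subnn expr0 mulr1 vj.
  rewrite sig_pX.
  have qk : qx l q k * lam ^+ (p ^ l) = (p ^ (l - k))%:R * lam ^+ (p ^ k).
    by rewrite /qx kl (datum_qE D).
  have -> : lam ^+ (p ^ l) * ((psi_int p l (p ^ k))%:R * qx l q k *
      ((psi_int p l j)%:R * lam ^+ (j - p ^ k) * qx l q k)) =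
      theta *+ (p ^ (l - k) * (psi_int p l (p ^ k) * psi_int p l j)).
    rewrite (_ : _ * _ = (psi_int p l (p ^ k))%:R * (psi_int p l j)%:R *
      (qx l q k * lam ^+ (p ^ l)) * lam ^+ (j - p ^ k) * qx l q k); last by ring.
    rewrite qk /theta -[RHS]mulr_natr !natrM -/j.
    have -> : lam ^+ j = lam ^+ (p ^ k) * lam ^+ (j - p ^ k).
      by rewrite -exprD subnKC // jE leq_pmull //; case: (p) p_gt1 => [|[]].
    by ring.
  rewrite -(psi_int_identity kl) mulrnDr -/j.
  have -> : \sum_(m < p ^ k.+1) lam ^+ (p ^ k.+1 - m) * (psi p l lam q)`_m *+ sig (p ^ k) j m
     = theta *+ (\sum_(m < p ^ k.+1) sig (p ^ k) j m * (psi_int p l m * p ^ (k - logn p m))).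
    rewrite -sumrMnr; apply: eq_bigr => -[m /= mlt] _.
    have [mi|im] := ltnP m (p ^ k); first by rewrite sig_eq0l // mul0n !mulr0n.
    have m0 : (0 < m)%N by apply: leq_trans im.
    have v' := logn_lt m0 mlt.
    rewrite mulnC [RHS]mulrnA; congr (_ *+ _).
    rewrite cE ?m0 ?(leq_trans (ltnW mlt)) // mulnC [RHS]mulrnA -[RHS]mulr_natl.
    have pvk : (p ^ logn p m <= p ^ k)%N by rewrite leq_exp2l.
    have vm : (p ^ logn p m <= m)%N by rewrite dvdn_leq // pfactor_dvdnn.
    rewrite -[theta *+ _]mulr_natl /theta [(p ^ _)%:R * _]mulrCA -IH; last by rewrite -ltnS v' ltnW.
    rewrite [lam ^+ _ * (lam ^+ _ * qx l q _)]mulrA -exprD.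
    rewrite (_ : (_ + _ = (p ^ k.+1 - m) + (m - p ^ logn p m))%N); last first.
      by move: (ltnW mlt) (ltnW kSk) pvk vm; clear; lia.
    by rewrite exprD; ring.
  move/addrI; rewrite psi_int_pX // => e.
  have pX h : (0 < p ^ h)%N by rewrite expn_gt0 p_gt0.
  (* The factors left over are binomial coefficients from rows p^e - 1, hence prime to p and
     invertible. *)
  have := @islocal_cancel p p_pr B ('C((p ^ l).-1, (p ^ k.+1).-1) *
    'C((p ^ k.+1).-1, (p ^ k).-1)) theta (p%:R * qx l q k.+1) lB; apply.
    by rewrite coprimeMr !(coprime_bin_pred p_pr) // prednK // ltnW.
  by rewrite -e -[LHS]mulr_natl -[RHS]mulr_natl !natrM; ring.
move: vk; rewrite leq_eqVlt ltnS => /orP[/eqP ->|vk]; first by rewrite !subnn expr0 expn0.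
have pvk : (p ^ v <= p ^ k)%N by rewrite leq_exp2l.
have pkk : (p ^ k <= p ^ k.+1)%N by rewrite leq_exp2l.
rewrite (_ : (_ - _ = (p ^ k.+1 - p ^ k) + (p ^ k - p ^ v))%N); last by move: pvk pkk; clear; lia.
rewrite exprD -mulrA IH ?vk ?(ltnW kl) // mulrCA step subSn // expnS natrM; ring.
Qed.
End QuotientRelation.
End Datum.

(** * The action of psi on Artin-Hasse coordinates *)

Section PowerOfP.
Variables (p l : nat) (p_pr : prime p).
Local Notation W := (witt p_pr).
Let p_gt0 : (0 < p)%N := prime_gt0 p_pr.
Let p_gt1 : (1 < p)%N := prime_gt1 p_pr.

Lemma ghost_nat (C : comNzRingType) k m : ghost p (k%:R : W C) m = k%:R.
Proof.
have g0 : ghost p (0 : W C) m = 0 by rewrite ghost_zero.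
elim: k => [|k IH]; first by rewrite mulr0n g0.
rewrite !mulrS ghostD IH; congr (_ + _).
by rewrite [LHS](ghost_teich p_pr 1) expr1n.
Qed.

Local Notation c := (((p ^ l)%:R : W int) : nat -> int).
Local Notation dvd e a := ((p ^ e)%:Z %| a)%Z.

Lemma dvd_ghost_term (a : int) e m i s : dvd e a -> (s <= e * m + i)%N ->
  dvd s (a ^+ m *+ p ^ i).
Proof.
move=> /dvdzP[d ->] sm; apply/dvdzP.
exists (d ^+ m * (p ^ (e * m + i - s))%:Z).
rewrite exprMn -mulr_natr -!mulrA; congr (_ * _).
by rewrite -[RHS]PoszM -expnD subnK // expnD expnM PoszM -!natz [in RHS]natrX.
Qed.

Lemma pow_comp_sum k : c k *+ p ^ k =
  (p ^ l)%:R - \sum_(i < k) c i ^+ (p ^ (k - i)) *+ p ^ i.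
Proof.
have := ghost_nat int (p ^ l) k; rewrite /ghost big_ord_recr /= subnn expr1 => <-.
by rewrite addrAC subrr add0r.
Qed.

Lemma dvd_cancel s k a : dvd (s + k) (a *+ p ^ k) -> dvd s a.
Proof.
rewrite -mulr_natr natz expnD PoszM dvdz_mul2r //.
by rewrite eqz_nat -lt0n expn_gt0 p_gt0.
Qed.

Lemma dvd1E a : dvd 1 a -> (p%:Z %| a)%Z.
Proof. by rewrite expn1. Qed.

Lemma pow_comp_dvd k : (k <= l)%N -> dvd (l - k) (c k).
Proof.
elim/ltn_ind: k => k IH kl; apply: (@dvd_cancel _ k); rewrite subnK // pow_comp_sum.
rewrite rpredB ?natz //; apply: rpred_sum => -[i /= ik] _.
apply: dvd_ghost_term (IH i ik (ltnW (leq_trans ik kl))) _.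
have : (0 < p ^ (k - i))%N by rewrite expn_gt0 p_gt0.
have := leq_trans ik kl; nia.
Qed.

(** In p^l = Phi_l(c) each term with i < l is divisible by p to the power (l - i) p^(l-i) + i, which
    exceeds l. *)
Lemma pow_comp_l : (p%:Z %| c l - 1)%Z.
Proof.
apply/dvd1E; apply: (@dvd_cancel _ l); rewrite mulrnBl pow_comp_sum addrAC subrr sub0r.
rewrite rpredN; apply: rpred_sum => -[i /= il] _.
apply: dvd_ghost_term (pow_comp_dvd (ltnW il)) _.
have : (l - i < p ^ (l - i))%N by rewrite ltn_expl.
nia.
Qed.

(** In Phi_k(c) = p^l the term p^l c_l^(p^(k-l)) equals p^l modulo p^(k+1), because c_l is 1 modulo
    p; the other terms below k vanish modulo p^(k+1). So modulo p the vector c is the l-th unit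
    vector. *)
Lemma pow_comp_gt k : (l < k)%N -> (p%:Z %| c k)%Z.
Proof.
elim/ltn_ind: k => k IH lk; apply/dvd1E; apply: (@dvd_cancel _ k); rewrite pow_comp_sum.
rewrite (bigD1 (Ordinal lk)) //= opprD addrA rpredB //.
  have [h e] : cong p (c l) 1 by have /dvdzP[h e] := pow_comp_l; exists h; rewrite e -mulr_natr natz.
  have [g] := cong_pow (k - l) (ex_intro _ h e : cong p (c l) 1).
  rewrite expr1n => eg; rewrite -mulrnBl -opprB eg mulNrn -mulrnA rpredN.
  rewrite -mulr_natr dvdz_mull // natz -expnD.
  by rewrite (_ : (1 + k = (k - l).+1 + l)%N) //; lia.
apply: rpred_sum => -[i /= ik] /eqP il.
have {}il : i <> l by move=> e; apply: il; apply: val_inj.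
have ki : (k - i < p ^ (k - i))%N by rewrite ltn_expl.
have [li|li] := ltnP i l.
  by apply: dvd_ghost_term (pow_comp_dvd (ltnW li)) _; nia.
have p1 : dvd 1 (c i) by rewrite expn1 IH //; lia.
by apply: dvd_ghost_term p1 _; nia.
Qed.
End PowerOfP.

(** * Division by lam^(p^l) when lam is a zero divisor *)

Lemma dvdX_mulrn (S : comNzRingType) (P Q : {poly S}) m e : torsion_free S -> (0 < m)%N ->
  P *+ m = Q * 'X^e -> exists P', P = P' * 'X^e.
Proof.
move=> tS m0 h; exists (drop_poly e P); rewrite -{1}[P](poly_take_drop e).
suff -> : take_poly e P = 0 by rewrite add0r.
apply/polyP => i; rewrite coef_take_poly coef0; case: ifP => // ie.
apply: (tS m) => //; have := congr1 (fun u : {poly S} => u`_i) h.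
by rewrite coefMn coefMXn ie mul0rn => ->.
Qed.

Lemma polyX_cancel (S : comNzRingType) (P : {poly S}) e : P * 'X^e = 0 -> P = 0.
Proof.
move=> h; apply/polyP => i; have := congr1 (fun u : {poly S} => u`_(i + e)) h.
by rewrite coefMXn ltnNge leq_addl /= addnK !coef0.
Qed.

Section Graph.
Variables (p n l : nat) (p_pr : prime p) (C : comNzRingType) (lam : C) (q : nat -> C).
Hypothesis D : datum p n l lam q.
Variables (S : comNzRingType) (tS : torsion_free S) (phi : {rmorphism {poly S} -> C}).
Hypothesis phiX : phi 'X = lam.
Let p_gt0 : (0 < p)%N := prime_gt0 p_pr.
Let p_gt1 : (1 < p)%N := prime_gt1 p_pr.
Local Notation mu := (lam ^+ (p ^ l)).

(* The graph of a "division by lam^(p^l)" on the ideal of {poly S} generated by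
   the p^(l-k) X^(p^k), where X specializes to lam; lam^(p^l) may be a zero
   divisor. *)
Definition graph (r : {poly S}) (a : C) : Prop := exists P : nat -> {poly S},
  r = \sum_(k < l.+1) P k * (p ^ (l - k))%:R * 'X^(p ^ k) /\
  a = \sum_(k < l.+1) phi (P k) * qx l q k.

(** All relations between the p^(l-k) X^(p^k) come from consecutive ones. Since S has no torsion,
    the lowest coefficient of a relation is divisible by X^e with e = p^(s+1) - p^s, so its term can
    be moved into the next one; [lam_pow_qx] says that the q_k allow the same move. *)
Lemma graph0_ind d (P : nat -> {poly S}) : (d <= l)%N ->
  \sum_(i < d.+1) P i * (p ^ (d - i))%:R * 'X^(p ^ (l - d + i)) = 0 ->
  \sum_(i < d.+1) phi (P i) * qx l q (l - d + i) = 0.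
Proof.
elim: d P => [|d IH] P dl; rewrite big_ord_recl /=.
  rewrite big_ord0 addr0 expn0 mulr1 => /polyX_cancel P0.
  by rewrite big_ord_recl big_ord0 P0 rmorph0 mul0r addr0.
set s := (l - d.+1)%N; have sE : (l - d = s.+1)%N by rewrite /s; lia.
have pk k : (0 < p ^ k)%N by rewrite expn_gt0 p_gt0.
pose e := (p ^ s.+1 - p ^ s)%N.
have eE : (p ^ s.+1 = e + p ^ s)%N by rewrite /e subnK // leq_exp2l.
rewrite subn0 addn0 => h.
have [P' P'E] : exists P', P 0%N = P' * 'X^e.
  apply: (@dvdX_mulrn _ _ (- \sum_(i < d.+1) P i.+1 * (p ^ (d - i))%:R *
    'X^(p ^ (s.+1 + i) - p ^ s.+1)) (p ^ d.+1)) => //.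
  apply/eqP; rewrite -subr_eq0 mulNr opprK; apply/eqP.
  apply: (@polyX_cancel _ _ (p ^ s)); rewrite -[RHS]h mulrDl -[P 0%N *+ _]mulr_natr.
  congr (_ + _); rewrite !mulr_suml; apply: eq_bigr => i _.
  rewrite subSS -!mulrA -!exprD; congr (_ * (_ * 'X^_)).
  have : (p ^ s.+1 <= p ^ (s.+1 + i))%N by rewrite leq_exp2l // leq_addr.
  have -> : (s + bump 0 i = s.+1 + i)%N by rewrite /bump leq0n addnA addn1.
  by move: eE; clear; lia.
have := IH (fun i => P i.+1 + P' * p%:R *+ (i == 0)%N) (ltnW dl); rewrite sE.
rewrite !big_ord_recl /= => IH'.
have qx_step : lam ^+ e * qx l q s = p%:R * qx l q s.+1.
  by rewrite (lam_pow_qx p_pr D) ?leqnSn ?subSnn ?expn1 //= /s; lia.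
have bE i : (s + bump 0 (bump 0 i) = s.+1 + bump 0 i)%N.
  by rewrite {1}/bump leq0n addnA addn1.
rewrite -[RHS]IH' -/(bump 0 0).
  rewrite addrA mulr1n addn0 [bump 0 0]/= addn1 addn0; congr (_ + _).
    by rewrite P'E rmorphD !rmorphM rmorph_nat rmorphXn phiX -mulrA qx_step; ring.
  by apply: eq_bigr => i _; rewrite mulr0n addr0 bE.
rewrite -[RHS]h big_ord_recl /= addrA; congr (_ + _); last first.
  apply: eq_bigr => i _; rewrite mulr0n addr0 bE.
  by rewrite [bump 0 (bump 0 i)]/bump leq0n add1n subSS.
rewrite P'E mulr1n addn0 subn0 [bump 0 0]/= addn1 subSS subn0 eE exprD expnS natrM.
ring.
Qed.

Lemma graph0 a : graph 0 a -> a = 0.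
Proof.
case=> P [r0 ->]; have := @graph0_ind l P (leqnn l); rewrite subnn; apply.
by rewrite [RHS]r0.
Qed.

Lemma graph_phi r a : graph r a -> phi r = mu * a.
Proof.
case=> P [-> ->]; rewrite rmorph_sum mulr_sumr; apply: eq_bigr => -[k /= kl] _.
rewrite !(rmorphM phi) (rmorph_nat phi) (rmorphXn phi) phiX -mulrA [RHS]mulrCA; congr (_ * _).
rewrite /qx; move: kl; rewrite ltnS leq_eqVlt => /orP[/eqP ->|kl].
  by rewrite ltnn subnn expn0 mul1r mulr1.
by rewrite kl [RHS]mulrC (datum_qE D).
Qed.

Lemma graph_zero : graph 0 0.
Proof.
by exists (fun=> 0); split; rewrite big1 // => k _; rewrite ?rmorph0 !mul0r.
Qed.

Lemma graphD r a r' a' : graph r a -> graph r' a' -> graph (r + r') (a + a').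
Proof.
move=> [P [-> ->]] [P' [-> ->]]; exists (fun k => P k + P' k).
rewrite -!big_split; split; apply: eq_bigr => k _ /=; first by rewrite !mulrDl.
by rewrite rmorphD mulrDl.
Qed.

Lemma graphZ s r a : graph r a -> graph (s * r) (phi s * a).
Proof.
move=> [P [-> ->]]; exists (fun k => s * P k); rewrite !mulr_sumr.
by split; apply: eq_bigr => k _; rewrite ?rmorphM !mulrA.
Qed.

Lemma graph_gen k s : (k <= l)%N ->
  graph (s * (p ^ (l - k))%:R * 'X^(p ^ k)) (phi s * qx l q k).
Proof.
move=> kl; exists (fun i => if i == k then s else 0).
by split; rewrite (bigD1 (Ordinal (kl : (k < l.+1)%N))) //= eqxx big1 ?addr0 //
  => i /negPf; rewrite -val_eqE /= => ->; rewrite ?rmorph0 !mul0r.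
Qed.

Lemma graph_fun r a a' : graph r a -> graph r a' -> a = a'.
Proof.
move=> h /(graphZ (-1)); rewrite mulN1r rmorphN1 mulN1r => /(graphD h).
by rewrite subrr => /graph0/eqP; rewrite subr_eq0 => /eqP.
Qed.

Lemma graph_sum (I : Type) (s : seq I) (P : pred I) (F : I -> {poly S}) (G : I -> C) :
  (forall i, P i -> graph (F i) (G i)) ->
  graph (\sum_(i <- s | P i) F i) (\sum_(i <- s | P i) G i).
Proof.
move=> h; apply: (big_ind2 graph) => //; first exact: graph_zero.
by move=> *; exact: graphD.
Qed.

Lemma graph_exp r a i : graph r a -> graph (r ^+ i.+1) (mu ^+ i * a ^+ i.+1).
Proof.
move=> h; elim: i => [|i IH]; first by rewrite expr0 mul1r.
rewrite exprS; have -> : mu ^+ i.+1 * a ^+ i.+2 = phi r * (mu ^+ i * a ^+ i.+1).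
  by rewrite (graph_phi h) !exprS; ring.
exact: graphZ.
Qed.

Lemma graph_glaw r a r' a' : graph r a -> graph r' a' ->
  graph ((1 + r) * (1 + r') - 1) (glaw mu a a').
Proof.
move=> h h'; rewrite (_ : _ - 1 = r + r' + r * r'); last by ring.
rewrite /glaw -(graph_phi h); apply: graphD; first exact: graphD.
exact: graphZ.
Qed.

Hypothesis lS : islocal p S.

Lemma graph_kap r a : nil r -> nil a -> graph r a ->
  graph (AH p_pr r - 1) (kap p_pr mu a).
Proof.
move=> [m e] [m' e'] h; have lP : islocal p {poly S} := islocal_rmorphism polyC lS.
have lC := datum_islocal p_pr D.
have r0 : r ^+ (m + m').+1 = 0 by apply: exp_nil_leq e _; lia.
have a0 : a ^+ (m + m').+1 = 0 by apply: exp_nil_leq e' _; lia.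
rewrite /AH /kap (evE _ r0) (evE _ a0) !big_ord_recl /= (ahP p_pr lP).1 !expr0 mul1r.
rewrite mul0r add0r [1 + _]addrC addrK; apply: graph_sum => i _.
rewrite /bump leq0n add1n /=; have -> : ah p_pr C i.+1 = phi (ah p_pr {poly S} i.+1).
  by rewrite (ah_rmorph _ _ _ lP).
rewrite -mulrA; exact/graphZ/graph_exp.
Qed.

End Graph.

Lemma trunc_tf M (R : comNzRingType) : torsion_free R -> torsion_free (trunc M R).
Proof.
move=> tR n f g n0 e; apply: trunc_eq => i iM; apply: (tR n) => //.
have cM (u : trunc M R) k : (u *+ k : {poly R})`_i = (u : {poly R})`_i *+ k.
  by elim: k => [|k IH]; rewrite ?mulr0n ?coef0 // !mulrS coefD IH.
by rewrite -!cM e.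
Qed.

Lemma nil_cover p (C : comNzRingType) (x : C) : islocal p C -> nil x ->
  exists (S : comNzRingType) (t : S) (g : {rmorphism S -> C}),
  [/\ torsion_free S, islocal p S, nil t & g t = x].
Proof.
case=> f _ [M e]; have e' : x ^+ M.+1 = 0 by rewrite exprS e mulr0.
have [g [gx _]] := trunc_lift f e'.
exists (trunc M (zloc p)), (tX M (zloc p)), g; split=> //.
- exact/trunc_tf/zloc_tf.
- apply: (islocal_rmorphism (tC M (zloc p))).
  by exists idfun.
- exact: tX_isnil.
Qed.

Fixpoint gsum (C : comNzRingType) (mu : C) (f : nat -> C) N : C :=
  if N is N'.+1 then glaw mu (gsum mu f N') (f N') else 0.

Lemma gsum_stable (C : comNzRingType) (mu : C) (f : nat -> C) m N :
  (forall k, (m <= k)%N -> f k = 0) -> gsum mu f (m + N) = gsum mu f m.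
Proof.
move=> f0; elim: N => [|N IH]; first by rewrite addn0.
by rewrite addnS /= IH f0 ?leq_addr // /glaw mulr0 !addr0.
Qed.

Lemma kap0 p (p_pr : prime p) (C : comNzRingType) (mu : C) : kap p_pr mu 0 = 0.
Proof. by rewrite /kap (@evE _ _ _ 1) ?expr1 // big_ord1 mul0r. Qed.

Section PsiKap.
Variables (p n l : nat) (p_pr : prime p).
Local Notation W := (witt p_pr).

Lemma E_mulrn (C : comNzRingType) (lC : islocal p C) (w : W C) x m : nil x ->
  E (w *+ m) x = E w x ^+ m.
Proof.
move=> nx; elim: m => [|m IH]; first by rewrite mulr0n E0.
by rewrite mulrS (E_add lC) // IH exprS.
Qed.

Variables (C : comNzRingType) (lam : C) (q : nat -> C).
Hypothesis D : datum p n l lam q.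
Local Notation mu := (lam ^+ (p ^ l)).
Local Notation c := (((p ^ l)%:R : W int) : nat -> int).

Lemma nil_avec x k : nil x -> nil (avec l p_pr lam q k * x ^+ (p ^ k)).
Proof. by move=> nx; apply/nil_mull/nil_exp => //; rewrite expn_gt0 (prime_gt0 p_pr). Qed.

Section Cover.
Variables (S : comNzRingType) (tS : torsion_free S) (lS : islocal p S) (t : S).
Variables (phi : {rmorphism {poly S} -> C}) (x : C).
Hypotheses (nt : nil t) (phiX : phi 'X = lam) (phit : phi t%:P = x).
Local Notation graph := (graph p l q phi).
Let p_gt0 : (0 < p)%N := prime_gt0 p_pr.
Let p_gt1 : (1 < p)%N := prime_gt1 p_pr.
Let lP : islocal p {poly S} := islocal_rmorphism polyC lS.
Let ntP : nil (t%:P : {poly S}) := nil_rmorph polyC nt.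
Let nx : nil x. Proof. by rewrite -phit; exact: nil_rmorph. Qed.

Lemma graph_psi :
  graph (AH p_pr ('X * t%:P) ^+ (p ^ l) - 1) (psi p l lam q).[kap p_pr lam x].
Proof.
rewrite AH_kap //; set k0 := kap _ _ _.
have k0E : phi k0 = kap p_pr lam x by rewrite (kap_rmorph p_pr lP) // phiX phit.
rewrite exprDn (@horner_coef_wide _ (p ^ l).+1); last first.
  by rewrite (size_psi p l lam q).1.
rewrite !big_ord_recl /= (psi_coef _ p_pr) ltnn /= mul0r add0r.
rewrite expr0 !expr1n mulr1 bin0 mulr1n addrAC subrr add0r.
apply: graph_sum => -[m /= mlt] _; rewrite /bump leq0n add1n expr1n mul1r.
have ml : (0 < m.+1 <= p ^ l)%N by [].
have [vl _] := bin_pfactor p_pr (ltn0Sn m) mlt.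
rewrite (psi_coef _ p_pr) ml (psi_intE p_pr ml); set v := logn p m.+1.
have vm : (p ^ v <= m.+1)%N by rewrite dvdn_leq // pfactor_dvdnn.
have := @graph_gen p l C q S phi v
  ((psi_int p l m.+1)%:R * 'X^(m.+1 - p ^ v) * k0 ^+ m.+1) vl.
rewrite !(rmorphM phi) (rmorph_nat phi) !(rmorphXn phi) phiX k0E.
set r := (X in graph X _); set a := (X in graph _ X).
have -> : r = ('X * k0) ^+ m.+1 *+ (p ^ (l - v) * psi_int p l m.+1).
  have -> : ('X * k0) ^+ m.+1 = 'X^(m.+1 - p ^ v) * 'X^(p ^ v) * k0 ^+ m.+1.
    by rewrite exprMn -exprD subnK.
  by rewrite -[RHS]mulr_natr natrM /r; ring.
suff -> : a = (psi_int p l m.+1)%:R * lam ^+ (m.+1 - p ^ v) * qx l q v * kap p_pr lam x ^+ m.+1 by [].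
by rewrite /a; ring.
Qed.

Lemma graph_avec k : graph ('X^(p ^ k) * (c k)%:~R * t%:P ^+ (p ^ k))
  (avec l p_pr lam q k * x ^+ (p ^ k)).
Proof.
rewrite /avec /=; case: ltnP => kl.
  have /dvdzP[d dE] := pow_comp_dvd p_pr (ltnW kl).
  have := @graph_gen p l C q S phi k (d%:~R * t%:P ^+ (p ^ k)) (ltnW kl).
  rewrite !(rmorphM phi) (rmorph_int phi) !(rmorphXn phi) phit /qx kl.
  rewrite dE mulzK ?eqz_nat -?lt0n ?expn_gt0 ?p_gt0 // intrM.
  by rewrite -pmulrn => h; congr (graph _ _): h; ring.
have pkl : (p ^ l <= p ^ k)%N by rewrite leq_exp2l.
have := @graph_gen p l C q S phi l ((c k)%:~R * 'X^(p ^ k - p ^ l) * t%:P ^+ (p ^ k)) (leqnn l).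
rewrite !(rmorphM phi) (rmorph_int phi) !(rmorphXn phi) phit phiX /qx ltnn subnn expn0 !mulr1.
rewrite mulrAC -[_ * 'X^(p ^ k - p ^ l) * 'X^_]mulrA -exprD subnK //.
by rewrite [(c k)%:~R * 'X^_]mulrC.
Qed.

Lemma AH_exp_prod m : t ^+ m = 0 -> AH p_pr ('X * t%:P) ^+ (p ^ l) =
  \prod_(k < m) AH p_pr ('X^(p ^ k) * (c k)%:~R * t%:P ^+ (p ^ k)).
Proof.
move=> tm; rewrite -(@E_teich _ p_pr _ lP) // -E_mulrn // (@EE _ p_pr _ lP _ _ m).
  apply: eq_bigr => k _; congr (AH p_pr (_ * _)).
  rewrite -[teich _ _ *+ _]mulr_natr teichM_comp; congr (_ * _).
  by rewrite -(rmorph_nat (wmap (intr : int -> {poly S}))).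
by rewrite -rmorphXn tm rmorph0.
Qed.

Lemma graph_gsum N :
  graph (\prod_(k < N) AH p_pr ('X^(p ^ k) * (c k)%:~R * t%:P ^+ (p ^ k)) - 1)
    (gsum mu (fun k => kap p_pr mu (avec l p_pr lam q k * x ^+ (p ^ k))) N).
Proof.
elim: N => [|N IH]; first by rewrite big_ord0 subrr; exact: graph_zero.
rewrite big_ord_recr /=; set r := \prod_(k < N) _ in IH *; set r' := AH _ _.
rewrite (_ : r * r' = (1 + (r - 1)) * (1 + (r' - 1))); last by ring.
apply: (graph_glaw D phiX IH); apply: (graph_kap p_pr D phiX lS).
- by apply/nil_mull/nil_exp => //; rewrite expn_gt0 p_gt0.
- exact: nil_avec.
- exact: graph_avec.
Qed.
End Cover.

(* Both sides are lam^(-p^l) (AH(lam x)^(p^l) - 1), computed in the graph over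
   a ring where lam is an indeterminate. *)
Lemma psi_kap x m : x ^+ m = 0 -> (psi p l lam q).[kap p_pr lam x] =
  gsum mu (fun k => kap p_pr mu (avec l p_pr lam q k * x ^+ (p ^ k))) m.
Proof.
move=> xm; have nx : nil x by exists m.
have lC := datum_islocal p_pr D.
have [S [t [g [tS lS nt gt]]]] := nil_cover lC nx.
pose phi : {rmorphism {poly S} -> C} := horner_eval lam \o map_poly g.
have phiX : phi 'X = lam by rewrite /phi /= map_polyX /horner_eval hornerX.
have phit : phi t%:P = x by rewrite /phi /= map_polyC /horner_eval hornerC.
(* The lift t of x may need a higher exponent than m; the additional summands vanish in C. *)
have [N tN] := nt; have tmN : t ^+ (m + N) = 0 by rewrite exprD tN mulr0.
have h := graph_gsum lS nt phiX phit (m + N).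
rewrite -(AH_exp_prod lS nt tmN) in h.
have -> := graph_fun p_pr D tS phiX (graph_psi lS nt phiX phit) h.
apply: gsum_stable => k mk; rewrite (expp_nil p_pr xm) // mulr0; exact: kap0.
Qed.
End PsiKap.

(** * Homomorphisms trivial on the kernel of psi *)

(** The quotient is hidden behind its universal property because such extensions are iterated
    below. *)
Lemma adjoin_root (C : comNzRingType) (h : {poly C}) (d := (size h).-1) :
  h \is monic -> (1 < size h)%N ->
  exists (C' : comNzRingType) (j : {rmorphism C -> C'}) (X : C'),
  [/\ (map_poly j h).[X] = 0,
      forall b : nat -> C, \sum_(i < d) j (b i) * X ^+ i = 0 ->
        forall i, (i < d)%N -> b i = 0,
      forall y, exists b : nat -> C, y = \sum_(i < d) j (b i) * X ^+ i &
      forall (C2 : comNzRingType) (f : {rmorphism C -> C2}) x, (map_poly f h).[x] = 0 ->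
        exists k : {rmorphism C' -> C2}, k X = x /\ forall c, k (j c) = f c].
Proof.
move=> hm hs; exists {poly %/ h}, (qpolyC h), (qpolyX h); split.
- exact: qpolyX_root.
- move=> b e i id; have := qpoly_coef_sum hm hs b id.
  by rewrite -/d e coef0.
- move=> y; exists (fun i => (y : {poly C})`_i).
  rewrite -{1}[y]in_qpoly_val (in_qpoly_sum hm hs).
  have yd : (size (y : {poly C}) <= d)%N by rewrite /d -{2}(mk_monicE hm hs); exact: size_npoly.
  rewrite [RHS](bigID (fun i : 'I_d => (i < size (y : {poly C}))%N)) /= [X in _ + X]big1.
    by rewrite addr0 (big_ord_widen _ (fun i => qpolyC h (y : {poly C})`_i * qpolyX h ^+ i) yd).
  by move=> i; rewrite -leqNgt => le; rewrite nth_default // rmorph0 mul0r.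
- move=> C2 f x fx; have [k kE] := qpoly_lift hm hs fx; exists k; split.
    by rewrite /qpolyX kE map_polyX hornerX.
  by move=> c; rewrite /= (qpolyC_in hm hs) kE map_polyC hornerC.
Qed.

Section PsiRoots.
Variables (p n l : nat) (p_pr : prime p).
Let p_gt0 : (0 < p)%N := prime_gt0 p_pr.
Let p_gt1 : (1 < p)%N := prime_gt1 p_pr.

Lemma psi_subC_size (C : comNzRingType) (lam : C) q (s : C) (h := psi p l lam q - s%:P) :
  [/\ h \is monic, (1 < size h)%N & (size h).-1 = (p ^ l)%N].
Proof.
have [sz mn] := size_psi p l lam q; have pl : (0 < p ^ l)%N by rewrite expn_gt0 p_gt0.
have lt : (size (- s%:P) < size (psi p l lam q))%N.
  by rewrite size_polyN sz (leq_ltn_trans (size_polyC_leq1 _)).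
have e : size h = (p ^ l).+1 by rewrite /h size_polyDl.
by split; rewrite ?e //; rewrite monicE /h lead_coefDl // -monicE.
Qed.

(** The coefficients of psi below the leading one are multiples of the q_k, so psi(T) and T^(p^l)
    differ by a nilpotent element. This puts the points of N_l into the domain of chi. *)
Lemma psi_nil (C : comNzRingType) (lam : C) q T : datum p n l lam q ->
  nil (psi p l lam q).[T] -> nil T.
Proof.
move=> D [m e]; suff : nil (T ^+ (p ^ l)) by case=> k; rewrite -exprM; exists (p ^ l * k)%N.
rewrite (_ : T ^+ _ = (psi p l lam q).[T] + - ((psi p l lam q).[T] - T ^+ (p ^ l))); last by ring.
apply: nilD; first by exists m.
rewrite -mulN1r; apply: nil_mull; rewrite /psi hornerD hornerXn addrAC subrr add0r.
rewrite horner_sum big_nat_cond; apply: nil_sum => j /andP[/andP[j0 jl] _].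
rewrite hornerZ; apply: nil_mulr; apply: nil_mull; apply: (datum_nil D).
exact: (logn_lt p_pr).
Qed.

Lemma psi0_nil (C : comNzRingType) (lam : C) q T : nil T -> nil (psi p l lam q).[T].
Proof.
have pl : (0 < p ^ l)%N by rewrite expn_gt0 p_gt0.
move=> nT; rewrite /psi hornerD hornerXn; apply: nilD; first exact: nil_exp.
rewrite horner_sum big_nat_cond; apply: nil_sum => j /andP[/andP[j0 jl] _].
by rewrite hornerZ hornerXn; apply/nil_mull/nil_exp.
Qed.

Lemma psi0 (C : comNzRingType) (lam : C) q : (psi p l lam q).[0] = 0.
Proof. by rewrite horner_coef0 (psi_coef _ p_pr). Qed.
End PsiRoots.

Section Descent.
Variables (p n l : nat) (p_pr : prime p).
Local Notation W := (witt p_pr).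
Variables (B : comNzRingType) (lam : B) (q : nat -> B).
Hypothesis D : datum p n l lam q.
Let lB : islocal p B := datum_islocal p_pr D.
Let p_gt0 : (0 < p)%N := prime_gt0 p_pr.
Let p_gt1 : (1 < p)%N := prime_gt1 p_pr.
Let pl_gt0 : (0 < p ^ l)%N. Proof. by rewrite expn_gt0 p_gt0. Qed.

Definition chi_at (x : W B) (C : comNzRingType) (g : {rmorphism B -> C}) (T : C) : C :=
  chi (islocal_rmorphism g lB) (g lam) (wmap g x) T.

Definition psi_at (C : comNzRingType) (g : {rmorphism B -> C}) : {poly C} :=
  psi p l (g lam) (g \o q).

Lemma chi_at_nat x (C C' : comNzRingType) (g : {rmorphism B -> C})
  (g' : {rmorphism B -> C'}) (h : {rmorphism C -> C'}) T :
  (forall c, h (g c) = g' c) -> nil T -> h (chi_at x g T) = chi_at x g' (h T).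
Proof.
move=> e nT; rewrite /chi_at.
rewrite (chi_rmorph _ (islocal_rmorphism g' lB)) // e.
by congr (chi _ _ _ _); apply: wittP => k /=.
Qed.

Lemma map_psi_at (C C' : comNzRingType) (g : {rmorphism B -> C})
  (g' : {rmorphism B -> C'}) (h : {rmorphism C -> C'}) :
  (forall c, h (g c) = g' c) -> map_poly h (psi_at g) = psi_at g'.
Proof.
move=> e; rewrite /psi_at psi_map e; congr psi; apply/funext => k /=; exact: e.
Qed.

Lemma psi_at_nil (C : comNzRingType) (g : {rmorphism B -> C}) T :
  nil (psi_at g).[T] -> nil T.
Proof. exact/psi_nil/datum_rmorph/D. Qed.

Lemma psi_at_glaw (C : comNzRingType) (g : {rmorphism B -> C}) S T : nil S -> nil T ->
  (psi_at g).[glaw (g lam) S T] =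
  glaw (g (lam ^+ (p ^ l))) (psi_at g).[S] (psi_at g).[T].
Proof. by move=> nS nT; rewrite rmorphXn; exact/psi_hom_nil/nT/nS/datum_rmorph/D. Qed.

(** Surjectivity of psi on nilpotent points up to a free extension of rank p^l; being free, the
    extension is injective, so identities proved there descend. *)
Lemma nil_image_psi (C : comNzRingType) (g : {rmorphism B -> C}) (s : C) : nil s ->
  exists (C' : comNzRingType) (j : {rmorphism C -> C'}) (X : C'),
  [/\ (psi_at (j \o g)).[X] = j s, injective j,
      forall b : nat -> C, \sum_(i < p ^ l) j (b i) * X ^+ i = 0 ->
        forall i, (i < p ^ l)%N -> b i = 0,
      forall y, exists b : nat -> C, y = \sum_(i < p ^ l) j (b i) * X ^+ i &
      forall (C2 : comNzRingType) (f : {rmorphism C -> C2}) x,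
        (psi_at (f \o g)).[x] = f s ->
        exists k : {rmorphism C' -> C2}, k X = x /\ forall c, k (j c) = f c].
Proof.
move=> ns; have [hm hs hd] := psi_subC_size l p_pr (g lam) (g \o q) s.
have [C' [j [X [X0 basis gen lift]]]] := adjoin_root hm hs.
have mapE (C2 : comNzRingType) (f : {rmorphism C -> C2}) x :
    (map_poly f (psi p l (g lam) (g \o q) - s%:P)).[x] = (psi_at (f \o g)).[x] - f s.
  by rewrite rmorphB /= map_polyC hornerD hornerN hornerC -(@map_psi_at _ _ g (f \o g) f).
rewrite hd in basis gen; exists C', j, X; split=> //.
- by apply/eqP; rewrite -subr_eq0 -mapE X0.
- move=> a b e; apply/eqP; rewrite -subr_eq0; apply/eqP.
  apply: (basis (fun i => if i is 0%N then a - b else 0) _ 0%N pl_gt0).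
  by rewrite big1 // => -[[|i] il] _ /=; rewrite ?rmorph0 ?rmorphB ?e ?subrr mul0r.
- by move=> C2 f x fx; apply: lift; rewrite mapE fx subrr.
Qed.

Variable (x : W B).
Hypothesis Fx : Flam lam x = 0.
Hypothesis chi_ker : forall (C : comNzRingType) (g : {rmorphism B -> C}) T,
  (psi_at g).[T] = 0 -> chi_at x g T = 1.

Lemma chi_at_hom (C : comNzRingType) (g : {rmorphism B -> C}) S T : nil S -> nil T ->
  chi_at x g (glaw (g lam) S T) = chi_at x g S * chi_at x g T.
Proof. by move=> nS nT; apply: chi_hom => //; rewrite -Flam_rmorph Fx wmap0. Qed.

(* If psi N = 0 then chi (glaw X N) = chi X; writing chi X = sum_m b_m X^m, the
   coefficient of X^0 N^m in this identity is b_m, for m > 0. *)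
Lemma chi_at_const (C : comNzRingType) (g : {rmorphism B -> C}) (s : C) : nil s ->
  exists (C' : comNzRingType) (j : {rmorphism C -> C'}) (X : C') (b : C),
  [/\ (psi_at (j \o g)).[X] = j s, injective j, chi_at x (j \o g) X = j b &
      forall (C2 : comNzRingType) (f : {rmorphism C -> C2}) y,
        (psi_at (f \o g)).[y] = f s ->
        exists k : {rmorphism C' -> C2}, k X = y /\ forall c, k (j c) = f c].
Proof.
move=> ns; have [C' [j [X [Xs inj_j basis gen lift]]]] := nil_image_psi g ns.
have [b bE] := gen (chi_at x (j \o g) X).
suff bi m0 : (0 < m0 < p ^ l)%N -> b m0 = 0.
  exists C', j, X, (b 0%N); split=> //; rewrite bE.
  rewrite (bigD1 (Ordinal pl_gt0)) //= expr0 mulr1 big1 ?addr0 // => i i0.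
  by rewrite bi ?rmorph0 ?mul0r // ltn_ord lt0n andbT.
have nX : nil X by apply: (@psi_at_nil _ (j \o g)); rewrite Xs; exact: nil_rmorph.
have n0 : nil (0 : C') by exists 1%N; rewrite expr1.
have [C'' [j2 [N [N0 _ basis2 _ _]]]] := nil_image_psi (j \o g) n0.
move: N0; rewrite rmorph0; set g2 := j2 \o (j \o g) => N0.
have nN : nil N by apply: (@psi_at_nil _ g2); rewrite N0; exists 1%N; rewrite expr1.
have nX2 : nil (j2 X) := nil_rmorph j2 nX.
have psiX2 : (psi_at g2).[j2 X] = j2 (j s).
  by rewrite -Xs -horner_map (@map_psi_at _ _ (j \o g) g2 j2).
pose S := glaw (g2 lam) (j2 X) N.
have psiS : (psi_at g2).[S] = (j2 \o j) s.
  by rewrite psi_at_glaw // N0 psiX2 /glaw mulr0 !addr0.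
(* As N is a root of psi, S lies over s just as X does, so the universal property specializes X to
   S. *)
have [k [kX kj]] := lift _ (j2 \o j) S psiS.
have e1 : k (chi_at x (j \o g) X) = chi_at x g2 S.
  by rewrite (@chi_at_nat _ _ _ _ g2) ?kX // => c; rewrite kj.
have e2 : chi_at x g2 S = j2 (chi_at x (j \o g) X).
  by rewrite chi_at_hom // (chi_ker N0) mulr1 (@chi_at_nat _ _ _ _ g2).
pose c i m : C := \sum_(r < p ^ l) g lam ^+ (i + m - r) * b r *+ sig i m r.
have e3 : chi_at x g2 S = \sum_(m < p ^ l)
    j2 (\sum_(i < p ^ l) j (c i m) * X ^+ i) * N ^+ m.
  rewrite -e1 bE rmorph_sum.
  rewrite (eq_bigr (fun i : 'I_(p ^ l) => j2 (j (b i)) * S ^+ i)) => [|i _]; last first.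
    by rewrite rmorphM rmorphXn kX kj.
  rewrite (poly_glaw (g2 lam) (j2 X) N (fun i => j2 (j (b i)))) exchange_big /=.
  apply: eq_bigr => m _; rewrite rmorph_sum mulr_suml; apply: eq_bigr => i _.
  rewrite rmorphM rmorphXn; congr (_ * _ * _).
  rewrite !rmorph_sum; apply: eq_bigr => r _.
  by rewrite !rmorphMn !rmorphM !rmorphXn.
move=> /andP[m0_gt0 m0l].
have e4 : \sum_(m' < p ^ l) j2 ((\sum_(i < p ^ l) j (c i m') * X ^+ i)
    - (if m' == 0%N :> nat then chi_at x (j \o g) X else 0)) * N ^+ m' = 0.
  under eq_bigr => m' _ do rewrite rmorphB mulrBl.
  rewrite sumrB -e3 e2 (bigD1 (Ordinal pl_gt0)) //= expr0 mulr1 big1 ?addr0 ?subrr //.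
  by move=> i /negPf; rewrite -val_eqE /= => ->; rewrite rmorph0 mul0r.
have := basis2 (fun m' => \sum_(i < p ^ l) j (c i m') * X ^+ i
    - (if m' == 0%N then chi_at x (j \o g) X else 0)) e4 _ m0l.
rewrite gtn_eqF // subr0 => /(basis (c^~ m0)) /(_ 0%N pl_gt0) <-.
rewrite /c (bigD1 (Ordinal m0l)) //= big1 ?addr0 => [|r].
  by rewrite add0n subnn expr0 mul1r /sig add0n leqnn binn subnn bin0 mulr1n.
rewrite -val_eqE /= => rm0; case: (ltngtP r m0) rm0 => // rm _.
  by rewrite sig_eq0r.
by rewrite sig_eq0.
Qed.
(** Every T with psi(T)^(M+1) = 0 is a specialization of one root X of psi = t over B[t]/t^(M+1).
    There chi is constant along the fibre, and the coefficients of that constant serve all T. *)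
Lemma chi_at_trunc M : exists b : trunc M B,
  forall (C : comNzRingType) (g : {rmorphism B -> C}) T, (psi_at g).[T] ^+ M.+1 = 0 ->
  chi_at x g T = \sum_(k < M.+1) g ((b : {poly B})`_k) * (psi_at g).[T] ^+ k.
Proof.
have [C' [j [X [b [Xs _ bE lift]]]]] := chi_at_const (tC M B) (tX_isnil M B).
exists b => C g T pT0; have [f [fX fC]] := trunc_lift g pT0.
have [|k [kX kj]] := lift _ f T.
  by rewrite fX; congr (_.[_]); rewrite /psi_at; congr psi; [|apply/funext => i]; rewrite /= fC.
have nX : nil X.
  by apply: (@psi_at_nil _ (j \o tC M B)); rewrite Xs; exact/nil_rmorph/tX_isnil.
rewrite -kX -(@chi_at_nat _ _ _ (j \o tC M B) g k) ?bE ?kj //; last first.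
  by move=> c /=; rewrite kj fC.
rewrite kX {1}[b]trunc_sum rmorph_sum; apply: eq_bigr => i _.
by rewrite rmorphM rmorphXn fX fC.
Qed.

Lemma chi_at_series : exists H : nat -> B,
  forall (C : comNzRingType) (g : {rmorphism B -> C}) T, nil T ->
  chi_at x g T = ev (g \o H) (psi_at g).[T].
Proof.
pose b M := projT1 (cid (chi_at_trunc M)); have bP M := projT2 (cid (chi_at_trunc M)).
(* Expansions of different lengths agree where both are defined, as the root for t^(k+1) = 0 shows;
   so the diagonal gives one series. *)
exists (fun i => (b i : {poly B})`_i) => C g T nT.
have [M e] := psi0_nil l p_pr (g lam) (g \o q) nT.
have e1 : (psi_at g).[T] ^+ M.+1 = 0 by rewrite exprS e mulr0.
rewrite (bP M) // (evE _ e1); apply: eq_bigr => -[k /= kM] _; congr (g _ * _).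
have nt := tX_isnil k B.
have [C' [j [X [_ [Xs inj_j _ _]]]]] := chi_at_const (tC k B) nt.
have Xk m : (k <= m)%N -> (psi_at (j \o tC k B)).[X] ^+ m.+1 = 0.
  by move=> km; rewrite Xs -rmorphXn (exp_nil_leq (tX_nil k B)) ?rmorph0.
have := bP k _ (j \o tC k B) X (Xk k (leqnn k)).
rewrite (bP M _ (j \o tC k B) X (Xk M kM)) Xs -/(b k) -/(b M).
have jE m (u : nat -> B) : \sum_(i < m) (j \o tC k B) (u i) * j (tX k B) ^+ i =
    j (\sum_(i < m) tC k B (u i) * tX k B ^+ i).
  by rewrite rmorph_sum; apply: eq_bigr => i _; rewrite rmorphM rmorphXn.
rewrite (jE _ (fun i => (b M : {poly B})`_i)) (jE _ (fun i => (b k : {poly B})`_i)).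
move/inj_j/(congr1 (fun u : trunc k B => (u : {poly B})`_k)).
have cE m (u : nat -> B) : (k < m)%N ->
    (\sum_(i < m) tC k B (u i) * tX k B ^+ i : {poly B})`_k = u k.
  move=> km; rewrite poly_of_qpoly_sum coef_sum.
  rewrite (bigD1 (Ordinal km)) //= coef_tCX // eqxx big1 ?addr0 // => i.
  by rewrite -val_eqE /= coef_tCX // eq_sym => /negPf ->.
by rewrite (cE _ (fun i => (b M : {poly B})`_i)) ?(cE _ (fun i => (b k : {poly B})`_i)).
Qed.

Lemma chi_at0 (C : comNzRingType) (g : {rmorphism B -> C}) : chi_at x g 0 = 1.
Proof. by apply: chi_ker; exact: psi0. Qed.

(** Two successive extensions turn s and t into psi(X) and psi(Y). Multiplicativity of chi at X and
    Y becomes that of H at s and t, and descends by injectivity. *)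
Lemma chi_at_ishom : exists H : nat -> B, ishom (lam ^+ (p ^ l)) H /\
  forall (C : comNzRingType) (g : {rmorphism B -> C}) T, nil T ->
  chi_at x g T = ev (g \o H) (psi_at g).[T].
Proof.
have [H HE] := chi_at_series; exists H; split=> //.
have n0 (C : comNzRingType) : nil (0 : C) by exists 1%N; rewrite expr1.
split.
  have := HE B idfun 0 (n0 _); rewrite chi_at0 /psi_at psi0 //.
  by rewrite (@evE _ _ _ 1) ?expr1 // big_ord1 expr0 mulr1 => ->.
move=> i j; have := @glaw_coef_points B (lam ^+ (p ^ l)) H 0 1 _ i j.
rewrite mul0r add0r mul1r => <- // C g s t ns nt.
rewrite rmorph0 mul0r add0r rmorph1 mul1r.
have [C1 [j1 [X [Xs inj1 _ _ _]]]] := nil_image_psi g ns.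
have nt1 := nil_rmorph j1 nt.
have [C2 [j2 [Y [Yt inj2 _ _ _]]]] := nil_image_psi (j1 \o g) nt1.
have nX : nil X by apply: (@psi_at_nil _ (j1 \o g)); rewrite Xs; exact: nil_rmorph.
apply: (inj_comp inj2 inj1); set g2 := j2 \o (j1 \o g) in Yt *.
have nY : nil Y by apply: (@psi_at_nil _ g2); rewrite Yt; exact: nil_rmorph.
have nX2 := nil_rmorph j2 nX.
have psiX2 : (psi_at g2).[j2 X] = j2 (j1 s).
  by rewrite -Xs -horner_map (@map_psi_at _ _ (j1 \o g) g2 j2).
have jev u : nil u -> (j2 \o j1) (ev (g \o H) u) = ev (g2 \o H) (j2 (j1 u)).
  by move=> nu; rewrite (ev_rmorph (j2 \o j1)).
have := chi_at_hom g2 nX2 nY; rewrite !HE //; last exact: nil_glaw.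
rewrite psi_at_glaw // psiX2 Yt -!jev ?nil_glaw // -rmorphM => <-.
rewrite jev; last exact: nil_glaw.
by rewrite /glaw !rmorphD !rmorphM.
Qed.
End Descent.

Section Kernel.
Variables (p : nat) (p_pr : prime p).
Local Notation W := (witt p_pr).

Lemma E_sub (C : comNzRingType) (w w' : W C) x : islocal p C -> nil x ->
  E w x = E w' x -> E (w - w') x = 1.
Proof.
move=> lC nx e; rewrite (E_add lC) // e -(E_add lC) //.
have -> : w' + - w' = 0 by exact: subrr.
exact: E0.
Qed.

Lemma E_inj (B : comNzRingType) (w w' : W B) : islocal p B ->
  (forall M, E (wmap (tC M B) w) (tX M B) = E (wmap (tC M B) w') (tX M B)) -> w = w'.
Proof.
move=> lB e; apply/eqP; rewrite -subr_eq0; apply/eqP/(E_eq1 lB) => M.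
rewrite wmapB; apply: E_sub (e M); last exact: tX_isnil.
exact: islocal_rmorphism (tC M B) lB.
Qed.

Variables (n l : nat).

Lemma avec_map (B C : comNzRingType) (g : {rmorphism B -> C}) (lam : B) q :
  wmap g (avec l p_pr lam q) = avec l p_pr (g lam) (g \o q).
Proof.
apply: wittP => k /=; case: ifP => _; rewrite rmorphM rmorph_int //.
by rewrite rmorphXn.
Qed.

Lemma gsum_nil (C : comNzRingType) (mu : C) (f : nat -> C) N :
  (forall k, nil (f k)) -> nil (gsum mu f N).
Proof.
move=> nf; elim: N => [|N IH] /=; first by exists 1%N; rewrite expr1.
exact: nil_glaw.
Qed.

Lemma chi_gsum (C : comNzRingType) (lC : islocal p C) (mu : C) (z : W C) f N :
  Flam mu z = 0 -> (forall k, nil (f k)) ->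
  chi lC mu z (gsum mu f N) = \prod_(k < N) chi lC mu z (f k).
Proof.
move=> Fz nf; elim: N => [|N IH] /=; last first.
  by rewrite big_ord_recr /= (chi_hom lC) ?IH //; exact: gsum_nil.
rewrite big_ord0 /chi; have [c ->] := kinv_mul p_pr lC mu 0.
by rewrite mul0r E_nil0.
Qed.

Lemma E_wT_avec (C : comNzRingType) (lC : islocal p C) (lam : C) q (z : W C) y :
  datum p n l lam q -> Flam (lam ^+ (p ^ l)) z = 0 -> nil y ->
  E (wT (avec l p_pr lam q) z) y =
  chi lC (lam ^+ (p ^ l)) z (psi p l lam q).[kap p_pr lam y].
Proof.
move=> D Fz ny; have [m ym] := ny; rewrite (psi_kap p_pr D ym) (E_wT lC _ _ ym).
have na k := nil_avec l p_pr lam q k ny.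
rewrite chi_gsum // => [|k]; last by apply: (nil_kap p_pr lC); exact: na.
by apply: eq_bigr => k _; rewrite /chi kapK //; exact: na.
Qed.

Variables (B : comNzRingType) (lam : B) (q : nat -> B).
Hypothesis D : datum p n l lam q.

Lemma descent (x : W B) : Flam lam x = 0 ->
  (forall (C : comNzRingType) (g : {rmorphism B -> C}) T, (psi_at p l lam q g).[T] = 0 ->
     chi_at D x g T = 1) ->
  exists z, x = wT (avec l p_pr lam q) z.
Proof.
move=> Fx hx; have lB := datum_islocal p_pr D.
have [H [Hhom HE]] := chi_at_ishom Fx hx.
have [z [Fz zE]] := hom_witt p_pr lB Hhom; exists z.
suff key (C : comNzRingType) (g : {rmorphism B -> C}) y : nil y ->
    E (wmap g x) y = E (wmap g (wT (avec l p_pr lam q) z)) y.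
  by apply: (E_inj lB) => M; apply: key; exact: tX_isnil.
move=> ny; have lC := islocal_rmorphism g lB.
have DC := datum_rmorph g D; have nk := nil_kap p_pr lC (g lam) ny.
rewrite wmap_T avec_map (E_wT_avec lC DC) //; last by rewrite -rmorphXn -Flam_rmorph Fz wmap0.
rewrite /chi zE; last by apply: (nil_kinv p_pr lC); exact: psi0_nil.
rewrite -rmorphXn kinvK; last exact: psi0_nil.
by rewrite -(HE _ g _ nk) /chi_at /chi kapK.
Qed.
End Kernel.

(** * Characters of the kernel of psi *)

Section Characters.
Variables (p n l : nat) (p_pr : prime p).
Local Notation W := (witt p_pr).
Variables (B : comNzRingType) (lam : B) (q : nat -> B).
Hypothesis D : datum p n l lam q.
Let lB : islocal p B := datum_islocal p_pr D.
Let p_gt0 : (0 < p)%N := prime_gt0 p_pr.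
Let pl_gt0 : (0 < p ^ l)%N. Proof. by rewrite expn_gt0 p_gt0. Qed.
Local Notation h := (psi p l lam q).
Local Notation Q := (coordN p l lam q).
Let hm : h \is monic. Proof. by case: (size_psi p l lam q). Qed.
Let hd : (size h).-1 = (p ^ l)%N. Proof. by case: (size_psi p l lam q) => ->. Qed.
Let hs : (1 < size h)%N. Proof. by case: (size_psi p l lam q) => -> _. Qed.

Lemma coordN_size (u : Q) : (size (u : {poly B}) <= p ^ l)%N.
Proof. by apply: leq_trans (size_npoly u) _; rewrite (mk_monicE hm hs) hd. Qed.

Lemma coordN_coef0 (u : Q) m : (p ^ l <= m)%N -> (u : {poly B})`_m = 0.
Proof. by move=> lm; rewrite nth_default // (leq_trans (coordN_size u)). Qed.

Lemma evalNE (u : Q) (C : comNzRingType) (g : {rmorphism B -> C}) T :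
  evalN g u T = \sum_(i < p ^ l) g (u : {poly B})`_i * T ^+ i.
Proof.
rewrite /evalN (@horner_coef_wide _ (p ^ l)).
  by apply: eq_bigr => i _; rewrite coef_map.
exact: leq_trans (size_poly _ _) (coordN_size u).
Qed.

Lemma evalN_rmorph (C : comNzRingType) (g : {rmorphism B -> C}) T :
  (psi_at p l lam q g).[T] = 0 ->
  exists k : {rmorphism Q -> C}, [/\ forall u, k u = evalN g u T,
    k (qpolyX h) = T & forall c, k (qpolyC h c) = g c].
Proof.
rewrite /psi_at -psi_map => /(qpoly_lift hm hs)[k kE]; exists k; split.
- by move=> u; rewrite -{1}[u]in_qpoly_val kE.
- by rewrite /qpolyX kE map_polyX hornerX.
- by move=> c; rewrite (qpolyC_in hm hs) kE map_polyC hornerC.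
Qed.

Lemma double_root : exists (C : comNzRingType) (g : {rmorphism B -> C}) (x y : C),
  [/\ (psi_at p l lam q g).[x] = 0, (psi_at p l lam q g).[y] = 0 &
   forall b : nat -> nat -> B,
     \sum_(i < p ^ l) \sum_(j < p ^ l) g (b i j) * x ^+ i * y ^+ j = 0 ->
     forall i j, (i < p ^ l)%N -> (j < p ^ l)%N -> b i j = 0].
Proof.
exists {poly %/ map_poly (qpolyC h) h}, (qpolyC (map_poly (qpolyC h) h) \o qpolyC h),
  (biX h), (biY h); split.
- rewrite /psi_at -psi_map map_poly_comp /biX horner_map qpolyX_root // rmorph0 //.
- rewrite /psi_at -psi_map map_poly_comp /biY qpolyX_root ?biquotient_size //.
  exact: biquotient_monic.
- by have := biquotient_basis hm hs; rewrite hd.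
Qed.

(** In u(x + y + lam x y) neither variable reaches degree p^l, so nothing is reduced modulo psi: the
    identity on N_l x N_l already holds between polynomials. *)
Lemma char_ishom (u : Q) : is_char u -> ishom lam (fun i => (u : {poly B})`_i).
Proof.
case=> -[v uv] hu; set c := fun i => _; have n0 : nil (0 : B) by exists 1%N; rewrite expr1.
have [g0 g0E] : exists g0 : {rmorphism B -> B}, forall b, g0 b = b by exists idfun.
have psi00 : (psi_at p l lam q g0).[0] = 0 by exact: psi0.
have inN_nil (C : comNzRingType) (g : {rmorphism B -> C}) T :
    nil T -> (psi_at p l lam q g).[T] = 0 -> inN p l (g lam) (g \o q) T.
  by move=> nT e; split=> //; exact/nil_unit/nil_mull.
have c_small m : (p ^ l <= m)%N -> c m = 0 by exact: coordN_coef0.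
split.
  have [k [kE _ _]] := evalN_rmorph psi00.
  have ev0 (w : Q) : evalN g0 w 0 = (w : {poly B})`_0.
    rewrite evalNE (bigD1 (Ordinal pl_gt0)) //= expr0 mulr1 g0E big1 ?addr0 // => i.
    by rewrite -val_eqE expr0n => /negPf ->; rewrite mulr0.
  have uu := hu B g0 0 0 (inN_nil _ _ _ n0 psi00) (inN_nil _ _ _ n0 psi00).
  rewrite (_ : glaw _ 0 0 = 0) ?ev0 in uu; last by rewrite /glaw mulr0 !addr0.
  (* The value of u at 0 is idempotent by multiplicativity and invertible because u is a unit, hence
     1. *)
  have e := congr1 k uv; rewrite rmorphM rmorph1 !kE !ev0 -/(c 0%N) in uu e.
  by rewrite -[LHS]mulr1 -e mulrA -uu.
move=> i j; rewrite -[RHS]/(glaw_coef lam c i j).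
have [il|li] := ltnP i (p ^ l); last first.
  rewrite c_small // mul0r /glaw_coef big1 // => m _.
  have [mi|im] := ltnP m i; first by rewrite sig_eq0l.
  by rewrite c_small ?mulr0 ?mul0rn // (leq_trans li).
have [jl|lj] := ltnP j (p ^ l); last first.
  rewrite [c j]c_small // mulr0 /glaw_coef big1 // => m _.
  have [mj|jm] := ltnP m j; first by rewrite sig_eq0r.
  by rewrite c_small ?mulr0 ?mul0rn // (leq_trans lj).
rewrite -(glaw_coef_small lam i j c_small); apply/esym/eqP; rewrite -subr_eq0; apply/eqP.
pose d i j := \sum_(m < p ^ l) lam ^+ (i + j - m) * c m *+ sig i j m - c i * c j.
have [C [g [x [y [x0 y0 basis]]]]] := double_root.
have nroot T : (psi_at p l lam q g).[T] = 0 -> nil T.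
  by move=> e; apply: (psi_at_nil p_pr D (g := g)); rewrite e; exists 1%N; rewrite expr1.
apply: (basis d _ i j il jl).
have := hu C g x y (inN_nil _ _ _ (nroot x x0) x0) (inN_nil _ _ _ (nroot y y0) y0).
rewrite !evalNE (poly_glaw (g lam) x y (g \o c)) mulr_suml => e.
transitivity (\sum_(i < p ^ l) ((\sum_(j < p ^ l)
    (\sum_(m < p ^ l) g lam ^+ (i + j - m) * (g \o c) m *+ sig i j m) * x ^+ i * y ^+ j)
  - g (c i) * x ^+ i * \sum_(j < p ^ l) g (c j) * y ^+ j)); last first.
  by rewrite sumrB e subrr.
apply: eq_bigr => i' _; rewrite mulr_sumr -sumrB; apply: eq_bigr => j' _.
rewrite /d rmorphB rmorph_sum !mulrBl rmorphM; congr (_ - _); last by ring.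
congr (_ * _ * _); apply: eq_bigr => m _.
by rewrite rmorphMn rmorphM rmorphXn.
Qed.

Lemma nil_coordX : nil (qpolyX h).
Proof.
apply: (psi_at_nil p_pr D (g := qpolyC h)); exists 1%N.
by rewrite expr1 /psi_at -psi_map qpolyX_root.
Qed.

Definition theta0 (x : W B) : Q := chi_at D x (qpolyC h) (qpolyX h).

Lemma evalN_theta0 x (C : comNzRingType) (g : {rmorphism B -> C}) T :
  (psi_at p l lam q g).[T] = 0 -> evalN g (theta0 x) T = chi_at D x g T.
Proof.
move=> T0; have [k [<- kX kC]] := evalN_rmorph T0.
by rewrite (chi_at_nat D x kC) ?kX //; exact: nil_coordX.
Qed.

Lemma theta0D x y : theta0 (x + y) = theta0 x * theta0 y.
Proof.
have lQ := islocal_rmorphism (qpolyC h) lB.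
have nk := nil_kinv p_pr (islocal_rmorphism (qpolyC h) (datum_islocal p_pr D))
  (qpolyC h lam) nil_coordX.
by rewrite /theta0 /chi_at /chi wmapD (E_add lQ).
Qed.

Lemma theta00 : theta0 0 = 1.
Proof.
have lQ := islocal_rmorphism (qpolyC h) lB.
rewrite /theta0 /chi_at /chi wmap0; apply: (E0 p_pr lQ).
by apply: (nil_kinv p_pr); exact: nil_coordX.
Qed.

Lemma theta0_char x : Flam lam x = 0 -> is_char (theta0 x).
Proof.
move=> Fx; split; first by exists (theta0 (- x)); rewrite -theta0D subrr theta00.
move=> C g S T [_ S0] [_ T0].
have nroot z : (psi_at p l lam q g).[z] = 0 -> nil z.
  by move=> e; apply: (psi_at_nil p_pr D (g := g)); rewrite e; exists 1%N; rewrite expr1.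
have nS := nroot S S0; have nT := nroot T T0.
rewrite !evalN_theta0 ?(chi_at_hom D) //.
rewrite (psi_at_glaw D) // [(psi_at p l lam q g).[S]]S0 [(psi_at p l lam q g).[T]]T0.
by rewrite /glaw mulr0 !addr0.
Qed.

Lemma theta0_surj u : is_char u -> exists x, [/\ Flam lam x = 0, theta0 x = u &
  forall (C : comNzRingType) (g : {rmorphism B -> C}) T, nil T ->
  chi_at D x g T = \sum_(i < p ^ l) g (u : {poly B})`_i * T ^+ i].
Proof.
move=> /char_ishom hu; have [x [Fx xE]] := hom_witt p_pr lB hu.
have chiE (C : comNzRingType) (g : {rmorphism B -> C}) T : nil T ->
    chi_at D x g T = \sum_(i < p ^ l) g (u : {poly B})`_i * T ^+ i.
  move=> nT; have lC := islocal_rmorphism g (datum_islocal p_pr D).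
  rewrite /chi_at /chi xE; last exact: (nil_kinv p_pr).
  rewrite kinvK //; have [m e] := nT.
  have e' : T ^+ (p ^ l + m) = 0 by rewrite exprD e mulr0.
  rewrite (evE _ e') big_split_ord /= [X in _ + X]big1 ?addr0 // => i _.
  by rewrite coordN_coef0 ?leq_addr // rmorph0 mul0r.
exists x; split=> //; rewrite /theta0 chiE; last exact: nil_coordX.
rewrite -{2}[u]in_qpoly_val (in_qpoly_sum hm hs).
rewrite (big_ord_widen _ (fun i => qpolyC h (u : {poly B})`_i * qpolyX h ^+ i) (coordN_size u)).
rewrite [RHS]big_mkcond; apply: eq_bigr => i _; case: ltnP => // le.
by rewrite nth_default // rmorph0 mul0r.
Qed.
End Characters.

(** * Removing the q_k: reduction modulo annihilators *)

Section AnnihilatorQuotient.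
Variables (B : comNzRingType) (m : B).
Hypothesis m0 : m != 0.

Definition ann : {pred B} := fun b => m * b == 0.

Lemma ann_idealr : idealr_closed ann.
Proof.
split; rewrite ?unfold_in /= ?mulr0 ?mulr1 //= => a u v.
rewrite !unfold_in => /eqP u0 /eqP v0.
by rewrite mulrDr v0 addr0 mulrCA u0 mulr0.
Qed.

HB.instance Definition _ := isIdealr.Build B ann ann_idealr.

Lemma ann_quotient : exists (B' : comNzRingType) (g : {rmorphism B -> B'}),
  forall b, g b = 0 <-> m * b = 0.
Proof.
exists {ideal_quot ann}, (\pi_{ideal_quot ann})%qT => b.
rewrite -(rmorph0 (\pi_{ideal_quot ann})%qT).
split => [/eqP|e]; last (apply/eqP).
  by rewrite -Quotient.idealrBE subr0 => /eqP.
by rewrite -Quotient.idealrBE subr0; apply/eqP.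
Qed.
End AnnihilatorQuotient.

(** Induction on the sum of exponents e_k with m q_k^(e_k) = 0 for all k: passing from m to m q_k
    lowers e_k by one. *)
Lemma nilpotent_descent (B : comNzRingType) (l : nat) (q : nat -> B) (S : B -> Prop) :
  (forall k, (k < l)%N -> nil (q k)) -> S 0 ->
  (forall m, m != 0 -> (forall k, (k < l)%N -> S (m * q k)) -> S m) -> S 1.
Proof.
move=> nq S0 step.
suff H N (e : nat -> nat) m : (\sum_(k < l) e k <= N)%N ->
    (forall k, (k < l)%N -> m * q k ^+ e k = 0) -> S m.
  pose e k := if pselect (nil (q k)) is left h then projT1 (cid h) else 0%N.
  apply: (H _ e 1 (leqnn _)) => k kl; rewrite mul1r /e; case: pselect => [h|[]].
    exact: projT2 (cid h).
  exact: nq.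
elim: N e m => [|N IH] e m eN h; have [->//|m0] := eqVneq m 0; apply: step => // k kl.
  have /eqP := h k kl; suff -> : e k = 0%N by rewrite expr0 mulr1 (negPf m0).
  by move: eN; rewrite leqn0 (bigD1 (Ordinal kl)) //= addn_eq0 => /andP[/eqP].
have ek : (0 < e k)%N.
  by rewrite lt0n; apply/eqP => e0; move: (h k kl) m0; rewrite e0 mulr1 => ->; rewrite eqxx.
apply: (IH (fun i => if i == k then (e i).-1 else e i)).
  move: eN; rewrite (bigD1 (Ordinal kl)) //= [X in (X <= N)%N](bigD1 (Ordinal kl)) //= eqxx.
  set s := (\sum_(i < l | _) _)%N; set s' := (\sum_(i < l | _) _)%N.
  have -> : s' = s by apply: eq_bigr => i; rewrite -val_eqE /= => /negPf ->.
  by move: ek; clear; lia.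
move=> i il; case: eqP => [->|_]; first by rewrite -mulrA -exprS prednK // h.
by rewrite mulrAC h // mul0r.
Qed.

Section KillTorsion.
Variables (p n l : nat) (p_pr : prime p) (l_gt0 : (0 < l)%N).
Local Notation W := (witt p_pr).
Let p_gt0 : (0 < p)%N := prime_gt0 p_pr.
Let pl_gt0 : (0 < p ^ l)%N. Proof. by rewrite expn_gt0 p_gt0. Qed.
Variables (B : comNzRingType) (lam : B) (q : nat -> B).
Hypothesis D : datum p n l lam q.
Variable (z : W B).
Hypothesis qz : forall k j, (k < l)%N -> q k * z j = 0.
Local Notation a := (avec l p_pr lam q).
Local Notation c := (((p ^ l)%:R : W int) : nat -> int).

(** As l > 0, p is itself a multiple of q_(l-1): [lam_pow_qx] at k = l, where [qx] is 1, reads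
    lam^(p^l - p^(l-1)) q_(l-1) = p. *)
Lemma p_kills j : p%:R * z j = 0.
Proof.
have := lam_pow_qx p_pr D (k := l) (v := l.-1); rewrite leq_pred leqnn => /(_ isT).
rewrite /qx prednK // leqnn ltnn mulr1 (_ : (l - l.-1 = 1)%N); last by lia.
by rewrite expn1 => <-; rewrite -mulrA qz ?mulr0 // prednK.
Qed.

Lemma p_multiple_kills (d : int) j : (p%:Z %| d)%Z -> d%:~R * z j = 0.
Proof. by case/dvdzP => e ->; rewrite intrM -mulrA -pmulrn p_kills mulr0. Qed.

(** For k < l the factor q_k kills z; for k > l the integer factor is a multiple of p. *)
Lemma teich_avec_mul k : k <> l -> teich p_pr (a k) * z = 0.
Proof.
move=> kl; apply: wittP => j; rewrite teichM_comp [RHS]/(0 : B) -(prednK (_ : 0 < p ^ j)%N).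
  rewrite exprS mulrAC -[RHS](mul0r (a k ^+ (p ^ j).-1)); congr (_ * _).
  rewrite /= ; case: ltnP => kl'; first by rewrite -mulrA qz ?mulr0.
  by rewrite mulrAC p_multiple_kills ?mul0r // pow_comp_gt //; lia.
by rewrite expn_gt0 p_gt0.
Qed.

Lemma teich_avec_l : teich p_pr (a l) * z = z.
Proof.
apply: wittP => j; rewrite teichM_comp /= ltnn subnn expr0 mulr1.
have e : (c l)%:~R * z j = z j.
  apply/eqP; rewrite -subr_eq0 -{2}[z j]mul1r -mulrBl.
  have -> : (c l)%:~R - 1 = (c l - 1)%:~R :> B by rewrite intrB.
  by rewrite p_multiple_kills // pow_comp_l.
by elim: (p ^ j)%N => [|i IH]; rewrite ?expr0 ?mul1r // exprS -mulrA IH.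
Qed.

Lemma E_wT_top (C : comNzRingType) (g : {rmorphism B -> C}) y : nil y ->
  E (wmap g (wT a z)) y = E (wmap g z) (y ^+ (p ^ l)).
Proof.
move=> [m e]; have lC := islocal_rmorphism g (datum_islocal p_pr D).
have e' : y ^+ (l.+1 + m) = 0 by rewrite exprD e mulr0.
rewrite wmap_T (E_wT lC _ _ e').
have il : (l < l.+1 + m)%N by rewrite ltnS leq_addr.
have ny k : nil (y ^+ (p ^ k)) by apply: nil_exp; [exists m | rewrite expn_gt0 p_gt0].
rewrite (bigD1 (Ordinal il)) //= big1 ?mulr1 => [|k kl].
  by rewrite -(E_teichM lC) // -wmap_teich -wmapM teich_avec_l.
rewrite -(E_teichM lC) // -wmap_teich -wmapM teich_avec_mul ?wmap0 ?(E0 p_pr lC) //.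
by move=> kE; move/negP: kl; apply; rewrite -val_eqE /= kE.
Qed.

Variable (u : nat -> B).
Hypothesis uE : forall (C : comNzRingType) (lC : islocal p C) (g : {rmorphism B -> C}) T,
  nil T -> chi lC (g lam) (wmap g (wT a z)) T = \sum_(i < p ^ l) g (u i) * T ^+ i.

Lemma u_const (C : comNzRingType) (g : {rmorphism B -> C}) T :
  \sum_(i < p ^ l) g (u i) * T ^+ i = 1.
Proof.
(* Truncation at degree p^l is long enough to show all coefficients of u, and short enough that the
   p^l-th power of [kinv] of t is 0. *)
pose M := (p ^ l).-1; have ME : M.+1 = (p ^ l)%N by rewrite prednK.
have lT := islocal_rmorphism (tC M B) (datum_islocal p_pr D).
have nt := tX_isnil M B; have := uE lT (tC M B) nt.
rewrite /chi E_wT_top; last exact: (nil_kinv p_pr).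
have [d ->] := kinv_mul p_pr lT (tC M B lam) (tX M B).
rewrite exprMn -ME tX_nil mul0r E_nil0 // => e.
have uk k : (k < M.+1)%N -> u k = (k == 0)%N%:R.
  move=> kM; have := congr1 (fun v : trunc M B => (v : {poly B})`_k) e.
  rewrite poly_of_qpoly_sum coef_sum (bigD1 (Ordinal kM)) //= coef_tCX // eqxx.
  rewrite big1 ?addr0 => [<-|i]; last by rewrite -val_eqE /= coef_tCX // eq_sym => /negPf ->.
  by rewrite coef1.
rewrite big_ord_recl uk // rmorph1 mul1r expr0 big1 ?addr0 // => i _.
by rewrite uk ?rmorph0 ?mul0r // ltnS ltn_ord.
Qed.

(** Since u is constant, E(z, y^(p^l)) = 1 at all nilpotent y; adjoining a p^l-th root of s, a free
    extension, gives E(z, s) = 1 at every nilpotent s. *)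
Lemma killed_eq0 : z = 0.
Proof.
have lB := datum_islocal p_pr D.
have Ez (C : comNzRingType) (g : {rmorphism B -> C}) y : nil y ->
    E (wmap g z) (y ^+ (p ^ l)) = 1.
  move=> ny; have lC := islocal_rmorphism g lB; rewrite -E_wT_top //.
  have nk := nil_kap p_pr lC (g lam) ny.
  by have := uE lC g nk; rewrite u_const /chi kapK.
suff key (C : comNzRingType) (g : {rmorphism B -> C}) s : nil s -> E (wmap g z) s = 1.
  by apply: (E_eq1 lB) => M; apply: key; exact: tX_isnil.
move=> ns; have hs : (1 < size ('X^(p ^ l) - s%:P : {poly C})%R)%N.
  by rewrite size_XnsubC.
have [C' [j [X [X0 basis _ _]]]] := adjoin_root (monicXnsubC s pl_gt0) hs.
have Xs : X ^+ (p ^ l) = j s.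
  apply/eqP; rewrite -subr_eq0 -X0 rmorphB /= map_polyXn map_polyC.
  by rewrite hornerD hornerN hornerC hornerXn.
have nX : nil X.
  have [m e] := nil_rmorph j ns; exists (p ^ l * m)%N.
  by rewrite exprM Xs.
have lC := islocal_rmorphism g lB.
have := Ez _ (j \o g) X nX; rewrite Xs -wmap_comp -(E_rmorph lC) //.
set b := E _ _ => jb; apply/eqP; rewrite -subr_eq0; apply/eqP.
apply: (basis (fun i => if i is 0%N then b - 1 else 0) _ 0%N); last first.
  by rewrite size_XnsubC.
rewrite big1 // => -[[|i] il] _ /=; last by rewrite rmorph0 mul0r.
by rewrite rmorphB jb rmorph1 subrr mul0r.
Qed.
End KillTorsion.

Section ThetaKernel.
Variables (p n l : nat) (p_pr : prime p) (l_gt0 : (0 < l)%N).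
Local Notation W := (witt p_pr).
Variables (B : comNzRingType) (lam : B) (q : nat -> B).
Hypothesis D : datum p n l lam q.
Local Notation a := (avec l p_pr lam q).

Lemma theta0_eq1 (x : W B) : Flam lam x = 0 -> theta0 D x = 1 -> exists z, x = wT a z.
Proof.
move=> Fx x1; apply: (descent (D := D) Fx) => C g T T0.
by rewrite -(evalN_theta0 D) // x1; have [k [<- _ _]] := evalN_rmorph p_pr T0; rewrite rmorph1.
Qed.

Lemma theta0_sub (x y : W B) : theta0 D x = theta0 D y -> theta0 D (x - y) = 1.
Proof. by move=> e; rewrite theta0D e -theta0D subrr theta00. Qed.

(* Let x' be the Witt vector attached to the character of T_a z; it is T_a z2
   for some z2. If m q_k z2 = 0 for all k, then over B / Ann(m) only the l-th
   component of a acts on z2, so the character of x' is trivial on points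
   killed by the p^l-th power; having degree < p^l, it is 1, and z2 = 0 there.
   Since the q_k are nilpotent, this yields z2 = 0. *)
Lemma theta0_image (z : W B) : Flam lam (wT a z) = 0 -> theta0 D (wT a z) = 1.
Proof.
move=> Fx; have [x' [Fx' x'E uE]] := theta0_surj p_pr D (theta0_char D Fx).
set u := theta0 D (wT a z) in x'E uE *.
have [|z' z'E] := theta0_eq1 (x := wT a z - x') _ (theta0_sub (esym x'E)).
  by rewrite raddfB /= Fx Fx' subrr.
pose z2 := z - z'; have x'T : x' = wT a z2 by rewrite raddfB /= -z'E opprB addrC subrK.
suff S1 : forall j, 1 * z2 j = 0.
  rewrite -x'E x'T (_ : z2 = 0) ?raddf0 ?theta00 //.
  by apply: wittP => j; rewrite -[LHS]mul1r S1.
apply: (nilpotent_descent (datum_nil D) (S := fun m => forall j, m * z2 j = 0)).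
  by move=> j; rewrite mul0r.
move=> m m0 mq j; have [B' [g gE]] := ann_quotient m0; apply/gE.
have DB' := datum_rmorph g D.
suff e : wmap g z2 = 0 by exact: (congr1 (fun w : W B' => w j) e).
apply: (killed_eq0 l_gt0 DB' _ (u := fun i => g (u : {poly B})`_i)).
  by move=> k i kl /=; rewrite -rmorphM; apply/gE; rewrite mulrA mq.
move=> C lC g' T nT; have := uE C (g' \o g) T nT.
rewrite /chi_at (Prop_irrelevance (islocal_rmorphism _ _) lC) => <-.
by rewrite -avec_map -wmap_T -x'T wmap_comp.
Qed.
End ThetaKernel.

(** * The isomorphism and its naturality *)

Section Duality.
Variables (p n l : nat) (p_pr : prime p) (l_gt0 : (0 < l)%N).
Local Notation W := (witt p_pr).
Variables (B : comNzRingType) (lam : B) (q : nat -> B).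
Hypothesis D : datum p n l lam q.
Local Notation cl := (@clW p l p_pr B lam q).

(** If F^(lam) x = F^(lam)(T_a u), then x - T_a u represents the same class and is killed by F^(lam)
    itself. *)
Lemma Fbar_rep (c : cokT l p_pr lam q) : Fbar c = 0 ->
  exists x : W B, Flam lam x = 0 /\ cl x = c.
Proof.
elim/coker_ind: c => x; rewrite /Fbar coker_mapE => Fx.
have /to_cokerP[u e] : to_coker (Flam lam \o wT (avec l p_pr lam q)) (Flam lam x) =
    to_coker (Flam lam \o wT (avec l p_pr lam q)) 0 by rewrite Fx raddf0.
exists (x - wT (avec l p_pr lam q) u); split.
  by rewrite raddfB /= -[Flam lam (wT _ u)]e subr0 subrr.
by apply/to_cokerP; exists (- u); rewrite addrAC subrr add0r raddfN.
Qed.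

Lemma Fbar_cl (x : W B) : Flam lam x = 0 -> Fbar (cl x) = 0.
Proof. by move=> Fx; rewrite /Fbar /clW coker_mapE /= Fx raddf0. Qed.

(** The value 1 is a default outside the kernel of [Fbar]; inside, independence of the
    representative rests on [theta0_image]. *)
Definition theta (c : cokT l p_pr lam q) : coordN p l lam q :=
  if pselect (exists x : W B, Flam lam x = 0 /\ cl x = c) is left h
  then theta0 D (projT1 (cid h)) else 1.

Lemma theta0_eq (x y : W B) : Flam lam x = 0 -> Flam lam y = 0 -> cl x = cl y ->
  theta0 D x = theta0 D y.
Proof.
move=> Fx Fy /to_cokerP[u e]; rewrite -[x](subrK y) theta0D e theta0_image ?mul1r //.
by rewrite -e raddfB /= Fx Fy subrr.
Qed.

Lemma thetaE (x : W B) : Flam lam x = 0 -> theta (cl x) = theta0 D x.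
Proof.
move=> Fx; rewrite /theta; case: pselect => [h|[]]; last by exists x.
by case: (cid h) => y [Fy e] /=; apply: theta0_eq.
Qed.

Lemma thetaD x y : Fbar x = 0 -> Fbar y = 0 -> theta (x + y) = theta x * theta y.
Proof.
move=> /Fbar_rep[x' [Fx <-]] /Fbar_rep[y' [Fy <-]].
rewrite /clW -raddfD !thetaE ?theta0D //.
by rewrite raddfD /= Fx Fy addr0.
Qed.

Lemma theta_inj x y : Fbar x = 0 -> Fbar y = 0 -> theta x = theta y -> x = y.
Proof.
move=> /Fbar_rep[x' [Fx <-]] /Fbar_rep[y' [Fy <-]]; rewrite !thetaE // => e.
have [|z zE] := theta0_eq1 (D := D) (x := x' - y') _ (theta0_sub e).
  by rewrite raddfB /= Fx Fy subrr.
by apply/to_cokerP; exists z.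
Qed.

Lemma theta_image u : is_char u <-> exists2 x, Fbar x = 0 & theta x = u.
Proof.
split=> [/(theta0_surj p_pr D)[x [Fx xu _]]|[x /Fbar_rep[x' [Fx <-]] <-]].
  by exists (cl x); [exact: Fbar_cl | rewrite thetaE].
by rewrite thetaE //; exact: theta0_char.
Qed.
End Duality.

Section Naturality.
Variables (p n l : nat) (p_pr : prime p).
Local Notation W := (witt p_pr).

(** [theta0] is chi at the generic point of N_l, and base change of coordinate rings takes generic
    point to generic point. *)
Lemma theta0_map (B B' : comNzRingType) (h : {rmorphism B -> B'}) (lam : B) q
  (D : datum p n l lam q) lam' q' (D' : datum p n l lam' q') (x : W B) :
  h lam = lam' -> h \o q = q' ->
  theta0 D' (wmap h x) = in_qpoly (psi p l lam' q') (map_poly h (theta0 D x : {poly B})).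
Proof.
move=> el eq; subst lam' q'; set g := psi p l lam q; set g' := psi p l (h lam) (h \o q).
have [sz gm] : size g = (p ^ l).+1 /\ g \is monic by exact: size_psi.
have [sz' gm'] : size g' = (p ^ l).+1 /\ g' \is monic by exact: size_psi.
have pl0 : (0 < p ^ l)%N by rewrite expn_gt0 prime_gt0.
have gs : (1 < size g)%N by rewrite sz.
have gs' : (1 < size g')%N by rewrite sz'.
have g0 : (map_poly (qpolyC g' \o h) g).[qpolyX g'] = 0.
  by rewrite map_poly_comp psi_map qpolyX_root.
have [k kE] := qpoly_lift gm gs g0.
have kC c : k (qpolyC g c) = qpolyC g' (h c).
  by rewrite (qpolyC_in gm gs) kE map_polyC hornerC.
have kX : k (qpolyX g) = qpolyX g' by rewrite /qpolyX kE map_polyX hornerX.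
transitivity (k (theta0 D x)); last first.
  by rewrite -{1}[theta0 D x]in_qpoly_val kE map_poly_comp -in_qpoly_horner.
have lQ' := islocal_rmorphism (qpolyC g') (datum_islocal p_pr D').
rewrite /theta0 /chi_at (chi_rmorph _ lQ'); last exact: (nil_coordX p_pr D).
rewrite kC kX (Prop_irrelevance (islocal_rmorphism _ _) lQ').
congr (chi _ _ _ _); apply: wittP => i /=; exact: (esym (kC _)).
Qed.
End Naturality.

Theorem theorem3
  (p n l : nat) (p_pr : prime p) (n_gt0 : (0 < n)%N) (l_gt0 : (0 < l)%N)
  (A : comNzRingType) (pn0 : (p%:R : A) ^+ n = 0)
  (lam : A) (q : nat -> A)
  (qE : forall k, (k < l)%N ->
     q k * lam ^+ (p ^ l) = (p ^ (l - k))%:R * lam ^+ (p ^ k))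
  (q_nil : forall k, (k < l)%N -> exists N : nat, q k ^+ N = 0)
  (q_lam0 : lam = 0 -> forall k, (k < l)%N -> q k = 0)
  (psiH : psi_hom p l lam q) :
  exists theta : forall (B : comNzRingType) (f : {rmorphism A -> B}),
      cokT l p_pr (f lam) (f \o q) -> coordN p l (f lam) (f \o q),
    (forall (B : comNzRingType) (f : {rmorphism A -> B}),
      [/\ forall x y, Fbar x = 0 -> Fbar y = 0 ->
            theta B f (x + y) = theta B f x * theta B f y,
          forall x y, Fbar x = 0 -> Fbar y = 0 ->
            theta B f x = theta B f y -> x = y
        & forall u, is_char u <-> exists2 x, Fbar x = 0 & theta B f x = u])
    /\
    (forall (B B' : comNzRingType) (f : {rmorphism A -> B})
        (f' : {rmorphism A -> B'}) (h : {rmorphism B -> B'}),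
      (forall a, h (f a) = f' a) ->
      forall x : witt p_pr B, Fbar (clW l (f lam) (f \o q) x) = 0 ->
        theta B' f' (clW l (f' lam) (f' \o q) (wmap h x)) =
        in_qpoly (psi p l (f' lam) (f' \o q))
          (map_poly h (theta B f (clW l (f lam) (f \o q) x) : {poly B}))).
Proof.
have D : datum p n l lam q by split.
exists (fun B f => theta (datum_rmorph f D)); split.
  move=> B f; split.
  - exact: thetaD.
  - exact: theta_inj.
  - exact: theta_image.
(* Naturality is checked on a representative y killed by F^(lam), which x itself need not be. *)
move=> B B' f f' h hf x /Fbar_rep[y [Fy ye]].
have el : h (f lam) = f' lam by exact: hf.
have eq : h \o (f \o q) = f' \o q by apply/funext => k; exact: hf.
have Fhy : Flam (f' lam) (wmap h y) = 0 by rewrite -el -Flam_rmorph Fy wmap0.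
rewrite -ye (thetaE l_gt0 (datum_rmorph f D) Fy) -(theta0_map (datum_rmorph f D) (datum_rmorph f' D)) //.
rewrite -(thetaE l_gt0 (datum_rmorph f' D) Fhy); congr theta; apply/to_cokerP.
have /to_cokerP[u xu] := ye; exists (- wmap h u).
rewrite -wmapB -opprB xu -raddfN wmap_T avec_map el eq; congr (wT _ _).
exact: wmap_opp.
Qed.
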